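(* Assume that $(\beta_n,h_n)\to(\beta_0,h_0)$ with $\beta_n-\beta_0=o(n^{-3/4})$ and $h_n-h_0=o(n^{-3/4})$, and let $\boldsymbol{x}=\left(\frac12,\frac1{2(q-1)},\ldots,\frac1{2(q-1)}\right)$, which is the unique minimizer of $f_{\beta_0,h_0}$ in $\Omega$. Let $\boldsymbol{u}=(1-q,1,\ldots,1)\in\mathbb{R}^q$. Let the random variables $T\in\mathbb{R}$ and $\boldsymbol{V}\in\mathcal{H}\cap\boldsymbol{u}^{\perp}$ be defined by $$\boldsymbol{N}=n\boldsymbol{x}+n^{3/4}T\boldsymbol{u}+n^{1/2}\boldsymbol{V},$$ where $\boldsymbol{N}$ is distributed according to $\mu_{\beta_n,h_n,n}$. Then $(T,\boldsymbol{V})$ converges in law as $n\to\infty$, and the limit has the following properties: (i) $T$ and $\boldsymbol{V}$ are asymptotically independent (independent in the limit law). (ii) $T$ converges in law to the probability measure on $\mathbb{R}$ proportional to $\exp\left(-\frac{4(q-1)^4}{3}t^4\right)dt$. (iii) $\boldsymbol{V}$ converges in law to the centered Gaussian vector with covariance matrix $$\frac{q}{2(q-1)^2(q-2)}\begin{pmatrix}0&0&\cdots&0\\0&q-2&&-1\\\vdots&&\ddots&\\0&-1&&q-2\end{pmatrix}$$ of rank $q-2$ (inside the matrix: first row and first column zero; the $(i,i)$ entries equal $q-2$ for $i\ge2$; the $(i,j)$ entries equal $-1$ for $i\ne j$, $i,j\ge2$).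
   Context: $q\ge 2$ is a fixed integer. For $q=2$ the space $\mathcal{H}\cap\boldsymbol{u}^\perp$ is $\{0\}$, so $\boldsymbol{V}=0$ and the covariance matrix in (iii) is understood as the zero matrix. The Curie-Weiss Potts model: for $n\ge1$ and real $\beta,h$, $\mu_{\beta,h,n}$ is the probability measure on $\{1,\ldots,q\}^n$ given by $$\mu_{\beta,h,n}(\sigma)=\frac1{Z_{\beta,h,n}}\exp\Big(\frac{\beta}{n}\sum_{1\le i<j\le n}\delta_{\sigma_i,\sigma_j}+h\sum_{i=1}^n\delta_{\sigma_i,1}\Big),$$ with $\delta$ the Kronecker symbol and $Z_{\beta,h,n}$ the normalizing constant. The empirical vector is $\boldsymbol{N}=(N_1,\ldots,N_q)$ with $N_k=\sum_{i=1}^n\delta_{\sigma_i,k}$. $\Omega=\{\boldsymbol{x}\in\mathbb{R}^q: x_1+\cdots+x_q=1,\ x_i\ge0\ \forall i\}$. The free energy is $f_{\beta,h}(\boldsymbol{x})=\sum_{i=1}^q x_i\log x_i-\frac{\beta}{2}\sum_{i=1}^q x_i^2-hx_1$ for $\boldsymbol{x}\in\Omega$, with $0\log0=0$. $\mathcal{H}=\{\boldsymbol{w}\in\mathbb{R}^q:\sum_{i=1}^q w_i=0\}$, and $\boldsymbol{u}^\perp$ is the space of vectors orthogonal to $\boldsymbol{u}$ in Euclidean $\mathbb{R}^q$. Finally $\beta_0=4\frac{q-1}{q}$ and $h_0=\log(q-1)-2\frac{q-2}{q}$. *)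

(* Defs.v *)
From HB Require Import structures.
From mathcomp Require Import all_boot all_order all_algebra.
From mathcomp Require Import all_classical all_reals all_analysis.
From mathcomp Require Import ring lra.

Set Implicit Arguments.
Unset Strict Implicit.
Unset Printing Implicit Defensive.

Import Order.TTheory GRing.Theory Num.Theory.
Import numFieldNormedType.Exports.

Local Open Scope classical_set_scope.
Local Open Scope ring_scope.

(* Coordinates and spins 1, ..., q are the ordinals 0, ..., q.-1 of 'I_q; the
   distinguished one is the ordinal of value 0. *)
Definition config (n q : nat) := {ffun 'I_n -> 'I_q}.

Section CurieWeissPotts.
Context {R : realType} {q : nat}.
Implicit Types (beta h : R) (n : nat).

Definition potts_energy beta h n (s : config n q) : R :=
  beta / n%:R * \sum_(i < n) \sum_(j < n | (i < j)%N) (s i == s j)%:R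
  + h * \sum_(i < n) (s i == 0%N :> nat)%:R.

Definition potts_Z beta h n : R :=
  \sum_(s : config n q) expR (potts_energy beta h s).

Definition potts_mu beta h n (s : config n q) : R :=
  (potts_Z beta h n)^-1 * expR (potts_energy beta h s).

Definition empirical n (s : config n q) : 'rV[R]_q :=
  \row_k \sum_(i < n) (s i == k)%:R.

Definition simplex : set 'rV[R]_q :=
  [set x | \sum_i x 0 i = 1 /\ forall i, 0 <= x 0 i].

(* The convention 0 log 0 = 0 holds since the product vanishes. *)
Definition free_energy beta h (x : 'rV[R]_q) : R :=
  \sum_i x 0 i * ln (x 0 i) - beta / 2 * \sum_i x 0 i ^+ 2
  - h * \sum_(i < q | i == 0%N :> nat) x 0 i.

Definition unique_minimizer (A : set 'rV[R]_q) (f : 'rV[R]_q -> R) x :=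
  A x /\ forall y, A y -> y <> x -> f x < f y.

Definition dot (x y : 'rV[R]_q) : R := \sum_i x 0 i * y 0 i.

Definition hyperplane : set 'rV[R]_q := [set w | \sum_i w 0 i = 0].

Definition orthogonal_to (u : 'rV[R]_q) : set 'rV[R]_q := [set w | dot w u = 0].

Definition x_star : 'rV[R]_q :=
  \row_i (if i == 0%N :> nat then 2^-1 else (2 * (q%:R - 1))^-1).

Definition u_vec : 'rV[R]_q :=
  \row_i (if i == 0%N :> nat then 1 - q%:R else 1).

Definition TV_decomposition n (s : config n q) (t : R) (v : 'rV[R]_q) :=
  (hyperplane `&` orthogonal_to u_vec) v /\
  empirical s = n%:R *: x_star + (n%:R `^ (3 / 4) * t) *: u_vec
                + n%:R `^ (1 / 2) *: v.

(* For q = 2 the covariance matrix is the zero matrix by convention. *)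
Definition V_covariance : 'M[R]_q :=
  if q == 2%N then 0 else
  (q%:R / (2 * (q%:R - 1) ^+ 2 * (q%:R - 2))) *:
  \matrix_(i, j) (if (i == 0%N :> nat) || (j == 0%N :> nat) then 0
                  else if i == j then q%:R - 2 else -1).

End CurieWeissPotts.

Section decomposition.
Context {R : realType} {q : nat}.

Let i0 (hq : (2 <= q)%N) : 'I_q := Ordinal (ltnW hq).

Let sum_split (hq : (2 <= q)%N) (a b : R) :
  \sum_(i < q) (if i == 0%N :> nat then a else b) = a + b * (q%:R - 1).
Proof.
rewrite (bigD1 (i0 hq)) //=; congr (_ + _).
rewrite (eq_bigr (fun=> b)) => [|i]; last first.
  by rewrite -val_eqE /= => /negPf ->.
rewrite sumr_const cardC1 card_ord -[b *+ _]mulr_natr; congr (_ * _).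
by rewrite -[in RHS](prednK (ltnW hq)) -natr1 addrK.
Qed.

Let sum_u (hq : (2 <= q)%N) : \sum_i @u_vec R q 0 i = 0.
Proof.
under eq_bigr do rewrite mxE.
by rewrite sum_split //; ring.
Qed.

Let q_gt1 (hq : (2 <= q)%N) : 1 < q%:R :> R.
Proof. by rewrite ltr1n. Qed.

Let sum_x (hq : (2 <= q)%N) : \sum_i @x_star R q 0 i = 1.
Proof.
under eq_bigr do rewrite mxE.
rewrite sum_split //; have := q_gt1 hq => h; field.
by rewrite subr_eq0 gt_eqF.
Qed.

Let dot_uu (hq : (2 <= q)%N) : dot (@u_vec R q) u_vec != 0.
Proof.
rewrite /dot (eq_bigr (fun i : 'I_q => if i == 0%N :> nat then
  (1 - q%:R) * (1 - q%:R) else 1 : R)); last first.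
  by move=> i _; rewrite !mxE; case: ifP; rewrite ?mulr1.
rewrite sum_split // mul1r gt_eqF //.
have := q_gt1 hq; nra.
Qed.

Let sum_empirical n (s : config n q) :
  \sum_i @empirical R q n s 0 i = n%:R.
Proof.
under eq_bigr do rewrite mxE.
rewrite exchange_big /= (eq_bigr (fun=> 1)) => [|i _].
  by rewrite sumr_const card_ord.
rewrite (bigD1 (s i)) //= eqxx big1 ?addr0 // => k.
by rewrite eq_sym => /negPf ->.
Qed.

Let dotDl (x y z : 'rV[R]_q) : dot (x + y) z = dot x z + dot y z.
Proof. by rewrite /dot -big_split; apply: eq_bigr => i _; rewrite mxE mulrDl. Qed.

Let dotZl a (x z : 'rV[R]_q) : dot (a *: x) z = a * dot x z.
Proof. by rewrite /dot mulr_sumr; apply: eq_bigr => i _; rewrite mxE mulrA. Qed.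

(* The decomposition does define the random variables T and V. *)
Lemma TV_decomposition_unique n (s : config n q) : (2 <= q)%N -> (0 < n)%N ->
  exists! tv : R * 'rV[R]_q, TV_decomposition s tv.1 tv.2.
Proof.
move=> hq n0; have nR : 0 < n%:R :> R by rewrite ltr0n.
have := powR_gt0 (3 / 4) nR; have := powR_gt0 (1 / 2) nR.
rewrite /TV_decomposition.
move: (n%:R `^ (3 / 4)) (n%:R `^ (1 / 2)) => a b b0 a0.
have a0' := lt0r_neq0 a0; have b0' := lt0r_neq0 b0.
pose d : 'rV[R]_q := empirical s - n%:R *: x_star.
pose t := dot d u_vec / (a * dot (@u_vec R q) u_vec).
pose v := b^-1 *: (d + (- (a * t)) *: u_vec).
exists (t, v); split=> [/=|[t' v'] /= [[v'H v'u] E]].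
  split; first split => /=.
  - rewrite /hyperplane /= /v.
    under eq_bigr do rewrite !mxE.
    rewrite -mulr_sumr big_split /= -mulr_sumr.
    have -> : \sum_(i < q) (if i == 0%N :> nat then 1 - q%:R else 1 : R) = 0.
      by rewrite -[RHS](sum_u hq); apply: eq_bigr => i _; rewrite mxE.
    rewrite mulr0 addr0 sumrB.
    have -> : \sum_(k < q) \sum_(i < n) (s i == k)%:R = n%:R :> R.
      rewrite -[RHS](sum_empirical s).
      by apply: eq_bigr => i _; rewrite mxE.
    rewrite -mulr_sumr.
    have -> : \sum_(i < q)
        (if i == 0%N :> nat then 2^-1 else (2 * (q%:R - 1))^-1) = 1 :> R.
      by rewrite -[RHS](sum_x hq); apply: eq_bigr => i _; rewrite mxE.
    by rewrite mulr1 subrr mulr0.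
  - rewrite /orthogonal_to /= /v dotZl dotDl dotZl /t.
    have := dot_uu hq; move: (dot _ _) (dot _ _) => x y y0.
    by field; rewrite a0' b0' y0.
  - rewrite /v scalerA mulfV // scale1r scaleNr /d.
    move: ((a * t) *: u_vec) (n%:R *: x_star) => y z.
    by rewrite -[_ - z - y]addrA -opprD subrKC.
have dE : d = (a * t') *: u_vec + b *: v'.
  by rewrite /d E -[_ + b *: v']addrA [_ + (_ + _)]addrC addrK.
have tE : t = t'.
  rewrite /t dE dotDl !dotZl v'u mulr0 addr0.
  by field; rewrite a0' dot_uu.
congr pair => //.
rewrite /v tE dE scaleNr [_ + b *: v']addrC addrK scalerA mulVf // scale1r //.
Qed.

End decomposition.

Definition beta0 (R : realType) (q : nat) : R := 4 * ((q%:R - 1) / q%:R).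

Definition h0 (R : realType) (q : nat) : R :=
  ln (q%:R - 1) - 2 * ((q%:R - 2) / q%:R).

HB.instance Definition _ (T1 T2 : ptopologicalType) :=
  Pointed.on (T1 * T2)%type.

(* T with its Borel sigma-algebra *)
Definition borel (T : ptopologicalType) := g_sigma_algebraType (@open T).

(* Convergence in law to L of random elements X n of T, each defined on the
   finite probability space Om n whose elements w have probability P n w. *)
Definition cvg_in_law (R : realType) (T : ptopologicalType)
    (Om : nat -> finType) (P : forall n, Om n -> R) (X : forall n, Om n -> T)
    (L : probability (borel T) R) :=
  forall g : T -> R, continuous g -> (exists M, forall x, `|g x| <= M) ->
    (\sum_(w : Om n) P n w * g (X n w)) @[n --> \oo]
      --> (\int[L]_(x in setT) g x).

Section limit_laws.
Context {R : realType}.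

Definition product_law (T1 T2 : ptopologicalType)
    (L : probability (borel (T1 * T2)%type) R)
    (L1 : probability (borel T1) R) (L2 : probability (borel T2) R) :=
  forall (A : set (borel T1)) (B : set (borel T2)),
    measurable A -> measurable B -> L (A `*` B) = (L1 A * L2 B)%E.

Definition proportional_density (L : probability (borel R) R) (f : R -> R) :=
  exists2 k : R, 0 < k & forall A : set (borel R), measurable A ->
    L A = (\int[@lebesgue_measure R]_(t in (A : set R)) (k * f t)%:E)%E.

(* Normal law of mean m and standard deviation s, where s = 0 gives the Dirac
   mass at m (normal_prob m 0 is not this law). *)
Definition gaussian_law (m s : R) (A : set R) : \bar R :=
  if s == 0 then \d_m A else normal_prob m s A.

Definition gaussian_vector (q : nat) (L : probability (borel 'rV[R]_q) R) :=
  forall a : 'rV[R]_q, exists m s, 0 <= s /\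
    forall A : set R, measurable A ->
      L [set x | A (dot a x)] = gaussian_law m s A.

Definition centered_gaussian (q : nat) (L : probability (borel 'rV[R]_q) R)
    (S : 'M[R]_q) :=
  [/\ gaussian_vector L,
      forall i, ('E_L[fun x : 'rV[R]_q => x 0%R i])%E = 0%E &
      forall i j, covariance L (fun x : 'rV[R]_q => x 0 i)
                               (fun x : 'rV[R]_q => x 0 j) = (S i j)%:E].

End limit_laws.

(* Main.v *)
From HB Require Import structures.
Require Import Defs.
From mathcomp Require Import all_boot all_order all_algebra.
From mathcomp Require Import all_classical all_reals all_analysis.
From mathcomp Require Import measurable_realfun ring lra zify.

(** Why the limit is quartic in one direction and Gaussian in the others.

    Let D = q - 1. The probability of a configuration depends only on the
    numbers c of sites of each colour. Grouping the configurations by c and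
    replacing every factorial by Stirling's formula turns the law of c into a
    product of harmless factors [sqrt n / S (c k)], where S is the Stirling
    ratio, times exp(- n (f (c / n) - min f)) ([multinomial_weight]).

    At the critical parameters the free energy splits exactly. If the first
    coordinate is 1/2 - s and the others are y, then f - min f is
    [quartic_entropy s], a binary entropy without its quadratic part, plus a sum
    of Bregman divergences of y from its mean m = (1/2 + s) / D, minus
    2 D / (D + 1) times the sum of the squares of y - m ([excess],
    [excess_free_energy]). This excess behaves like
    (4/3) s^4 + D (D - 1) / (D + 1) |y - m|^2, so deviations of order n^(-1/4)
    along u and of order n^(-1/2) across are visible at the same time, and
    n times the excess converges to (4/3) D^4 t^4 + D (D - 1) / (D + 1) |v|^2.
    Moving the parameters by o(n^(-3/4)) changes the exponent by
    n * o(n^(-3/4)) * O(n^(-1/4)), which vanishes ([tilt_le]).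

    Pointwise convergence of the weights ([local_density_cvg]) is made into
    convergence of expectations by dominated convergence. The domination comes
    from the global bound excess >= c (s^4 + |y - m|^2)
    ([excess_quadratic_lower_bound]), which also shows that the minimizer is
    unique: it yields weights at most C exp(- k (t^2 + |v|^2))
    ([local_density_le]). To write the sum over c as an integral, the
    hyperplane of vectors v with zero sum is parametrised by triangular
    coordinates ([helmert]), in which the lattice of possible values of v cuts
    the space into boxes of equal volume ([corner_lattice_floor],
    [lattice_floor_corner]). The sum is then the integral of a step function
    ([step]) whose value at a point is the weight of the cell containing it
    ([cell_cover], [step_cvg]).

    The limit weight is a function of t times a function of the other
    coordinates, hence the independence and the law of T ([limit_laws]). The
    second factor is the density of a product of normal laws in triangular
    coordinates. Linear functionals of V are normal because mixing normal laws
    over a normal mean gives a normal law ([helmert_combination_law]), and the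
    covariance follows from the variances of these functionals by polarisation
    ([integral_helmert_mul]). *)

Set Implicit Arguments.
Unset Strict Implicit.
Unset Printing Implicit Defensive.

Import Order.TTheory GRing.Theory Num.Theory.
Import numFieldNormedType.Exports.

Local Open Scope classical_set_scope.
Local Open Scope ring_scope.

(** * Bounds for the logarithm and for entropies *)

(** The mean value theorem on either side of the centre [c]; the last inequality
    says that [z] lies between [c] and [x] whatever their order. *)
Lemma mvt_between (R : realType) (f f' : R -> R) (l u c x : R) :
  (forall y, l < y < u -> is_derive y 1 f (f' y)) ->
  l < c < u -> l < x < u ->
  exists2 z, l < z < u & f x - f c = f' z * (x - c) /\ 0 <= (z - c) * (x - z).
Proof.
move=> df /andP[lc cu] /andP[lx xu].
have cont a b : l < a -> b < u -> {within `[a, b], continuous f}.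
  move=> la bu; apply: derivable_within_continuous => y.
  rewrite in_itv/= => /andP[ay yb]; have [|? _] := df y => //.
  by rewrite (lt_le_trans la) ?(le_lt_trans yb).
have seg a b : l < a -> b < u -> a <= b ->
    exists2 z, a <= z <= b & f b - f a = f' z * (b - a).
  move=> la bu ab.
  have [||z] := @MVT_segment R f f' a b ab; last by rewrite in_itv/=; exists z.
  - move=> y; rewrite in_itv/= => /andP[ay yb]; apply: df.
    by rewrite (lt_trans la) ?(lt_trans yb).
  - exact: cont.
have [cx|/ltW xc] := leP c x.
- have [z /andP[cz zx] e] := seg c x lc xu cx; exists z.
    by rewrite (lt_le_trans lc) ?(le_lt_trans zx).
  by split => //; rewrite mulr_ge0 ?subr_ge0.
- have [z /andP[cz zx] e] := seg x c lx cu xc; exists z.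
    by rewrite (lt_le_trans lx) ?(le_lt_trans zx).
  by split; [nra|rewrite mulr_le0 ?subr_le0].
Qed.

Section deriv_rules.
Context {R : realType}.
Implicit Types (f g : R -> R) (a b c m s x y : R).

(* Derivation rules in the form of lambda abstractions, for the tactic [deriv]. *)
Let dcst c y : is_derive y 1 (fun _ : R => c) 0.
Proof. exact: is_derive_cst. Qed.

Let did y : is_derive y 1 (fun x : R => x) 1.
Proof. exact: is_derive_id. Qed.

Let dD f g a b y : is_derive y 1 f a -> is_derive y 1 g b ->
  is_derive y 1 (fun x => f x + g x) (a + b).
Proof. exact: is_deriveD. Qed.

Let dN f a y : is_derive y 1 f a -> is_derive y 1 (fun x => - f x) (- a).
Proof. exact: is_deriveN. Qed.

Let dM f g a b y : is_derive y 1 f a -> is_derive y 1 g b ->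
  is_derive y 1 (fun x => f x * g x) (f y * b + g y * a).
Proof. exact: is_deriveM. Qed.

Let dX f a n y : is_derive y 1 f a ->
  is_derive y 1 (fun x => f x ^+ n) (n%:R * f y ^+ n.-1 * a).
Proof.
move=> h; have := is_deriveX n h.
by rewrite (_ : f ^+ n = (fun x => f x ^+ n)) // funeqE => z; elim: n => // n IH; rewrite !exprS -IH.
Qed.

Let dV f a y : f y != 0 -> is_derive y 1 f a ->
  is_derive y 1 (fun x => (f x)^-1) (- (f y) ^- 2 * a).
Proof. exact: is_deriveV. Qed.

Let dln f a y : 0 < f y -> is_derive y 1 f a ->
  is_derive y 1 (fun x => ln (f x)) ((f y)^-1 * a).
Proof.
by move=> fy df; exact: (@is_derive1_comp R (@ln R) f y _ _ (is_derive1_ln fy) df).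
Qed.

(** Binary entropy at [1/2 - s] without its Taylor polynomial of degree two at
    the centre: what remains is of order four. *)
Definition quartic_entropy s : R :=
  (1/2 - s) * ln (1/2 - s) + (1/2 + s) * ln (1/2 + s) + ln 2 - 2 * s ^+ 2.

Let qe1 s : R := ln (1/2 + s) - ln (1/2 - s) - 4 * s.

Ltac deriv := repeat
  lazymatch goal with
  | |- is_derive _ _ (fun _ => ?c) _ => exact (dcst c _)
  | |- is_derive _ _ (fun x => x) _ => exact (did _)
  | |- is_derive _ _ (@ln _) _ => eapply is_derive1_ln
  | |- is_derive _ _ (@GRing.inv _) _ => eapply (dV (f := fun x => x)); [|exact (did _)]
  | |- is_derive _ _ (@GRing.opp _) _ => exact (dN (did _))
  | |- is_derive _ _ (@GRing.add _ ?c) _ => exact (dD (dcst c _) (did _))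
  | |- is_derive _ _ (@GRing.mul _ ?c) _ => exact (dM (dcst c _) (did _))
  | |- is_derive _ _ (fun x => ln _) _ => eapply dln
  | |- is_derive _ _ (fun x => _ ^+ _) _ => eapply dX
  | |- is_derive _ _ (fun x => _^-1) _ => eapply dV
  | |- is_derive _ _ (fun x => _ + _) _ => eapply dD
  | |- is_derive _ _ (fun x => - _) _ => eapply dN
  | |- is_derive _ _ (fun x => _ * _) _ => eapply dM
  end; rewrite /=.

(** The difference has derivative [(x - 1)^3 / (x^2 (x + 2)^2)], so it decreases
    before [x = 1], where it vanishes, and increases after. *)
Lemma ln_ge_rational x : 0 < x ->
  (x - 1) * (5 * x + 1) / (2 * x * (x + 2)) <= ln x.
Proof.
move=> x0.
pose F y : R := ln y + (1/4) * y^-1 + (27/4) * (y + 2)^-1.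
have dF y : 0 < y < x + 2 ->
    is_derive y 1 F ((y - 1) ^+ 3 / (y ^+ 2 * (y + 2) ^+ 2)).
  move=> /andP[y0 _].
  have h1 : y + 2 != 0 by rewrite gt_eqF // addr_gt0.
  have y1 : y != 0 by rewrite gt_eqF.
  by notypeclasses refine (is_derive_eq _ _); [by rewrite /F; deriv|rewrite /=; field; rewrite y1 h1].
have [||z /andP[z0 _] [e s]] := mvt_between dF (c := 1) (x := x).
- by rewrite ltr01 /=; lra.
- by rewrite x0 /=; lra.
have : 0 <= F x - F 1.
  rewrite e (_ : _ * (x - 1) =
    (z - 1) ^+ 2 * ((z - 1) * (x - 1)) / (z ^+ 2 * (z + 2) ^+ 2)).
    apply: divr_ge0; apply: mulr_ge0; rewrite ?sqr_ge0 //.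
    by have := sqr_ge0 (z - 1); nra.
  by field; rewrite !gt_eqF // addr_gt0.
rewrite subr_ge0 /F ln1 => h.
suff -> : (x - 1) * (5 * x + 1) / (2 * x * (x + 2)) =
  0 + 1 / 4 * 1^-1 + 27 / 4 * (1 + 2)^-1 - 1 / 4 * x^-1 - 27 / 4 * (x + 2)^-1.
  by lra.
by field; rewrite !gt_eqF ?addr_gt0.
Qed.

Lemma ln_le_rational x : 0 < x ->
  ln x <= (x - 1) * (x + 5) / (2 * (1 + 2 * x)).
Proof.
move=> x0; have xV : 0 < x^-1 by rewrite invr_gt0.
have := ln_ge_rational xV; rewrite lnV ?posrE // lerNr => /le_trans; apply.
rewrite le_eqVlt; apply/orP; left; apply/eqP.
by field; rewrite !gt_eqF //=; lra.
Qed.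

(** Bregman divergence of [x ln x]: the contribution of one colour to a relative
    entropy. It equals [m] at [x = 0]. *)
Definition bregman x m : R := x * ln (x / m) - x + m.

(** This bound and the next one agree with [(x - m)^2 / (2 m)] to second order at
    [x = m], which gives the limit of [n * bregman]; being valid for all [x],
    the lower one also serves far from the minimizer. *)
Lemma bregman_ge x m : 0 < m -> 0 <= x ->
  3 * (x - m) ^+ 2 / (2 * (x + 2 * m)) <= bregman x m.
Proof.
move=> m0; rewrite le_eqVlt => /orP[/eqP <-|x0]; rewrite /bregman.
  rewrite !mul0r (_ : _ / _ = 3 / 4 * m); first by lra.
  by field; lra.
have := ln_ge_rational (divr_gt0 x0 m0).
rewrite -(ler_pM2l x0) => h.
suff -> : 3 * (x - m) ^+ 2 / (2 * (x + 2 * m)) = x * ((x / m - 1) *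
  (5 * (x / m) + 1) / (2 * (x / m) * (x / m + 2))) - x + m by lra.
by field; repeat (apply/andP; split); rewrite gt_eqF //; nra.
Qed.

Lemma bregman_le x m : 0 < m -> 0 <= x ->
  bregman x m <= (x - m) ^+ 2 * (x + 2 * m) / (2 * m * (m + 2 * x)).
Proof.
move=> m0; rewrite le_eqVlt => /orP[/eqP <-|x0]; rewrite /bregman.
  rewrite !mul0r (_ : _ / _ = m); first by lra.
  by field; lra.
have := ln_le_rational (divr_gt0 x0 m0).
rewrite -(ler_pM2l x0) => h.
suff -> : (x - m) ^+ 2 * (x + 2 * m) / (2 * m * (m + 2 * x)) = x * ((x / m - 1) *
  (x / m + 5) / (2 * (1 + 2 * (x / m)))) - x + m by lra.
by field; repeat (apply/andP; split); rewrite gt_eqF //; nra.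
Qed.

Let deriv_qe s : - (1/2) < s < 1/2 -> is_derive s 1 quartic_entropy (qe1 s).
Proof.
move=> /andP[s1 s2].
have h1 : 0 < 1/2 - s by lra.
have h2 : 0 < 1/2 + s by lra.
notypeclasses refine (is_derive_eq _ _).
  by rewrite /quartic_entropy; deriv; [exact: h1|exact: h2].
by rewrite /= /qe1; field; rewrite !gt_eqF //; lra.
Qed.

Let deriv_qe1 s : - (1/2) < s < 1/2 ->
  is_derive s 1 qe1 (16 * s ^+ 2 / (1 - 4 * s ^+ 2)).
Proof.
move=> /andP[s1 s2].
have h1 : 0 < 1/2 - s by lra.
have h2 : 0 < 1/2 + s by lra.
notypeclasses refine (is_derive_eq _ _); first by rewrite /qe1; deriv.
by rewrite /=; field; rewrite !gt_eqF //; nra.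
Qed.

Let qe_0 : quartic_entropy 0 = 0.
Proof.
rewrite /quartic_entropy subr0 addr0 expr0n /= mulr0 subr0 div1r.
by rewrite lnV ?posrE //; field.
Qed.

Let qe1_0 : qe1 0 = 0.
Proof. by rewrite /qe1 subr0 addr0 mulr0 !subrr. Qed.

Let zero_in : - (1/2) < (0 : R) < 1/2.
Proof. by lra. Qed.

(** The second derivative [16 s^2 / (1 - 4 s^2)] is at least [16 s^2 + 64 s^4];
    integrate twice. *)
Lemma quartic_entropy_ge s : -(1/2) <= s <= 1/2 ->
  4/3 * s ^+ 4 + 32/15 * s ^+ 6 <= quartic_entropy s.
Proof.
have p2 : 0 < 2 :> R by [].
have ln2 : 11/16 <= ln 2 :> R 
  by apply: le_trans (ln_ge_rational p2); rewrite le_eqVlt; apply/orP; left; apply/eqP; field.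
have half_half : 1/2 + 1/2 = 1 :> R by field.
move=> /andP[]; rewrite le_eqVlt => /orP[/eqP <- _|s1].
  by rewrite /quartic_entropy opprK half_half subrr ln1; lra.
rewrite le_eqVlt => /orP[/eqP ->|s2].
  by rewrite /quartic_entropy half_half subrr ln1; lra.
pose P1 s : R := 16/3 * s ^+ 3 + 64/5 * s ^+ 5.
pose F s : R := quartic_entropy s - (4/3 * s ^+ 4 + 32/15 * s ^+ 6).
have dF1 y : - (1/2) < y < 1/2 -> is_derive y 1 (fun s => qe1 s - P1 s)
    (256 * y ^+ 6 / (1 - 4 * y ^+ 2)).
  move=> yI; have dq := deriv_qe1 yI.
  notypeclasses refine (is_derive_eq _ _); first by rewrite /P1; eapply dD; [exact: dq|deriv].
  by rewrite /=; field; rewrite gt_eqF //; move/andP: yI => []; nra.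
have F1 y : - (1/2) < y < 1/2 -> 0 <= (qe1 y - P1 y) * y.
  move=> yI; have [z zI [e _]] := mvt_between dF1 zero_in yI.
  have -> : qe1 y - P1 y = 256 * z ^+ 6 / (1 - 4 * z ^+ 2) * y.
    by move: e; rewrite /= qe1_0 /P1 !expr0n /= !mulr0 addr0 !subr0.
  rewrite -(mulrA _ y y); apply: mulr_ge0; last exact: sqr_ge0.
  apply: divr_ge0; last by move/andP: zI => []; nra.
  by apply: mulr_ge0; [exact: ler0n|rewrite (exprM z 2 3) exprn_ge0 // sqr_ge0].
have dF y : - (1/2) < y < 1/2 -> is_derive y 1 F (qe1 y - P1 y).
  move=> yI; have dq := deriv_qe yI.
  notypeclasses refine (is_derive_eq _ _); first by rewrite /F; eapply dD; [exact: dq|deriv].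
  by rewrite /= /P1; field.
have sI : - (1/2) < s < 1/2 by rewrite s1.
have [z zI [e i]] := mvt_between dF zero_in sI.
have F0 : F 0 = 0 by rewrite /F qe_0 !expr0n /= !mulr0 addr0 subr0.
rewrite F0 !subr0 in e i; rewrite -subr_ge0 -/(F s) e.
have := F1 z zI.
have [->|z0] := eqVneq z 0.
  by move=> _; rewrite qe1_0 /P1 !expr0n /= !mulr0 addr0 subrr mul0r.
have z2 : 0 < z ^+ 2 by rewrite exprn_even_gt0.
have zs : 0 <= z * s by nra.
have [s0|s0|s0] := ltgtP s 0.
- by move: (qe1 z - P1 z) => w wz; nra.
- by move: (qe1 z - P1 z) => w wz; nra.
- by rewrite s0 mulr0.
Qed.

(** On the segment from [0] to [s] the factor [1 / (1 - 4 y^2)] of the second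
    derivative is largest at [s]. *)
Lemma quartic_entropy_le s : -(1/2) < s < 1/2 ->
  quartic_entropy s <= 4/3 * s ^+ 4 / (1 - 4 * s ^+ 2).
Proof.
move=> sI; pose K := (1 - 4 * s ^+ 2)^-1.
have K0 : 0 < 1 - 4 * s ^+ 2 by move/andP: sI => []; nra.
pose P1 y : R := 16/3 * K * y ^+ 3.
pose F y : R := 4/3 * K * y ^+ 4 - quartic_entropy y.
have dF1 y : - (1/2) < y < 1/2 -> is_derive y 1 (fun s => P1 s - qe1 s)
    (16 * y ^+ 2 * (K - (1 - 4 * y ^+ 2)^-1)).
  move=> yI; have dq := deriv_qe1 yI.
  notypeclasses refine (is_derive_eq _ _); first by rewrite /P1; eapply dD; [deriv|eapply dN; exact: dq].
  by rewrite /=; field; rewrite gt_eqF //; move/andP: yI => []; nra.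
have F1 y : - (1/2) < y < 1/2 -> y ^+ 2 <= s ^+ 2 -> 0 <= (P1 y - qe1 y) * y.
  move=> yI ys; have [z zI [e i]] := mvt_between dF1 zero_in yI.
  have -> : P1 y - qe1 y = 16 * z ^+ 2 * (K - (1 - 4 * z ^+ 2)^-1) * y.
    by move: e; rewrite /= qe1_0 /P1 !expr0n /= !mulr0 !subr0.
  rewrite -(mulrA _ y y); apply: mulr_ge0; last exact: sqr_ge0.
  apply: mulr_ge0; first by apply: mulr_ge0 => //; exact: sqr_ge0.
  rewrite subr_ge0.
  by rewrite lef_pV2 ?posrE //; [|move/andP: zI => []]; nra.
have dF y : - (1/2) < y < 1/2 -> is_derive y 1 F (P1 y - qe1 y).
  move=> yI; have dq := deriv_qe yI.
  notypeclasses refine (is_derive_eq _ _); first by rewrite /F; eapply dD; [deriv|eapply dN; exact: dq].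
  by rewrite /= /P1; field.
have [z zI [e i]] := mvt_between dF zero_in sI.
have F0 : F 0 = 0 by rewrite /F qe_0 !expr0n /= !mulr0 subr0.
rewrite F0 !subr0 in e i; rewrite -subr_ge0 mulrAC -/K -/(F s) e.
have zs : z ^+ 2 <= s ^+ 2 by nra.
have := F1 z zI zs.
have [->|z0] := eqVneq z 0.
  by move=> _; rewrite qe1_0 /P1 !expr0n /= !mulr0 subrr mul0r.
have z2 : 0 < z ^+ 2 by rewrite exprn_even_gt0.
have z_s : 0 <= z * s by nra.
by have [s0|s0|->] := ltgtP s 0; rewrite ?mulr0 //;
  move: (P1 z - qe1 z) => w wz; nra.
Qed.
End deriv_rules.

(** * The excess free energy and its lower bound *)

Section excess.
Context {R : realType}.
Implicit Types (s r m : R).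

(** The critical free energy minus its minimum, at the point whose first
    coordinate is [1/2 - s] and whose other coordinates are [y] (see
    [excess_free_energy]). The last term is the part of the interaction energy
    that favours unequal coordinates. *)
Definition excess D s (y : 'I_D -> R) : R :=
  quartic_entropy s + \sum_i bregman (y i) ((1/2 + s) / D%:R)
  - 2 * D%:R / (D%:R + 1) * \sum_i (y i - (1/2 + s) / D%:R) ^+ 2.

Lemma bregman_sub_sqr_ge y m a b : 0 < m -> 0 <= y -> 0 < a ->
  y + 2 * m <= a -> b * (2 * a) <= 3 ->
  b * (y - m) ^+ 2 <= bregman y m.
Proof.
move=> m0 y0 a0 ya ab.
have p : 0 < 2 * (y + 2 * m) by lra.
apply: le_trans (bregman_ge m0 y0).
rewrite ler_pdivlMr // mulrAC ler_wpM2r ?sqr_ge0 //.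
by have [b0|b0] := leP 0 b; nra.
Qed.

Lemma quartic_entropy_ge0 s : -(1/2) <= s <= 1/2 -> 0 <= quartic_entropy s.
Proof.
move=> /quartic_entropy_ge; apply: le_trans.
by apply: addr_ge0; apply: mulr_ge0; rewrite ?exprn_even_ge0 //; lra.
Qed.

Lemma quartic_entropy_ge4 s : -(1/2) <= s <= 1/2 -> 4/3 * s ^+ 4 <= quartic_entropy s.
Proof.
move=> /quartic_entropy_ge; apply: le_trans.
by rewrite lerDl; apply: mulr_ge0; rewrite ?exprn_even_ge0 //; lra.
Qed.

(** For small [s] the Bregman divergences dominate the negative quadratic term
    coordinate by coordinate. *)
Lemma excess_near D s (y : 'I_D -> R) : (2 <= D)%N ->
  (forall i, 0 <= y i) -> \sum_i y i = 1/2 + s -> s <= 1/32 ->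
  quartic_entropy s + (48 * D%:R / (17 * (D%:R + 2)) - 2 * D%:R / (D%:R + 1))
     * \sum_i (y i - (1/2 + s) / D%:R) ^+ 2 <= excess s y.
Proof.
move=> D2 y0 ysum s32.
have DR : 2 <= D%:R :> R by rewrite (ler_nat R 2).
rewrite /excess -[leRHS]addrA lerD2l mulrBl lerB // mulr_sumr.
apply: ler_sum => i _.
have yr : y i <= 1/2 + s by rewrite -ysum (bigD1 i) //= lerDl sumr_ge0.
have [r0|r0] := eqVneq (1/2 + s) 0.
  have -> : y i = 0 by apply: le_anti; rewrite y0 -{1}r0 yr.
  by rewrite r0 /bregman !mul0r !subr0 expr0n mulr0 addr0.
have rp : 0 < 1/2 + s by rewrite lt_neqAle eq_sym r0 /= (le_trans (y0 i)).
have Dn : D%:R != 0 :> R by rewrite gt_eqF //; lra.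
(* [y i] and [1/2 + s] are at most 17/32. *)
apply: (@bregman_sub_sqr_ge _ _ (17 * (D%:R + 2) / (32 * D%:R))) => //.
- by apply: divr_gt0; lra.
- by apply: divr_gt0; lra.
- rewrite ler_pdivlMr; last by lra.
  have -> : (y i + 2 * ((1/2 + s) / D%:R)) * (32 * D%:R) =
     32 * D%:R * y i + 64 * (1/2 + s) by field.
  by nra.
- rewrite le_eqVlt; apply/orP; left; apply/eqP; field.
  by rewrite Dn gt_eqF //; lra.
Qed.

(** What remains to be shown for [D = 2] after completing the square; the factor
    24/25 leaves 1/25 of the entropy as a lower bound for the excess. *)
Lemma far_poly2 s : 1/4 <= s <= 1/2 ->
  (1/2 + s) * (4 * s - 1) ^+ 2 / 12 <= 24/25 * (4/3 * s ^+ 4 + 32/15 * s ^+ 6).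
Proof.
move=> /andP[s1 s2].
pose t := 4 * s - 1.
have st : s = (t + 1) / 4 by rewrite /t; field.
have t0 : 0 <= t by rewrite /t; lra.
have t1 : t <= 1 by rewrite /t; lra.
have s6 : s ^+ 4 / 16 <= s ^+ 6.
  rewrite (exprD s 4 2) ler_wpM2l ?exprn_even_ge0 //; nra.
suff : (1/2 + s) * (4 * s - 1) ^+ 2 / 12 <= 24/25 * (4/3 * s ^+ 4 + 2/15 * s ^+ 4) by lra.
rewrite -/t st {s1 s2 s6}; have := sqr_ge0 (t ^+ 2 - 2/3) => h.
have tt : t ^+ 2 <= t by nra.
have -> : t ^+ 2 = t * t by [].
nra.
Qed.

(** What remains to be shown for [D >= 3] in the worst case, when one coordinate
    carries all the mass and [D = 3]. *)
Lemma far_poly3 s : 0 <= s <= 1/2 ->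
  (1/2 + s) * (9 * s - 7/2) / 9 <= 24/25 * (4/3 * s ^+ 4 + 32/15 * s ^+ 6).
Proof.
move=> /andP[s1 s2]; pose e := 1/2 - s.
have se : s = 1/2 - e by rewrite /e; lra.
have [e0 e1] : 0 <= e /\ e <= 1/2 by rewrite /e; lra.
have [se4|se4] := leP (1/4) e.
  have : 0 <= 24/25 * (4/3 * s ^+ 4 + 32/15 * s ^+ 6).
    by rewrite mulr_ge0 // addr_ge0 // mulr_ge0 ?exprn_even_ge0.
  by apply: le_trans; rewrite /e in se4; nra.
have h4 : 1/16 - e/2 + e ^+ 2 <= s ^+ 4.
  rewrite se -subr_ge0 (_ : _ - _ = e ^+ 2 * (1/2 - 2 * e + e ^+ 2)); last by field.
  by rewrite mulr_ge0 ?sqr_ge0 //; nra.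
have h6 : 1/64 - 3/16 * e <= s ^+ 6.
  rewrite se -subr_ge0 (_ : _ - _ = e ^+ 2 * (15/16 - 5/2 * e + 15/4 * e ^+ 2
    - 3 * e ^+ 3 + e ^+ 4)); last by field.
  by rewrite mulr_ge0 ?sqr_ge0 //; nra.
suff : (1/2 + s) * (9 * s - 7/2) / 9 <=
  24/25 * (4/3 * (1/16 - e/2 + e ^+ 2) + 32/15 * (1/64 - 3/16 * e)) by lra.
by rewrite se; nra.
Qed.

(** Changing the reference point costs a term linear in [y], so summing over a
    block with mean [m'] separates the spread inside the block from the
    displacement of the block. *)
Lemma bregman_recenter y m m' : 0 < m -> 0 < m' -> 0 <= y ->
  bregman y m = bregman y m' + y * ln (m' / m) + m - m'.
Proof.
move=> m0 m'0; rewrite le_eqVlt => /orP[/eqP <-|y0]; rewrite /bregman.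
  by rewrite !mul0r; ring.
by rewrite !ln_div ?posrE //; ring.
Qed.

Lemma sum_bregman_recenter (I : finType) (P : pred I) (y : I -> R) m m' :
  0 < m -> (forall i, 0 <= y i) -> 0 <= m' ->
  \sum_(i | P i) y i = #|P|%:R * m' ->
  \sum_(i | P i) bregman (y i) m =
  \sum_(i | P i) bregman (y i) m' + #|P|%:R * bregman m' m.
Proof.
move=> m0 y0; rewrite le_eqVlt => /orP[/eqP <-|m'0] ysum.
  have y_0 i : P i -> y i = 0.
    move: ysum; rewrite mulr0 => /eqP.
    by rewrite psumr_eq0 // => /allP /(_ i (mem_index_enum _)) /implyP h /h /eqP.
  rewrite (eq_bigr (fun=> m)) => [|i /y_0 ->]; last by rewrite /bregman !mul0r; ring.
  rewrite [in RHS]big1 => [|i /y_0 ->]; last by rewrite /bregman !mul0r; ring.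
  by rewrite sumr_const /bregman !mul0r subr0 !add0r mulr_natl.
under eq_bigr => i _ do rewrite (bregman_recenter m0 m'0 (y0 i)).
rewrite sumrB big_split big_split /= -mulr_suml ysum !sumr_const.
by rewrite /bregman -[m *+ _]mulr_natl -[m' *+ _]mulr_natl; ring.
Qed.

Lemma sum_sqr_recenter (I : finType) (P : pred I) (y : I -> R) m m' :
  \sum_(i | P i) y i = #|P|%:R * m' ->
  \sum_(i | P i) (y i - m) ^+ 2 =
  \sum_(i | P i) (y i - m') ^+ 2 + #|P|%:R * (m' - m) ^+ 2.
Proof.
move=> ysum.
have e i : (y i - m) ^+ 2 =
    (y i - m') ^+ 2 + 2 * (m' - m) * y i + (m ^+ 2 - m' ^+ 2) by ring.
under eq_bigr do rewrite e.
by rewrite !big_split /= -mulr_sumr ysum !sumr_const -[_ *+ #|P|]mulr_natl; ring.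
Qed.

(** Split the coordinates into the largest one and the rest. The coordinates of
    the rest do not exceed 1/2, so their spread is controlled as in
    [excess_near]; the two blocks form a binary problem, whose deficit is
    absorbed by the entropy of [s]. *)
Lemma excess_far3 D s (y : 'I_D -> R) : (3 <= D)%N ->
  (forall i, 0 <= y i) -> \sum_i y i = 1/2 + s -> 0 <= s <= 1/2 ->
  1/25 * quartic_entropy s <= excess s y.
Proof.
move=> D3 y0 ysum /andP[s0 s1].
have sI : -(1/2) <= s <= 1/2 by lra.
have DR : 3 <= D%:R :> R by rewrite (ler_nat R 3).
have D_gt0 : (0 < D)%N by lia.
pose k := [arg max_(i > Ordinal D_gt0) y i]%O.
have kmax i : y i <= y k.
  by rewrite /k; case: arg_maxP => //= j _; exact.
set r := 1/2 + s in ysum *; set m := r / D%:R.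
have r0 : 0 < r by rewrite /r; lra.
have m0 : 0 < m by rewrite divr_gt0 //; lra.
pose M := \sum_(i | i != k) y i.
have Mr : y k + M = r by rewrite -ysum (bigD1 k).
have M0 : 0 <= M by rewrite sumr_ge0.
have cardD : #|[pred i | i != k]|%:R = D%:R - 1 :> R.
  by rewrite cardC1 card_ord -[in RHS](prednK D_gt0) -natr1 addrK.
pose m' := M / (D%:R - 1).
have Mm' : M = #|[pred i | i != k]|%:R * m'.
  by rewrite cardD /m' mulrC divfK // gt_eqF //; lra.
have m'0 : 0 <= m' by rewrite divr_ge0 //; lra.
rewrite /excess -/r -/m (bigD1 k) //= [\sum_i (y i - m) ^+ 2](bigD1 k) //=.
rewrite (sum_bregman_recenter m0 y0 m'0 Mm') (sum_sqr_recenter m Mm') cardD.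
set B := 2 * D%:R / (D%:R + 1).
(* [y i <= y k] and [y i + y k <= 1] give [y i <= 1/2]. *)
have rest : B * \sum_(i | i != k) (y i - m') ^+ 2 <=
    \sum_(i | i != k) bregman (y i) m'.
  rewrite mulr_sumr; apply: ler_sum => i ik.
  have yiM : y i <= M by rewrite /M (bigD1 i) //= lerDl sumr_ge0.
  have [M_0|M_0] := eqVneq M 0.
    have -> : y i = 0 by apply: le_anti; rewrite y0 -{1}M_0 yiM.
    by rewrite /m' M_0 /bregman !mul0r !subr0 expr0n mulr0 addr0.
  have m'p : 0 < m' by rewrite divr_gt0 ?lt0r ?M_0 //; lra.
  apply: (@bregman_sub_sqr_ge _ _ (3/4 * (1 + D%:R^-1))) => //.
  - have := kmax i => yik.
    have yi2 : y i <= 1/2 by rewrite /r in Mr; lra.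
    have M1 : M <= 1 - y i by rewrite /r in Mr; lra.
    have d1 : D%:R^-1 * D%:R = 1 :> R by rewrite mulVf // gt_eqF //; lra.
    have m'e : m' * (D%:R - 1) = M by rewrite mulrC -cardD -Mm'.
    have d0 : 0 < D%:R^-1 :> R by rewrite invr_gt0; lra.
    have h : (y i + 2 * m') * (D%:R - 1) <= 3/4 * (1 + D%:R^-1) * (D%:R - 1).
      rewrite mulrDl -mulrA m'e.
      have -> : 3/4 * (1 + D%:R^-1) * (D%:R - 1) = 3/4 * (D%:R - D%:R^-1) :> R.
        by rewrite -d1; field; rewrite gt_eqF //; lra.
      have : D%:R^-1 <= 3^-1 :> R by rewrite lef_pV2 ?posrE; lra.
      nra.
    by move: h; rewrite ler_pM2r //; lra.
  - rewrite le_eqVlt; apply/orP; left; apply/eqP; rewrite /B; field.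
    by rewrite !gt_eqF //; lra.
set Y := y k in Mr *; set dl := Y - m.
have Y0 : 0 <= Y := y0 k.
(* The inequality between harmonic and arithmetic means, applied to the two
   denominators in [bregman_ge], whose weighted sum is [3 * r]. *)
have blocks : 2 / r * dl ^+ 2 <= bregman Y m + (D%:R - 1) * bregman m' m.
  have A0 : 0 < Y + 2 * m by lra.
  have B0 : 0 < m' + 2 * m by lra.
  have h1 := bregman_ge m0 Y0.
  have := bregman_ge m0 m'0.
  rewrite -(@ler_pM2l _ (D%:R - 1)); last by lra.
  move=> h2.
  have m'e : m' * (D%:R - 1) = M by rewrite mulrC -cardD -Mm'.
  have me : m * D%:R = r by rewrite /m divfK // gt_eqF //; lra.
  pose A := Y + 2 * m; pose C := (D%:R - 1) * (m' + 2 * m).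
  have C0 : 0 < C by rewrite mulr_gt0 //; lra.
  have AC : A + C = 3 * r by rewrite /A /C; lra.
  have dl' : (D%:R - 1) * (m' - m) = - dl by rewrite /dl; lra.
  have e2 : (D%:R - 1) * (3 * (m' - m) ^+ 2 / (2 * (m' + 2 * m))) =
      3 * dl ^+ 2 / (2 * C).
    have -> : dl ^+ 2 = ((D%:R - 1) * (m' - m)) ^+ 2 by rewrite dl' sqrrN.
    by rewrite /C; field; rewrite !gt_eqF //; lra.
  rewrite e2 in h2; apply: le_trans (lerD h1 h2).
  rewrite -/dl -/A.
  have -> : 2 / r = 6 / (A + C) by rewrite AC; field; rewrite gt_eqF.
  rewrite -subr_ge0 (_ : _ - _ = 3/2 * dl ^+ 2 * (A - C) ^+ 2 / (A * C * (A + C))).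
    apply: divr_ge0; last first.
      by apply: mulr_ge0; [apply: mulr_ge0|apply: addr_ge0]; exact: ltW.
    apply: mulr_ge0; last exact: sqr_ge0.
    by apply: mulr_ge0; [lra|exact: sqr_ge0].
  by field; rewrite !gt_eqF // addr_gt0.
have quad : dl ^+ 2 + (D%:R - 1) * (m' - m) ^+ 2 = D%:R / (D%:R - 1) * dl ^+ 2.
  have -> : m' - m = - dl / (D%:R - 1).
    have m'e : m' * (D%:R - 1) = M by rewrite mulrC -cardD -Mm'.
    have me : m * D%:R = r by rewrite /m divfK // gt_eqF //; lra.
    apply/(mulIf (x := D%:R - 1)); first by rewrite gt_eqF //; lra.
    by rewrite divfK ?gt_eqF //; [rewrite /dl|]; lra.
  by field; rewrite gt_eqF //; lra.
(* The two blocks must pay for the quadratic term created by the displacement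
   [dl]; the worst displacement puts all the mass on [k]. *)
suff key : B * (D%:R / (D%:R - 1) * dl ^+ 2) - 2 / r * dl ^+ 2 <=
    24/25 * quartic_entropy s.
  rewrite -/dl [dl ^+ 2 + _](_ : _ = (dl ^+ 2 + (D%:R - 1) * (m' - m) ^+ 2) +
    \sum_(i | i != k) (y i - m') ^+ 2); last by ring.
  by rewrite quad (mulrDr B); lra.
have E0 := quartic_entropy_ge0 sI.
have Dm : 0 < D%:R ^+ 2 - 1 :> R by nra.
have -> : B * (D%:R / (D%:R - 1) * dl ^+ 2) - 2 / r * dl ^+ 2 =
    2 * dl ^+ 2 * (D%:R ^+ 2 * r - (D%:R ^+ 2 - 1)) / (r * (D%:R ^+ 2 - 1)).
  by rewrite /B; field; rewrite !gt_eqF //; lra.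
have den : 0 < r * (D%:R ^+ 2 - 1) by rewrite mulr_gt0.
have [neg|pos] := leP (D%:R ^+ 2 * r - (D%:R ^+ 2 - 1)) 0.
  apply: (@le_trans _ _ 0); last by rewrite mulr_ge0.
  by rewrite pmulr_lle0 ?invr_gt0 // mulr_ge0_le0 // mulr_ge0 // sqr_ge0.
have dl_ge0 : 0 <= dl.
  rewrite subr_ge0 ler_pdivrMr; last by lra.
  rewrite -ysum; apply: (@le_trans _ _ (\sum_(i < D) Y)).
    by apply: ler_sum => i _; exact: kmax.
  by rewrite sumr_const card_ord mulr_natr.
have dl_le : dl <= r * (D%:R - 1) / D%:R.
  rewrite ler_pdivlMr; last by lra.
  have me : m * D%:R = r by rewrite /m divfK // gt_eqF //; lra.
  by rewrite /dl mulrBl me; nra.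
have dl2 : dl ^+ 2 <= (r * (D%:R - 1) / D%:R) ^+ 2.
  by rewrite !expr2; apply: ler_pM.
apply: (@le_trans _ _ (2 * (r * (D%:R - 1) / D%:R) ^+ 2 *
  (D%:R ^+ 2 * r - (D%:R ^+ 2 - 1)) / (r * (D%:R ^+ 2 - 1)))).
  apply: ler_wpM2r; first by rewrite invr_ge0 ltW.
  apply: ler_wpM2r; first exact: ltW.
  by apply: ler_wpM2l.
have rs : r - 1/2 = s by rewrite /r; lra.
have sI' : 0 <= s <= 1/2 by rewrite s0.
have := far_poly3 sI'.
have := quartic_entropy_ge sI.
move=> h1 h2.
have h3 : (1/2 + s) * (9 * s - 7/2) / 9 <= 24/25 * quartic_entropy s by lra.
apply: le_trans h3.
(* The bound is worst at [D = 3], where [g = 1/18]. *)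
pose g : R := (D%:R - 1) / (D%:R ^+ 2 * (D%:R + 1)).
have -> : 2 * (r * (D%:R - 1) / D%:R) ^+ 2 *
  (D%:R ^+ 2 * r - (D%:R ^+ 2 - 1)) / (r * (D%:R ^+ 2 - 1)) =
  2 * r * g * (1 - D%:R ^+ 2 * (1 - r)).
  by rewrite /g; field; rewrite !gt_eqF //; lra.
have g18 : g <= 1/18.
  rewrite /g ler_pdivrMr; last by nra.
  by nra.
have g0 : 0 <= g by rewrite /g divr_ge0 // ?mulr_ge0 //; nra.
have -> : (1/2 + s) * (9 * s - 7/2) / 9 = 2 * r * (1/18) * (1 - 9 * (1 - r)).
  by rewrite /r; field.
rewrite -(mulrA (2 * r) g) -(mulrA (2 * r) (1/18)) ler_pM2l; last by lra.
have r1 : 0 <= 1 - r by rewrite /r; lra.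
have D9 : 9 <= D%:R ^+ 2 :> R by nra.
have ab : 1 - D%:R ^+ 2 * (1 - r) <= 1 - 9 * (1 - r).
  by rewrite lerD2l lerN2 ler_wpM2r.
apply: ler_pM => //; lra.
Qed.

(** The relative entropy of two colours is a binary entropy, hence again a
    quartic entropy up to its quadratic part. *)
Lemma two_point_bregman r x : 0 < r -> -(1/2) <= x <= 1/2 ->
  bregman (r * (1/2 + x)) (r / 2) + bregman (r * (1/2 - x)) (r / 2) =
  r * (quartic_entropy x + 2 * x ^+ 2).
Proof.
move=> r0 /andP[x1 x2].
have e z : 0 <= z -> r * z * ln (r * z / (r / 2)) = r * z * (ln 2 + ln z).
  rewrite le_eqVlt => /orP[/eqP <-|z0]; first by rewrite mulr0 !mul0r.
  rewrite (_ : r * z / (r / 2) = 2 * z); last by field; rewrite gt_eqF.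
  by rewrite lnM ?posrE.
rewrite /bregman !e; [|lra|lra].
rewrite /quartic_entropy; move: (ln _) (ln _) (ln _) => a b c.
by field.
Qed.

Lemma excess_far2 s (y : 'I_2 -> R) :
  (forall i, 0 <= y i) -> \sum_i y i = 1/2 + s -> 0 <= s <= 1/2 ->
  1/25 * quartic_entropy s <= excess s y.
Proof.
move=> y0 ysum /andP[s0 s1]; set r := 1/2 + s in ysum.
have r0 : 0 < r by rewrite /r; lra.
have sI : -(1/2) <= s <= 1/2 by lra.
have E0 := quartic_entropy_ge0 sI.
rewrite /excess !big_ord_recl !big_ord0 -/r in ysum *.
have := y0 (lift ord0 ord0); have := y0 ord0; move: ysum.
move: (y ord0) (y (lift ord0 ord0)) => a b ab a0 b0.
pose x := a / r - 1/2.
have aE : a = r * (1/2 + x) by rewrite /x; field; rewrite gt_eqF.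
have bE : b = r * (1/2 - x).
  have -> : b = r - a by move: ab; rewrite addr0 => <-; ring.
  by rewrite /x; field; rewrite gt_eqF.
have xI : -(1/2) <= x <= 1/2.
  have : 0 <= 1/2 + x by rewrite -(pmulr_rge0 _ r0) -aE.
  have : 0 <= 1/2 - x by rewrite -(pmulr_rge0 _ r0) -bE.
  by lra.
rewrite !addr0 aE bE two_point_bregman //.
have := quartic_entropy_ge4 xI.
have -> : 2 * 2 / (2 + 1) * ((r * (1/2 + x) - r / 2) ^+ 2 + (r * (1/2 - x) - r / 2) ^+ 2)
  = 8/3 * r ^+ 2 * x ^+ 2 by field.
move=> hx.
suff : r * (8/3 * r * x ^+ 2 - 2 * x ^+ 2 - 4/3 * x ^+ 4) <= 24/25 * quartic_entropy s.
  by have := ler_wpM2l (ltW r0) hx; lra.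
have [sl|sg] := leP s (1/4).
  apply: (@le_trans _ _ 0); last by rewrite mulr_ge0.
  have x4 : 0 <= x ^+ 4 by rewrite exprn_even_ge0.
  rewrite pmulr_rle0 //; have := sqr_ge0 x; rewrite /r; nra.
have sI' : 1/4 <= s <= 1/2 by lra.
apply: (@le_trans _ _ ((1/2 + s) * (4 * s - 1) ^+ 2 / 12)); last first.
  by have := far_poly2 sI'; have := quartic_entropy_ge sI; lra.
rewrite -(mulrA (1/2 + s)); apply: ler_wpM2l; first exact: ltW.
rewrite /r -subr_ge0.
rewrite (_ : _ - _ = 4/3 * (x ^+ 2 - (4 * s - 1) / 4) ^+ 2); last by field.
by rewrite mulr_ge0 // sqr_ge0.
Qed.

(** A single coordinate equals its mean. *)
Lemma excess_one s (y : 'I_1 -> R) : \sum_i y i = 1/2 + s ->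
  excess s y = quartic_entropy s.
Proof.
rewrite /excess !big_ord_recl !big_ord0 !addr0 divr1 => ->.
rewrite subrr expr0n mulr0 subr0 /bregman.
have [->|r0] := eqVneq (1/2 + s) 0; first by rewrite !mul0r subrr !addr0.
by rewrite divff // ln1 mulr0 sub0r addNr addr0.
Qed.

(** For [s <= 1/32] both parts of the excess have the right order separately; for
    larger [s] it is at least a fraction of the entropy of [s], hence bounded
    below, while the left-hand side is bounded above. *)
Lemma excess_quadratic_lower_bound D : (0 < D)%N ->
  exists2 c : R, 0 < c & forall s (y : 'I_D -> R), (forall i, 0 <= y i) ->
    \sum_i y i = 1/2 + s -> s <= 1/2 ->
    c * (s ^+ 4 + \sum_i (y i - (1/2 + s) / D%:R) ^+ 2) <= excess s y.
Proof.
move=> D0.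
have DR : 1 <= D%:R :> R by rewrite (ler_nat R 1).
have sI D' s (y : 'I_D' -> R) : (forall i, 0 <= y i) -> \sum_i y i = 1/2 + s ->
    s <= 1/2 -> -(1/2) <= s <= 1/2.
  by move=> y0 ys ->; rewrite andbT -[_ <= s](lerD2l (1/2)) -ys subrr sumr_ge0.
have [D1|D2] := leqP D 1.
  have D_eq : D = 1%N by lia.
  subst D; exists 1 => // s y y0 ys s2.
  rewrite (excess_one ys) mul1r big_ord_recl big_ord0 addr0 divr1.
  have -> : y ord0 = 1/2 + s by rewrite -ys big_ord_recl big_ord0 addr0.
  rewrite subrr expr0n /= addr0.
  apply: le_trans (quartic_entropy_ge4 (sI _ _ _ y0 ys s2)).
  have s40 : 0 <= s ^+ 4 by rewrite exprn_even_ge0.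
  by lra.
have DR2 : 2 <= D%:R :> R by rewrite (ler_nat R 2).
pose c1 : R := 48 * D%:R / (17 * (D%:R + 2)) - 2 * D%:R / (D%:R + 1).
have c1_gt0 : 0 < c1.
  rewrite /c1 (_ : _ - _ = 2 * D%:R * (7 * D%:R - 10) / (17 * (D%:R + 2) * (D%:R + 1))).
    apply: divr_gt0; first by nra.
    by apply: mulr_gt0; lra.
  by field; rewrite !gt_eqF //; lra.
(* The entropy of [s] exceeds [4/3 * (1/32)^4], and the bracket is at most 2. *)
pose c2 : R := 1/25 * (4/3 * (1/32) ^+ 4) / 2.
have c2_gt0 : 0 < c2 by rewrite /c2; lra.
pose c := Num.min 1 (Num.min c1 c2).
have c0 : 0 < c by rewrite !lt_min ltr01 c1_gt0.
exists c => // s y y0 ys s2.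
have sI' := sI _ _ _ y0 ys s2.
have s40 : 0 <= s ^+ 4 by rewrite exprn_even_ge0.
set Q := \sum_i _.
have Q0 : 0 <= Q by apply: sumr_ge0 => i _; exact: sqr_ge0.
have [near|far] := leP s (1/32).
  apply: le_trans (excess_near D2 y0 ys near).
  rewrite mulrDr; apply: lerD.
    apply: le_trans (quartic_entropy_ge4 sI').
    apply: ler_wpM2r => //.
    by apply: (@le_trans _ _ 1); [rewrite ge_min lexx|lra].
  by apply: ler_wpM2r => //; rewrite !ge_min lexx orbT.
have sI0 : 0 <= s <= 1/2 by lra.
apply: (@le_trans _ _ (1/25 * quartic_entropy s)); last first.
  have [D3|] := leqP 3 D; first exact: excess_far3.
  move=> D3; have D_eq : D = 2%N by apply/eqP; rewrite eqn_leq D2 andbT -ltnS.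
  by subst D; exact: excess_far2.
apply: (@le_trans _ _ (c2 * 2)).
  apply: ler_pM; [exact: ltW|exact: addr_ge0|by rewrite !ge_min lexx !orbT|].
  have s4 : s ^+ 4 <= 1.
    have : s ^+ 2 <= 1 by nra.
    by have := sqr_ge0 s; rewrite (exprM s 2 2); nra.
  suff : Q <= 1 by lra.
  have m_sum : Q = \sum_i (y i) ^+ 2 - (1/2 + s) ^+ 2 / D%:R.
    rewrite /Q; set m := _ / D%:R.
    have e i : (y i - m) ^+ 2 = (y i) ^+ 2 - 2 * m * y i + m ^+ 2 by ring.
    under eq_bigr do rewrite e.
    rewrite big_split sumrB /= -mulr_sumr ys sumr_const card_ord -[_ *+ D]mulr_natl.
    by rewrite /m; field; rewrite gt_eqF //; lra.
  rewrite m_sum; apply: (@le_trans _ _ (\sum_i y i ^+ 2)).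
    by rewrite gerBl divr_ge0 ?sqr_ge0 //; lra.
  apply: (@le_trans _ _ (\sum_i y i)); last by rewrite ys; lra.
  apply: ler_sum => i _.
  have : y i <= 1/2 + s by rewrite -ys (bigD1 i) //= lerDl sumr_ge0.
  by have := y0 i; nra.
rewrite /c2 divfK // ler_pM2l //.
apply: le_trans (quartic_entropy_ge4 sI'); rewrite ler_pM2l //.
by rewrite lerXn2r ?nnegrE //; lra.
Qed.
End excess.

(** * Stirling ratios *)

Section stirling.
Context {R : realType}.

(** [n! / (n / e)^n]; it equals [1] at [n = 0], as needed for empty colours. *)
Definition stirling_ratio (n : nat) : R := n`!%:R * expR n%:R / n%:R ^+ n.

Lemma stirling_ratio_gt0 n : 0 < stirling_ratio n.
Proof.
apply: divr_gt0; first by rewrite mulr_gt0 ?expR_gt0 // ltr0n fact_gt0.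
by case: n => // n; rewrite exprn_gt0.
Qed.

Let L n : R := ln (stirling_ratio n.+1) - ln n.+1%:R / 2.

(* [L] is nonincreasing and its steps are dominated by a telescoping sum, by the
   rational bounds for the logarithm at [1 + 1 / n]. *)
Let L_step n : L n - L n.+1 = (n.+1%:R + 1/2) * ln (n.+2%:R / n.+1%:R) - 1.
Proof.
have p1 : 0 < n.+1%:R :> R by [].
have p2 : 0 < n.+2%:R :> R by [].
have S_step : stirling_ratio n.+2 =
    stirling_ratio n.+1 * (expR 1 * (n.+1%:R / n.+2%:R) ^+ n.+1).
  have eS : expR n.+2%:R = expR n.+1%:R * expR 1 :> R by rewrite -expRD natr1.
  rewrite /stirling_ratio factS natrM eS.
  rewrite exprMn exprVn [n.+2%:R ^+ n.+2]exprS.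
  by field; rewrite !gt_eqF // exprn_gt0.
have q : 0 < n.+1%:R / n.+2%:R :> R by rewrite divr_gt0.
have qX : 0 < (n.+1%:R / n.+2%:R) ^+ n.+1 :> R by rewrite exprn_gt0.
rewrite /L S_step lnM ?posrE ?stirling_ratio_gt0 ?mulr_gt0 ?expR_gt0 //.
rewrite lnM ?posrE ?expR_gt0 // expRK lnXn // !ln_div ?posrE //.
rewrite -[(_ - _) *+ n.+1]mulr_natl; move: (ln _) (ln _) (ln _) => a b c.
by field.
Qed.

Let L_bounds n : 0 <= L n - L n.+1 <= (n.+1%:R^-1 - n.+2%:R^-1) / 4.
Proof.
rewrite L_step; set x : R := n.+1%:R.
have x0 : 0 < x by [].
have -> : n.+2%:R = x + 1 :> R by rewrite natr1.
have q : 0 < (x + 1) / x by rewrite divr_gt0 // addr_gt0.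
have y0 : 0 < x + 1/2 by lra.
apply/andP; split.
  have := ln_ge_rational q; rewrite -(ler_pM2l y0) => h.
  rewrite subr_ge0; apply: le_trans h; rewrite -subr_ge0.
  rewrite (_ : _ - _ = 1 / (4 * (x + 1) * (3 * x + 1))).
    by rewrite divr_ge0 // mulr_ge0 //; lra.
  by field; rewrite !gt_eqF //; lra.
have := ln_le_rational q; rewrite -(ler_pM2l y0) => h.
rewrite lerBlDr; apply: (le_trans h); rewrite -subr_ge0.
rewrite (_ : _ - _ = (2 * x + 1) / (4 * x * (x + 1) * (3 * x + 2))).
  by apply: divr_ge0; [lra|apply: mulr_ge0; [apply: mulr_ge0|]; lra].
by field; rewrite !gt_eqF //; lra.
Qed.

Let L_nonincr : nonincreasing_seq L.
Proof.
by apply/nonincreasing_seqP => n; rewrite -subr_ge0; case/andP: (L_bounds n).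
Qed.

Let L_lb n : L 0 - 1/4 <= L n.
Proof.
suff : L 0 - L n <= (1 - n.+1%:R^-1) / 4.
  have : 0 <= n.+1%:R^-1 :> R by rewrite invr_ge0.
  by move: (n.+1%:R^-1 : R) => x; lra.
elim: n => [|n IH]; first by rewrite subrr invr1 subrr mul0r.
have /andP[_] := L_bounds n; move: IH.
by move: (n.+1%:R^-1 : R) (n.+2%:R^-1 : R) => x y; lra.
Qed.

Let ratioE n : stirling_ratio n.+1 = expR (L n) * Num.sqrt n.+1%:R.
Proof.
have -> : Num.sqrt n.+1%:R = expR (ln n.+1%:R / 2) :> R.
  rewrite -[RHS]ger0_norm ?expR_ge0 // -sqrtr_sqr expr2 -expRD -splitr.
  by rewrite lnK ?posrE.
by rewrite -expRD /L subrK lnK // posrE stirling_ratio_gt0.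
Qed.

Lemma stirling_ratio_cvg : exists2 k : R, 0 < k &
  stirling_ratio n / Num.sqrt n%:R @[n --> \oo] --> k.
Proof.
have cL : cvgn L.
  apply: nonincreasing_is_cvgn L_nonincr _.
  by exists (L 0 - 1/4) => _ [n _ <-]; exact: L_lb.
exists (expR (limn L)); first exact: expR_gt0.
rewrite -cvg_shiftS /=.
rewrite (_ : (fun n => _) = expR \o L); last first.
  apply/funext => n; rewrite ratioE /= mulfK // gt_eqF // sqrtr_gt0 //.
by apply: continuous_cvg => //; exact: continuous_expR.
Qed.

(** The shift by one makes the bound meaningful for empty colours too. *)
Lemma stirling_ratio_ge : exists2 C : R, 0 < C &
  forall n, (stirling_ratio n)^-1 <= C / Num.sqrt n.+1%:R.
Proof.
pose c := expR (L 0 - 1/4); have c0 : 0 < c := expR_gt0 _.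
pose C := 1 + Num.sqrt 2 / c.
have sqrt2 : 0 < Num.sqrt 2 :> R by rewrite sqrtr_gt0.
have s2c : 0 < Num.sqrt 2 / c by rewrite divr_gt0.
exists C; first by rewrite /C; lra.
case=> [|n].
  rewrite /stirling_ratio fact0 expR0 !mul1r expr0 invr1 sqrtr1 invr1 mulr1.
  by rewrite lerDl ltW.
have sn1 : 0 < Num.sqrt n.+1%:R :> R by rewrite sqrtr_gt0.
have sn2 : 0 < Num.sqrt n.+2%:R :> R by rewrite sqrtr_gt0.
have h : c * Num.sqrt n.+1%:R <= stirling_ratio n.+1.
  by rewrite ratioE ler_pM2r // ler_expR L_lb.
apply: (@le_trans _ _ (c * Num.sqrt n.+1%:R)^-1).
  by rewrite lef_pV2 ?posrE ?stirling_ratio_gt0 ?mulr_gt0.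
apply: (@le_trans _ _ ((Num.sqrt 2 / c) / Num.sqrt n.+2%:R)); last first.
  by rewrite ler_pM2r ?invr_gt0 // /C lerDr.
rewrite ler_pdivlMr // mulrC ler_pdivrMr ?mulr_gt0 //.
rewrite mulrA divfK ?gt_eqF // -sqrtrM // ler_wsqrtr //.
by rewrite -natrM ler_nat; lia.
Qed.
End stirling.

(** * From configurations to counts *)

Section multinomial_counting.
Local Open Scope nat_scope.
Variable q : nat.

Definition occurrences n (s : config n q) (k : 'I_q) : nat := \sum_(i < n) (s i == k).

Lemma sum_occurrences n (s : config n q) : \sum_k occurrences s k = n.
Proof.
rewrite exchange_big /= (eq_bigr (fun=> 1)) ?sum1_card ?card_ord // => i _.
by rewrite (bigD1 (s i)) //= eqxx big1 // => k; rewrite eq_sym => /negPf ->.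
Qed.

Let glue n (p : 'I_q * config n q) : config n.+1 q :=
  [ffun i => if unlift ord0 i is Some j then p.2 j else p.1].

Let occurrences_glue n (p : 'I_q * config n q) k : occurrences (glue p) k = (p.1 == k) + occurrences p.2 k.
Proof.
rewrite /occurrences big_ord_recl ffunE unlift_none; congr (_ + _).
by apply: eq_bigr => i _; rewrite ffunE liftK.
Qed.

Let glue_bij n : {on predT, bijective (@glue n)}.
Proof.
exists (fun s => (s ord0, [ffun i => s (lift ord0 i)])) => [[k s] _|s _].
  by congr pair; [rewrite ffunE unlift_none|apply/ffunP => i; rewrite !ffunE liftK].
by apply/ffunP => i; rewrite ffunE; case: unliftP => [j ->|-> //]; rewrite ffunE.
Qed.

(** Induction on the number of sites: removing the first site lowers the count
    of its colour by one. *)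
Lemma card_occurrences n (c : 'I_q -> nat) : \sum_k c k = n ->
  (\sum_(s : config n q) [forall k, occurrences s k == c k]) * \prod_k (c k)`! = n`!.
Proof.
elim: n c => [|n IH] c csum.
  have c0 k : c k = 0.
    by apply/eqP; move/eqP: csum; rewrite sum_nat_eq0 => /forallP /(_ k).
  rewrite [X in _ * X]big1 => [|k _]; last by rewrite c0.
  rewrite muln1 (eq_bigr (fun=> 1)) => [|s _]; last first.
    by apply/eqP; rewrite eqb1; apply/forallP => k; rewrite /occurrences big_ord0 c0.
  by rewrite sum1_card card_ffun !card_ord expn0.
rewrite (reindex _ (glue_bij n)) /= -(pair_big predT predT
  (fun k s => [forall j, occurrences (glue (k, s)) j == c j] : nat)) /= big_distrl /=.
have -> : n.+1`! = \sum_k c k * n`! by rewrite -big_distrl /= csum factS.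
apply: eq_bigr => k _.
have [ck|ck] := posnP (c k).
  rewrite big1 ?mul0n ?ck // => s _; apply/eqP; rewrite eqb0.
  by apply/forallPn; exists k; rewrite occurrences_glue /= eqxx ck.
pose c' j := c j - (k == j).
have c'sum : \sum_j c' j = n.
  apply/eqP; rewrite -eqSS -csum (bigD1 k) //= [X in _ == X](bigD1 k) //=.
  rewrite /c' eqxx -addSn -[(_ - true).+1]addn1 subnK // eqn_add2l; apply/eqP.
  by apply: eq_bigr => j; rewrite eq_sym => /negPf ->; rewrite subn0.
rewrite -(IH c' c'sum) mulnCA; congr (_ * _).
  apply: eq_bigr => s _; congr nat_of_bool; apply: eq_forallb => j.
  rewrite occurrences_glue /= /c'; case: (k =P j) => [<-|_]; last by rewrite subn0.
  by rewrite (_ : nat_of_bool true = 1) // add1n subn1 -{1}(prednK ck) eqSS.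
rewrite [LHS](bigD1 k) //= [in RHS](bigD1 k) //= mulnA; congr (_ * _).
  by rewrite /c' eqxx subn1 -{1 2}(prednK ck) factS.
by apply: eq_bigr => j; rewrite /c' eq_sym => /negPf ->; rewrite subn0.
Qed.
End multinomial_counting.

Lemma sum_config_occurrences (R : realType) q n (F : {ffun 'I_q -> nat} -> R) :
  \sum_(s : config n q) F [ffun k => occurrences s k] =
  \sum_(c : {ffun 'I_q -> 'I_n.+1} | (\sum_k c k == n)%N)
    n`!%:R / (\prod_k (c k)`!%:R) * F [ffun k => c k : nat].
Proof.
have occurrences_le (s : config n q) k : (occurrences s k < n.+1)%N.
  by rewrite ltnS -[X in (_ <= X)%N](sum_occurrences s) (bigD1 k) //= leq_addr.
pose oc (s : config n q) : {ffun 'I_q -> 'I_n.+1} := [ffun k => Ordinal (occurrences_le s k)].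
rewrite (partition_big oc (fun c => (\sum_k c k == n)%N)) => [|s _]; last first.
  apply/eqP; rewrite -[RHS](sum_occurrences s); apply: eq_bigr => k _.
  by rewrite ffunE.
apply: eq_bigr => c /eqP csum.
rewrite (eq_bigr (fun=> F [ffun k => c k : nat])) => [|s /andP[_ /eqP <-]]; last first.
  by congr F; apply/ffunP => k; rewrite !ffunE.
rewrite sumr_const -[LHS]mulr_natl; congr (_ * _).
rewrite -(card_occurrences csum) natrM -natr_prod.
rewrite mulfK; last by rewrite pnatr_eq0 -lt0n prodn_gt0 // => k; exact: fact_gt0.
congr (_%:R); rewrite -sum1_card big_mkcond; apply: eq_bigr => s _.
have -> : (s \in (fun i => oc i == c)) = [forall k, occurrences s k == c k].
  rewrite unfold_in; apply/eqP/forallP => [<- k|h]; first by rewrite ffunE.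
  by apply/ffunP => k; apply/val_inj; rewrite ffunE /=; exact/eqP/h.
by case: ifP.
Qed.

(** * Triangular coordinates on the hyperplane of zero sum *)

Section product_volume.
Context d1 d2 (T1 : measurableType d1) (T2 : measurableType d2) (R : realType).
Variables (m1 : {sigma_finite_measure set T1 -> \bar R})
          (m2 : {sigma_finite_measure set T2 -> \bar R}).

(** Packing the product as a sigma-finite measure lets products be iterated. *)
Definition product_volume : set (T1 * T2)%type -> \bar R := (m1 \x m2)%E.

HB.instance Definition _ := Measure.on product_volume.

Let product_volume_sigma_finite : sigma_finite setT product_volume.
Proof.
apply: isSigmaFinite.sigma_finiteT.
exact: (lebesgue_integral_fubini.measure_function_Measure_isSigmaFinite__to__measure_function_isSigmaFinite m1 m2).
Qed.

HB.instance Definition _ := Measure_isSigmaFinite.Build _ _ _ product_volume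
  product_volume_sigma_finite.

Definition product_sfm : {sigma_finite_measure set (T1 * T2)%type -> \bar R} :=
  product_volume.
End product_volume.

Section product_prob.
Context d1 d2 (T1 : measurableType d1) (T2 : measurableType d2) (R : realType).
Definition product_prob (P1 : probability T1 R) (P2 : probability T2 R) :
  probability (T1 * T2)%type R := (P1 \x P2)%E.
End product_prob.

Section euclidean.
Variable R : realType.

Fixpoint euclid_display (d : nat) : measure_display :=
  if d is d'.+1 then measure_prod_display ((R.-ocitv.-measurable).-sigma%mdisp, euclid_display d')
  else default_measure_display.

(** [R^d] as an iterated product, so that integrals over it are computed one
    coordinate at a time. *)
Fixpoint euclid (d : nat) : measurableType (euclid_display d) :=
  match d return measurableType (euclid_display d) with
  | 0 => unit
  | d'.+1 => (measurableTypeR R * euclid d')%type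
  end.

Fixpoint vol (d : nat) : {sigma_finite_measure set (euclid d) -> \bar R} :=
  match d return {sigma_finite_measure set (euclid d) -> \bar R} with
  | 0 => @dirac _ unit tt R
  | d'.+1 => product_sfm (@lebesgue_measure R) (vol d')
  end.

Fixpoint normal_product (sg : nat -> R) (d : nat) : probability (euclid d) R :=
  match d return probability (euclid d) R with
  | 0 => @dirac _ unit tt R
  | d'.+1 => product_prob (normal_prob 0 (sg d')) (normal_product sg d')
  end.

Lemma vol_setX d (A : set R) (B : set (euclid d)) :
  measurable A -> measurable B ->
  vol d.+1 (A `*` B) = (lebesgue_measure A * vol d B)%E.
Proof. by move=> mA mB; rewrite -(product_measure1E (@lebesgue_measure R) (vol d) mA mB). Qed.

(** The vector of [d.+1] entries with zero sum that has triangular coordinates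
    [w]: its first entry is [w.1] and the others are those of the vector given
    by [w.2], shifted to restore the sum (Helmert's transformation without its
    normalisation). Triangularity makes the squared norm diagonal and turns the
    fundamental cells of the lattice into boxes. *)
Fixpoint helmert (d : nat) : euclid d -> nat -> R :=
  match d return euclid d -> nat -> R with
  | 0 => fun _ _ => 0
  | d'.+1 => fun w i =>
      if i is i'.+1 then helmert w.2 i' - w.1 / d'.+1%:R else w.1
  end.

Fixpoint helmert_inv (d : nat) : (nat -> R) -> euclid d :=
  match d return (nat -> R) -> euclid d with
  | 0 => fun _ => tt
  | d'.+1 => fun y => (y 0 - (\sum_(i < d'.+2) y i) / d'.+2%:R,
                       helmert_inv d' (fun i => y i.+1))
  end.

Lemma helmert_invK d (y : nat -> R) i : (i <= d)%N ->
  helmert (helmert_inv d y) i = y i - (\sum_(i < d.+1) y i) / d.+1%:R.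
Proof.
elim: d y i => [|d IH] y [|i] //= id.
- by rewrite big_ord_recl big_ord0 addr0 divr1 subrr.
- rewrite IH // [in RHS]big_ord_recl [in X in _ - X / d.+1%:R]big_ord_recl /=.
  rewrite /bump /=; set S := \sum_(_ < _) _.
  rewrite -[d.+2%:R]natr1; have d1 : 0 < d.+1%:R :> R by [].
  by field; rewrite !gt_eqF // addr_gt0.
Qed.

Lemma sum_helmert d (w : euclid d) : \sum_(i < d.+1) helmert w i = 0.
Proof.
elim: d w => [|d IH] w; first by rewrite big_ord_recl big_ord0 addr0.
rewrite big_ord_recl /= sumrB.
rewrite (eq_bigr (fun i : 'I_d.+1 => helmert w.2 i)) // IH sumr_const card_ord.
by rewrite sub0r -[(w.1 / _) *+ _]mulr_natr divfK ?subrr // pnatr_eq0.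
Qed.

Fixpoint quad (d : nat) : euclid d -> R :=
  match d return euclid d -> R with
  | 0 => fun _ => 0
  | d'.+1 => fun w => d'.+2%:R / d'.+1%:R * w.1 ^+ 2 + quad w.2
  end.

Lemma sum_sqr_helmert d (w : euclid d) : \sum_(i < d.+1) helmert w i ^+ 2 = quad w.
Proof.
elim: d w => [|d IH] w; first by rewrite big_ord_recl big_ord0 addr0 expr0n.
rewrite big_ord_recl /= -IH.
have e (i : 'I_d.+1) : (helmert w.2 i - w.1 / d.+1%:R) ^+ 2 =
  helmert w.2 i ^+ 2 - 2 * (w.1 / d.+1%:R) * helmert w.2 i + (w.1 / d.+1%:R) ^+ 2.
  by ring.
rewrite (eq_bigr (fun i : 'I_d.+1 => helmert w.2 i ^+ 2 -
  2 * (w.1 / d.+1%:R) * helmert w.2 i + (w.1 / d.+1%:R) ^+ 2)) => [|i _]; last exact: e.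
rewrite big_split sumrB /= -mulr_sumr sum_helmert mulr0 subr0 sumr_const card_ord.
rewrite -[((w.1 / _) ^+ 2) *+ _]mulr_natl -[d.+2%:R]natr1.
have d1 : 0 < d.+1%:R :> R by [].
by field; rewrite gt_eqF.
Qed.

Fixpoint sqnorm (d : nat) : euclid d -> R :=
  match d return euclid d -> R with
  | 0 => fun _ => 0
  | d'.+1 => fun w => w.1 ^+ 2 + sqnorm w.2
  end.

Lemma sqnorm_le_quad d (w : euclid d) : sqnorm w <= quad w.
Proof.
elim: d w => [|d IH] w //=; apply: lerD => //.
rewrite -[leLHS]mul1r ler_wpM2r ?sqr_ge0 // ler_pdivlMr // mul1r ler_nat.
by rewrite leqnSn.
Qed.

Fixpoint box (dl : R) (d : nat) : euclid d -> set (euclid d) :=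
  match d return euclid d -> set (euclid d) with
  | 0 => fun _ => setT
  | d'.+1 => fun p => [set` `[p.1, p.1 + dl[] `*` box dl p.2
  end.

Lemma measurable_box dl d (p : euclid d) : measurable (box dl p).
Proof.
elim: d p => [|d IH] p /=; first exact: measurableT.
by apply: measurableX => //; exact: measurable_itv.
Qed.

Lemma vol_box dl d (p : euclid d) : 0 <= dl -> vol d (box dl p) = (dl ^+ d)%:E.
Proof.
move=> dl0; elim: d p => [|d IH] p; first by rewrite /= diracT expr0.
rewrite [box _ _]/= vol_setX; [|exact: measurable_itv|exact: measurable_box].
rewrite IH lebesgue_measure_itv /= lte_fin.
have [h|h] := ltP p.1 (p.1 + dl).
  by rewrite -EFinD -EFinM addrAC subrr add0r exprS.
have -> : dl = 0 by apply: le_anti; rewrite dl0 -(lerD2l p.1) addr0 h.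
by rewrite mul0e exprS mul0r.
Qed.

Lemma helmert_box dl d (p w : euclid d) i : box dl p w ->
  `|helmert w i - helmert p i| <= d%:R * dl.
Proof.
elim: d p w i => [|d IH] p w i; first by rewrite /= subrr normr0 mul0r.
move=> [/=]; rewrite in_itv /= => /andP[w1 w2] wb.
have dl0 : 0 <= dl by lra.
have d0 : 0 <= d%:R :> R by [].
case: i => [|i]; rewrite -natr1 mulrDl mul1r.
  by rewrite ger0_norm ?subr_ge0 //; nra.
rewrite (_ : _ - _ = (helmert w.2 i - helmert p.2 i) - (w.1 - p.1) / (d%:R + 1)).
  apply: le_trans (ler_normB _ _) _; apply: lerD; first exact: IH.
  have d1 : 0 < d%:R + 1 :> R by lra.
  rewrite ger0_norm; last by rewrite divr_ge0 ?subr_ge0 //; lra.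
  rewrite ler_pdivrMr //; nra.
by rewrite mulrBl; ring.
Qed.

Lemma sqnorm_box dl d (p w : euclid d) : dl <= 1 -> box dl p w ->
  sqnorm w <= 2 * sqnorm p + 2 * d%:R.
Proof.
move=> dl1; elim: d p w => [|d IH] p w; first by rewrite /= !mulr0 addr0.
move=> [/=]; rewrite in_itv /= => /andP[w1 w2] /IH h.
rewrite -natr1; have := sqr_ge0 (p.1 - (w.1 - p.1)); nra.
Qed.

(** Given the sum [M] of the integers to be found, each of them is read off the
    corresponding coordinate by rounding down, and the others have the
    remaining sum. *)
Fixpoint lattice_floor (sg : R) (d : nat) : int -> euclid d -> nat -> int :=
  match d return int -> euclid d -> nat -> int with
  | 0 => fun M _ _ => M
  | d'.+1 => fun M w i => let a := Num.floor (M%:~R / d'.+2%:R + sg * w.1) in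
      if i is i'.+1 then lattice_floor sg (M - a) w.2 i' else a
  end.

Definition corner sg d (c : nat -> int) : euclid d :=
  helmert_inv d (fun i => (c i)%:~R / sg).

Let cornerS sg d (c : nat -> int) : 
  corner sg d.+1 c = ((c 0)%:~R / sg - (\sum_(i < d.+2) c i)%:~R / d.+2%:R / sg,
                      corner sg d (fun i => c i.+1)) :> euclid d.+1.
Proof.
rewrite /corner /=; congr pair; congr (_ - _).
by rewrite -mulr_suml -rmorph_sum /= mulrAC.
Qed.

Lemma sum_lattice_floor sg d M (w : euclid d) : \sum_(i < d.+1) lattice_floor sg M w i = M.
Proof.
elim: d M w => [|d IH] M w; first by rewrite big_ord_recl big_ord0 addr0.
by rewrite big_ord_recl /= IH addrC subrK.
Qed.

(** This and the next lemma say that the boxes at the lattice points of a given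
    sum tile the space. *)
Lemma corner_lattice_floor sg d M (w : euclid d) : 0 < sg ->
  box sg^-1 (corner sg d (lattice_floor sg M w)) w.
Proof.
move=> sg0; elim: d M w => [|d IH] M w //.
rewrite cornerS sum_lattice_floor; split; last exact: IH.
rewrite /= in_itv /=; set a := Num.floor _.
have /andP[a1 a2] := floor_itv (M%:~R / d.+2%:R + sg * w.1).
rewrite -/a in a1 a2; rewrite intrD in a2.
move: (M%:~R / d.+2%:R) (a%:~R : R) a1 a2 => m x a1 a2.
apply/andP; split.
- by rewrite -mulrBl ler_pdivrMr //; lra.
- rewrite -mulrBl -[X in _ + X]mul1r -mulrDl ltr_pdivlMr //; lra.
Qed.

Lemma lattice_floor_corner sg d (c : nat -> int) (w : euclid d) : 0 < sg ->
  box sg^-1 (corner sg d c) w ->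
  forall i, (i <= d)%N -> lattice_floor sg (\sum_(i < d.+1) c i) w i = c i.
Proof.
move=> sg0; elim: d c w => [|d IH] c w.
  by move=> _ [|//] _; rewrite big_ord_recl big_ord0 addr0.
rewrite cornerS => -[/=]; rewrite in_itv /= => /andP[h1 h2] wb.
set M := \sum_(i < d.+2) c i in h1 h2 *.
have c0 : Num.floor (M%:~R / d.+2%:R + sg * w.1) = c 0.
  apply: floor_def; rewrite intrD.
  move: h1 h2; move: (M%:~R / d.+2%:R) ((c 0)%:~R : R) => m x.
  rewrite -!mulrBl (_ : (x - m) / sg + sg^-1 = (x - m + 1) / sg); last first.
    by field; rewrite gt_eqF.
  rewrite ler_pdivrMr // ltr_pdivlMr //.
  by lra.
case=> [|i] id; rewrite c0 //.
rewrite -(IH (fun i => c i.+1) w.2 wb i id); congr lattice_floor.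
by rewrite /M big_ord_recl addrC addKr.
Qed.
End euclidean.

(** * Gaussian and quartic laws *)

Section densities.
Local Open Scope ereal_scope.
Context d (T : measurableType d) (R : realType).
Variables (mu nu : {measure set T -> \bar R}) (f : T -> R).
Hypotheses (mf : measurable_fun setT f) (f0 : forall x, (0 <= f x)%R).
Hypothesis nuE : forall A, measurable A -> nu A = \int[mu]_(x in A) (f x)%:E.
Import HBNNSimple.

Let mfE : measurable_fun setT (fun x => (f x)%:E).
Proof. exact/measurable_EFinP. Qed.

(* Linearity first, then monotone convergence along simple functions. *)
Let integral_density_nnsfun (h : {nnsfun T >-> R}) :
  \int[nu]_x (h x)%:E = \int[mu]_x ((f x)%:E * (h x)%:E).
Proof.
under [LHS]eq_integral do rewrite fimfunE -fsumEFin//.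
rewrite ge0_integral_fsum//; last 2 first.
- by move=> r; exact/measurable_EFinP/measurable_funM.
- by move=> r x _; rewrite nnfun_muleindic_ge0.
have e x : (f x)%:E * (h x)%:E = \sum_(r \in range h)
    (f x)%:E * (r * \1_(h @^-1` [set r]) x)%:E.
  rewrite {1}fimfunE -fsumEFin// ge0_mule_fsumr// => r.
  by rewrite nnfun_muleindic_ge0.
under [RHS]eq_integral do rewrite e.
rewrite ge0_integral_fsum//; last 2 first.
- move=> r; apply: emeasurable_funM => //.
  by apply/measurable_EFinP/measurable_funM.
- move=> r x _; apply: mule_ge0; first by rewrite lee_fin.
  by rewrite nnfun_muleindic_ge0.
apply: eq_fsbigr => r _; rewrite integralZl_indic_nnsfun// integral_indic// setIT.
rewrite nuE//.
have [r0|r0] := ltP r 0%R.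
  rewrite preimage_nnfun0// integral_set0 mule0.
  by rewrite integral0_eq // => x _; rewrite indicE in_set0 mulr0 mule0.
rewrite integral_mkcond -ge0_integralZl//; last 2 first.
- apply/(measurable_restrictT _ _).1 => //; exact: measurable_funTS.
- by move=> x _; apply: erestrict_ge0 => y _; rewrite lee_fin.
apply: eq_integral => x _; rewrite patchE indicE.
by case: ifPn => _; rewrite ?mulr1 ?mulr0 ?mule0// muleC.
Qed.

Lemma integral_density (G : T -> \bar R) : measurable_fun setT G ->
  (forall x, 0 <= G x) -> \int[nu]_x G x = \int[mu]_x ((f x)%:E * G x).
Proof.
move=> mG G0; pose h := nnsfun_approx measurableT mG.
have hG x : EFin \o h ^~ x @ \oo --> G x.
  by apply: (cvg_nnsfun_approx measurableT mG) => // y _; exact: G0.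
have l1 : \int[nu]_x (h n x)%:E @[n --> \oo] --> \int[nu]_x G x.
  rewrite (eq_integral (fun x => limn (EFin \o h ^~ x))) => [|x _].
    apply: cvg_monotone_convergence => //.
    - by move=> n; exact/measurable_EFinP/measurable_funP.
    - by move=> n x _; rewrite lee_fin.
    - by move=> x _ m n mn; rewrite lee_fin; exact/lefP/nd_nnsfun_approx.
  by apply/esym/cvg_lim => //; exact: hG.
have l2 : \int[mu]_x ((f x)%:E * (h n x)%:E) @[n --> \oo] -->
    \int[mu]_x ((f x)%:E * G x).
  rewrite (eq_integral (fun x => limn (fun n => (f x)%:E * (h n x)%:E))) => [|x _].
    apply: cvg_monotone_convergence => //.
    - move=> n; apply: emeasurable_funM => //.
      by apply/measurable_EFinP/measurable_funP.
    - by move=> n x _; rewrite mule_ge0// lee_fin.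
    - move=> x _ m n mn; rewrite lee_wpmul2l ?lee_fin//.
      exact/lefP/nd_nnsfun_approx.
  by apply/esym/cvg_lim => //; apply: cvgeZl => //; exact: hG.
have e : (fun n => \int[nu]_x (h n x)%:E) =
    (fun n => \int[mu]_x ((f x)%:E * (h n x)%:E)).
  by apply/funext => n; exact: integral_density_nnsfun.
by rewrite e in l1; apply: cvg_unique l1 l2.
Qed.
End densities.

Section tensor.
Local Open Scope ereal_scope.
Context d1 d2 (T1 : measurableType d1) (T2 : measurableType d2) (R : realType).
Variables (m1 : {sigma_finite_measure set T1 -> \bar R})
          (m2 : {sigma_finite_measure set T2 -> \bar R}).

Lemma integral_tensor (f : T1 -> \bar R) (g : T2 -> \bar R) :
  measurable_fun setT f -> measurable_fun setT g ->
  (forall x, 0 <= f x) -> (forall y, 0 <= g y) ->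
  \int[m1 \x m2]_z (f z.1 * g z.2) = \int[m1]_x f x * \int[m2]_y g y.
Proof.
move=> mf mg f0 g0; rewrite fubini_tonelli1//.
- rewrite /fubini_F.
  under eq_integral do rewrite /= ge0_integralZl//.
  rewrite ge0_integralZr// integral_ge0//.
- by apply: emeasurable_funM; apply: measurableT_comp.
- by move=> z; rewrite mule_ge0.
Qed.
End tensor.

Section euclid_measurability.
Variable R : realType.

Lemma measurable_euclid_fst d : measurable_fun setT (fun w : euclid R d.+1 => w.1 : R).
Proof. exact: (@measurable_fst _ _ (measurableTypeR R) (euclid R d)). Qed.

Lemma measurable_euclid_snd d : measurable_fun setT (fun w : euclid R d.+1 => w.2 : euclid R d).
Proof. exact: (@measurable_snd _ _ (measurableTypeR R) (euclid R d)). Qed.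

Lemma measurable_helmert d i : measurable_fun setT (fun w : euclid R d => helmert w i).
Proof.
elim: d i => [|d IH] [|i]; [exact: measurable_cst..| |].
  exact: measurable_euclid_fst.
apply: measurable_funB; last first.
  by apply: measurable_funM; [exact: measurable_euclid_fst|exact: measurable_cst].
exact: (measurableT_comp (IH i) (@measurable_euclid_snd d)).
Qed.

Lemma measurable_quad d : measurable_fun setT (@quad R d).
Proof.
elim: d => [|d IH]; first exact: measurable_cst.
apply: measurable_funD; last exact: (measurableT_comp IH (@measurable_euclid_snd d)).
apply: measurable_funM; first exact: measurable_cst.
by apply: measurable_funX; exact: measurable_euclid_fst.
Qed.

Lemma measurable_sqnorm d : measurable_fun setT (@sqnorm R d).
Proof.
elim: d => [|d IH]; first exact: measurable_cst.
apply: measurable_funD; last exact: (measurableT_comp IH (@measurable_euclid_snd d)).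
by apply: measurable_funX; exact: measurable_euclid_fst.
Qed.
End euclid_measurability.

Section gaussian_weights.
Variable R : realType.
Local Notation leb := (@lebesgue_measure R).
Implicit Types (k : R).

Lemma normal_pdf0E (s x : R) : s != 0 ->
  normal_pdf 0 s x = normal_peak s * expR (- (x ^+ 2 / (2 * s ^+ 2))).
Proof.
move=> s0; rewrite normal_pdfE // /normal_fun subr0 mulNr.
by rewrite -[s ^+ 2 *+ 2]mulr_natl.
Qed.

Lemma integral_gauss_weight k : 0 < k ->
  exists2 c : R, 0 < c & (\int[leb]_x (expR (- (k * x ^+ 2)))%:E = c%:E)%E.
Proof.
move=> k0; pose s := Num.sqrt (2 * k)^-1.
have s0 : 0 < s by rewrite sqrtr_gt0 invr_gt0 mulr_gt0.
have s2 : s ^+ 2 = (2 * k)^-1 by rewrite sqr_sqrtr // invr_ge0 mulr_ge0 // ltW.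
have p0 : 0 < normal_peak s by rewrite normal_peak_gt0 // gt_eqF.
exists (normal_peak s)^-1; first by rewrite invr_gt0.
have e x : expR (- (k * x ^+ 2)) = (normal_peak s)^-1 * normal_pdf 0 s x.
  rewrite normal_pdf0E ?gt_eqF // mulKf ?gt_eqF // s2; congr expR.
  by field; rewrite gt_eqF.
under eq_integral do rewrite e EFinM.
rewrite ge0_integralZl_EFin //.
- by rewrite integral_normal_pdf mule1.
- by move=> x _; rewrite lee_fin normal_pdf_ge0.
- by apply/measurable_EFinP; exact: measurable_normal_pdf.
- by rewrite invr_ge0 ltW.
Qed.

Lemma measurable_gauss_weight k d :
  measurable_fun setT (fun w : euclid R d => expR (- (k * sqnorm w))).
Proof.
apply: measurableT_comp => //; apply: measurableT_comp => //.
by apply: measurable_funM => //; exact: measurable_sqnorm.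
Qed.

Lemma integral_vol_gauss_weight k d : 0 < k -> exists2 c : R, 0 < c &
  (\int[vol R d]_w (expR (- (k * sqnorm w)))%:E = c%:E)%E.
Proof.
move=> k0; elim: d => [|d [c c0 IH]].
  exists 1 => //; rewrite integral_dirac // ?diracT ?mul1e /= ?mulr0 ?oppr0 ?expR0 //.
have [c1 c10 I1] := integral_gauss_weight k0.
exists (c1 * c); first by rewrite mulr_gt0.
rewrite EFinM -I1 -IH -integral_tensor //.
- by apply: eq_integral => -[x w] _ /=; rewrite -EFinM -expRD mulrDr opprD.
- apply/measurable_EFinP/measurableT_comp => //; apply: measurableT_comp => //.
  by apply: measurable_funM => //; exact: measurable_funX.
- by apply/measurable_EFinP; exact: measurable_gauss_weight.
Qed.

(** Provides the dominating function. *)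
Lemma integrable_vol_gauss_weight k d : 0 < k ->
  (vol R d).-integrable setT (fun w => (expR (- (k * sqnorm w)))%:E).
Proof.
move=> k0; apply/integrableP; split.
  by apply/measurable_EFinP; exact: measurable_gauss_weight.
have [c _ E] := integral_vol_gauss_weight d k0.
under eq_integral do rewrite gee0_abs ?lee_fin ?expR_ge0 //.
by rewrite E ltry.
Qed.
End gaussian_weights.

Section has_density.
Local Open Scope ereal_scope.
Context d (T : measurableType d) (R : realType).

(** Stated for integrals and not for sets, since this form passes to products by
    Tonelli's theorem and to expectations without approximation. *)
Definition has_density (nu mu : set T -> \bar R) (f : T -> R) : Prop :=
  forall G : T -> \bar R, measurable_fun setT G -> (forall x, 0 <= G x) ->
    \int[nu]_x G x = \int[mu]_x ((f x)%:E * G x).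

Section density_probability.
Variables (mu : {measure set T -> \bar R}) (f : T -> R).
Hypotheses (mf : measurable_fun setT f) (f0 : forall x, (0 <= f x)%R)
  (f1 : \int[mu]_x (f x)%:E = 1).

Definition density_measure
    of measurable_fun setT f & (forall x, (0 <= f x)%R)
     & \int[mu]_x (f x)%:E = 1 :=
  fun A : set T => \int[mu]_(x in A) (f x)%:E.
Local Notation nu := (density_measure mf f0 f1).

Let nu0 : nu set0 = 0.
Proof. by rewrite /density_measure integral_set0. Qed.

Let nu_ge0 A : 0 <= nu A.
Proof. by apply: integral_ge0 => x _; rewrite lee_fin. Qed.

Let nu_sigma_additive : semi_sigma_additive nu.
Proof.
move=> A mA tA mUA; rewrite /density_measure ge0_integral_bigcup//=.
- apply: is_cvg_ereal_nneg_natsum_cond => n _ _.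
  by apply: integral_ge0 => x _; rewrite lee_fin.
- by apply/measurable_EFinP; exact: measurable_funTS.
- by move=> x _; rewrite lee_fin.
Qed.

HB.instance Definition _ := isMeasure.Build _ _ _ nu nu0 nu_ge0 nu_sigma_additive.

Let nu1 : nu setT = 1.
Proof. by []. Qed.

HB.instance Definition _ := @Measure_isProbability.Build _ _ R nu nu1.

Definition density_probability : probability T R := nu.

Lemma density_probability_has_density : has_density density_probability mu f.
Proof. by move=> G mG G0; apply: integral_density. Qed.
End density_probability.
End has_density.

Section product_density.
Local Open Scope ereal_scope.
Context d1 d2 (T1 : measurableType d1) (T2 : measurableType d2) (R : realType).
Variables (n1 m1 : {sigma_finite_measure set T1 -> \bar R})
          (n2 m2 : {sigma_finite_measure set T2 -> \bar R}).
Variables (f1 : T1 -> R) (f2 : T2 -> R).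
Hypotheses (mf1 : measurable_fun setT f1) (mf2 : measurable_fun setT f2).
Hypotheses (f10 : forall x, (0 <= f1 x)%R) (f20 : forall x, (0 <= f2 x)%R).

Lemma product_has_density : has_density n1 m1 f1 -> has_density n2 m2 f2 ->
  has_density (n1 \x n2) (m1 \x m2) (fun z => f1 z.1 * f2 z.2)%R.
Proof.
move=> h1 h2 G mG G0.
have mf2G : measurable_fun setT (fun z : T1 * T2 => (f2 z.2)%:E * G z).
  apply: emeasurable_funM => //.
  by apply/measurable_EFinP; apply: measurableT_comp.
have f2G0 z : 0 <= (f2 z.2)%:E * G z by rewrite mule_ge0// lee_fin.
have mF : measurable_fun setT (fun z : T1 * T2 => (f1 z.1 * f2 z.2)%:E * G z).
  apply: emeasurable_funM => //; apply/measurable_EFinP.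
  by apply: measurable_funM; apply: measurableT_comp.
rewrite !fubini_tonelli1//; last first.
  by move=> z; rewrite mule_ge0// lee_fin mulr_ge0.
rewrite /fubini_F.
rewrite (eq_integral (fun x => \int[m2]_y ((f2 y)%:E * G (x, y)))) => [|x _]; last first.
  by rewrite h2// ; exact: measurableT_comp mG (measurable_pair1 x).
rewrite h1//; last 2 first.
- exact: (@measurable_fun_fubini_tonelli_F _ _ _ _ _ m2 _ mf2G f2G0).
- by move=> x; apply: integral_ge0 => y _; exact: (f2G0 (x, y)).
apply: eq_integral => x _ /=; rewrite -ge0_integralZl//.
- by apply: eq_integral => y _; rewrite EFinM muleA.
- exact: measurableT_comp mf2G (measurable_pair1 x).
- by move=> y _; exact: (f2G0 (x, y)).
- by rewrite lee_fin.
Qed.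
End product_density.

Section limit_densities.
Variable R : realType.
Local Notation leb := (@lebesgue_measure R).

Lemma normal_prob_has_density (m s : R) :
  has_density (normal_prob m s) leb (normal_pdf m s).
Proof.
move=> G mG G0; apply: integral_density => //.
- exact: measurable_normal_pdf.
- by move=> x; exact: normal_pdf_ge0.
Qed.

(** Finite because [x^4 >= x^2 - 1], positive because the weight is bounded below
    on the unit interval. *)
Lemma integral_quartic_weight (g : R) : 0 < g ->
  exists2 c : R, 0 < c & (\int[leb]_x (expR (- (g * x ^+ 4)))%:E = c%:E)%E.
Proof.
move=> g0; have mq : measurable_fun setT (fun x : R => expR (- (g * x ^+ 4))).
  apply: measurableT_comp => //; apply: measurableT_comp => //.
  by apply: measurable_funM => //; exact: measurable_funX.
have [c c0 cE] := integral_gauss_weight g0.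
have ub : (\int[leb]_x (expR (- (g * x ^+ 4)))%:E <= (expR g * c)%:E)%E.
  rewrite EFinM -cE -ge0_integralZl_EFin //; last first.
  - apply/measurable_EFinP/measurableT_comp => //; apply: measurableT_comp => //.
    by apply: measurable_funM => //; exact: measurable_funX.
  apply: ge0_le_integral => //.
  - exact/measurable_EFinP.
  - apply/measurable_EFinP/measurable_funM => //.
    apply/measurableT_comp => //; apply: measurableT_comp => //.
    by apply: measurable_funM => //; exact: measurable_funX.
  - move=> x _; rewrite -EFinM lee_fin -expRD ler_expR.
    rewrite (exprM x 2 2); move: (x ^+ 2) => y; have := sqr_ge0 (y - 1/2); nra.
have lb : ((expR (- g))%:E <= \int[leb]_x (expR (- (g * x ^+ 4)))%:E)%E.
  have h : (\int[leb]_(x in `[0%R, 1%R]) (expR (- g))%:E = (expR (- g))%:E)%E.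
    by rewrite integral_cst //= lebesgue_measure_itv /= lte01 oppr0 adde0 mule1.
  rewrite -h; apply: (@le_trans _ _ (\int[leb]_(x in `[0%R, 1%R]) (expR (- (g * x ^+ 4)))%:E)%E).
    apply: ge0_le_integral => //.
    - by apply/measurable_EFinP; exact: measurable_funTS.
    - move=> x /=; rewrite in_itv /= => /andP[x0 x1].
      rewrite lee_fin ler_expR lerN2; have := exprn_ile1 4 x0 x1.
      by move: (x ^+ 4) => y; nra.
  by apply: ge0_subset_integral => //; exact/measurable_EFinP.
have fin : (\int[leb]_x (expR (- (g * x ^+ 4)))%:E \is a fin_num)%E.
  rewrite ge0_fin_numE; first exact: le_lt_trans ub (ltry _).
  by apply: integral_ge0 => x _; rewrite lee_fin expR_ge0.
exists (fine (\int[leb]_x (expR (- (g * x ^+ 4)))%:E)); last by rewrite fineK.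
by rewrite -lte_fin fineK //; apply: lt_le_trans lb; rewrite lte_fin expR_gt0.
Qed.

Lemma quartic_probability (g : R) : 0 < g ->
  exists (P : probability (measurableTypeR R) R) (k : R), [/\ 0 < k,
    has_density P leb (fun x => k * expR (- (g * x ^+ 4))) &
    forall A, measurable A ->
      P A = (\int[leb]_(x in A) (k * expR (- (g * x ^+ 4)))%:E)%E].
Proof.
move=> g0; have [c c0 cE] := integral_quartic_weight g0.
have mf : measurable_fun setT (fun x : measurableTypeR R => c^-1 * expR (- (g * x ^+ 4))).
  apply: measurable_funM => //.
  apply/measurableT_comp => //; apply: measurableT_comp => //.
  by apply: measurable_funM => //; exact: measurable_funX.
have f0 (x : measurableTypeR R) : 0 <= c^-1 * expR (- (g * x ^+ 4)).
  by rewrite mulr_ge0 ?expR_ge0 // invr_ge0 ltW.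
have f1 : (\int[leb]_x (c^-1 * expR (- (g * x ^+ 4)))%:E = 1)%E.
  under eq_integral do rewrite EFinM.
  rewrite ge0_integralZl_EFin //.
  - by rewrite cE -EFinM mulVf ?gt_eqF.
  - apply/measurable_EFinP/measurableT_comp => //; apply: measurableT_comp => //.
    by apply: measurable_funM => //; exact: measurable_funX.
  - by rewrite invr_ge0 ltW.
exists (density_probability mf f0 f1), c^-1; split => //; first by rewrite invr_gt0.
exact: density_probability_has_density.
Qed.

(** By [quad], these standard deviations make the product of normal laws the law
    with density proportional to [exp (- a |v|^2 / 2)] in triangular
    coordinates. *)
Definition helmert_sd (a : R) (d : nat) : R :=
  Num.sqrt (d.+1%:R / (d.+2%:R * a)).

Lemma helmert_sd_gt0 a d : 0 < a -> 0 < helmert_sd a d.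
Proof. by move=> a0; rewrite sqrtr_gt0 divr_gt0 // mulr_gt0. Qed.

Lemma normal_product_has_density a d : 0 < a -> exists2 k : R, 0 < k &
  has_density (normal_product (helmert_sd a) d) (vol R d)
    (fun w => k * expR (- (a / 2 * quad w))).
Proof.
move=> a0; elim: d => [|d [k k0 IH]].
  exists 1 => // G mG G0 /=; apply: eq_integral => x _.
  by rewrite mulr0 oppr0 expR0 mulr1 mul1e.
have s0 := helmert_sd_gt0 d a0.
set s := helmert_sd a d in s0.
have s2 : s ^+ 2 = d.+1%:R / (d.+2%:R * a).
  by rewrite sqr_sqrtr // divr_ge0 // mulr_ge0 // ltW.
have p0 : 0 < normal_peak s by rewrite normal_peak_gt0 // gt_eqF.
exists (normal_peak s * k); first by rewrite mulr_gt0.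
have mk : measurable_fun setT (fun w : euclid R d => k * expR (- (a / 2 * quad w))).
  apply: measurable_funM => //.
  apply/measurableT_comp => //; apply: measurableT_comp => //.
  by apply: measurable_funM => //; exact: measurable_quad.
have k0' (w : euclid R d) : 0 <= k * expR (- (a / 2 * quad w)).
  by rewrite mulr_ge0 ?expR_ge0 // ltW.
move=> G mG G0.
rewrite [LHS](product_has_density (n1 := normal_prob 0 s) (m1 := leb)
  (n2 := normal_product (helmert_sd a) d) (m2 := vol R d) (measurable_normal_pdf 0 s) mk
  (normal_pdf_ge0 0 s) k0' (@normal_prob_has_density 0 s) IH mG G0).
apply: eq_integral => -[x w] _ /=; congr (_%:E * _)%E.
rewrite normal_pdf0E ?gt_eqF // mulrACA -expRD; congr (_ * expR _).
rewrite s2 -opprD; congr (- _).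
have h1 : 0 < d.+1%:R :> R by [].
have h2 : 0 < d.+2%:R :> R by [].
by field; rewrite !gt_eqF.
Qed.
End limit_densities.

Section affine_normal.
Variable R : realType.
Local Notation leb := (@lebesgue_measure R).
Implicit Types (a c m s x y : R).

Let affine a c : measurableTypeR R -> measurableTypeR R := fun x => a * x + c.

Let measurable_affine a c : measurable_fun setT (affine a c).
Proof. by apply: measurable_funD => //; exact: measurable_funM. Qed.

(** Lebesgue measure is determined by its values on intervals. *)
Lemma lebesgue_measure_affine a c (A : set R) : a != 0 -> measurable A ->
  (leb A = `|a|%:E * leb [set x : R | A (a * x + c)%R])%E.
Proof.
move=> a0 mA; pose r := NngNum (normr_ge0 a).
have -> : (`|a|%:E * leb [set x : R | A (a * x + c)%R])%E =
  mscale r (pushforward leb (affine a c)) A by [].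
apply: lebesgue_measure_unique => // _ [[u v]] /= _ <-.
rewrite /mscale /= /pushforward.
have [ap|an] := ltP 0 a.
  have -> : affine a c @^-1` `]u, v] = [set` `](u - c) / a, (v - c) / a]].
    apply/seteqP; split => x; rewrite /affine /= !in_itv /= => /andP[h1 h2];
      apply/andP; split; move: h1 h2;
      rewrite ?ltr_pdivrMr ?ler_pdivlMr // (mulrC x); lra.
  rewrite !lebesgue_measure_itv /= !lte_fin ltr_pM2r ?invr_gt0 // ltrD2r.
  case: ifP => _; last by rewrite mule0.
  rewrite -!EFinD -EFinM gtr0_norm //; congr (_%:E).
  by field.
have {an} an : a < 0 by rewrite lt_neqAle a0.
have -> : affine a c @^-1` `]u, v] = [set` `[(v - c) / a, (u - c) / a[].
  apply/seteqP; split => x; rewrite /affine /= !in_itv /= => /andP[h1 h2];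
    apply/andP; split; move: h1 h2;
    rewrite ?ltr_ndivlMr ?ler_ndivrMr // (mulrC x); lra.
rewrite !lebesgue_measure_itv /= !lte_fin ltr_nM2r ?invr_lt0 // ltrD2r.
case: ifP => _; last by rewrite mule0.
rewrite -!EFinD -EFinM ltr0_norm //; congr (_%:E).
by field.
Qed.

Lemma integral_affine a c (G : R -> \bar R) : a != 0 ->
  measurable_fun setT G -> (forall x, 0 <= G x)%E ->
  (\int[leb]_x G (a * x + c)%R = `|a|^-1%:E * \int[leb]_x G x)%E.
Proof.
move=> a0 mG G0; have na0 : `|a| != 0 by rewrite normr_eq0.
pose r := NngNum (normr_ge0 a).
rewrite [in RHS](eq_measure_integral (mscale r (pushforward leb (affine a c)))) => [|A mA _]; last first.
  exact: lebesgue_measure_affine.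
rewrite ge0_integral_mscale // ge0_integral_pushforward //.
by rewrite muleA -EFinM mulVf // mul1e.
Qed.

Lemma normal_prob_affine a c s (A : set R) : a != 0 -> 0 < s -> measurable A ->
  normal_prob 0 s [set x : R | A (a * x + c)%R] = normal_prob c (`|a| * s) A.
Proof.
move=> a0 s0 mA; have na0 : 0 < `|a| by rewrite normr_gt0.
have as0 : `|a| * s != 0 by rewrite gt_eqF // mulr_gt0.
rewrite /normal_prob [LHS]integral_mkcond [RHS]integral_mkcond.
set B := [set x : R | A (a * x + c)%R].
pose F := (fun x => (normal_pdf 0 s x)%:E) \_ B.
pose H := (fun x => (normal_pdf c (`|a| * s) x)%:E) \_ A.
rewrite -/F -/H.
have -> : F = fun x => (`|a|%:E * H (a * x + c)%R)%E.
  apply/funext => x; rewrite /F /H !patchE.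
  rewrite (_ : (x \in B) = (a * x + c \in A)); last first.
    by apply/idP/idP; rewrite !inE.
  case: ifP => _; last by rewrite mule0.
  rewrite -EFinM; congr (_%:E).
  rewrite !normal_pdfE ?gt_eqF ?mulr_gt0 //.
  rewrite /normal_fun /normal_peak mulrA; congr (_ * expR _).
    have -> : (`|a| * s) ^+ 2 * pi *+ 2 = `|a| ^+ 2 * (s ^+ 2 * pi *+ 2).
      by rewrite exprMn -!mulrnAr !mulrA.
    rewrite sqrtrM ?sqr_ge0 // sqrtr_sqr normr_id invfM mulrA divff ?mul1r //.
    by rewrite gt_eqF.
  have as2 : (`|a| * s) ^+ 2 = a ^+ 2 * s ^+ 2.
    by rewrite exprMn real_normK ?num_real.
  rewrite addrK subr0 as2 -[s ^+ 2 *+ 2]mulr_natl.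
  rewrite -[(a ^+ 2 * s ^+ 2) *+ 2]mulr_natl.
  by field; rewrite a0 gt_eqF.
have mH : measurable_fun setT H.
  apply/(measurable_restrictT _ _).1 => //; apply/measurable_EFinP.
  by apply: measurable_funTS; exact: measurable_normal_pdf.
have H0 x : (0 <= H x)%E.
  by apply: erestrict_ge0 => y _; rewrite lee_fin normal_pdf_ge0.
rewrite ge0_integralZl_EFin //; last first.
  exact: measurableT_comp mH (measurable_affine a c).
by rewrite integral_affine // muleA -EFinM divff ?mul1e ?gt_eqF.
Qed.

(** Completing the square: the joint density factors into the normal law of the
    observation and the normal posterior of the mean. *)
Lemma normal_pdf_mixture al c s t x y : 0 < s -> 0 < t ->
  let r := Num.sqrt (al ^+ 2 * s ^+ 2 + t ^+ 2) in
  normal_pdf 0 s x * normal_pdf (c + al * x) t y =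
  normal_pdf c r y * normal_pdf (al * s ^+ 2 * (y - c) / r ^+ 2) (s * t / r) x.
Proof.
move=> s0 t0 r.
have r2 : r ^+ 2 = al ^+ 2 * s ^+ 2 + t ^+ 2.
  rewrite sqr_sqrtr //; apply: addr_ge0; last exact: sqr_ge0.
  by apply: mulr_ge0; exact: sqr_ge0.
have p0 : 0 < al ^+ 2 * s ^+ 2 + t ^+ 2.
  by apply: ltr_wpDl; [apply: mulr_ge0; exact: sqr_ge0|exact: exprn_gt0].
have r0 : 0 < r by rewrite sqrtr_gt0.
have str : 0 < s * t / r by rewrite divr_gt0 // mulr_gt0.
rewrite !normal_pdfE ?gt_eqF // /normal_peak /normal_fun.
rewrite mulrACA [RHS]mulrACA -!expRD -!invfM; congr (_^-1 * expR _).
  have pp : 0 <= pi *+ 2 :> R by rewrite mulrn_wge0 // pi_ge0.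
  have e z : 0 < z -> Num.sqrt (z ^+ 2 * pi *+ 2) = z * Num.sqrt (pi *+ 2).
    by move=> z0; rewrite -mulrnAr sqrtrM ?sqr_ge0 // sqrtr_sqr gtr0_norm.
  by rewrite !e //; field; rewrite gt_eqF.
rewrite -[s ^+ 2 *+ 2]mulr_natl -[t ^+ 2 *+ 2]mulr_natl -[r ^+ 2 *+ 2]mulr_natl.
rewrite -[_ *+ 2]mulr_natl !exprMn exprVn r2.
by field; rewrite !gt_eqF // exprMn.
Qed.

Let measurable_joint_normal_pdf al c t : 0 < t ->
  measurable_fun setT
   (fun z : measurableTypeR R * measurableTypeR R => normal_pdf (c + al * z.1) t z.2).
Proof.
move=> t0; have e (z : R * R) : normal_pdf (c + al * z.1) t z.2 =
    normal_peak t * expR (- (z.2 - (c + al * z.1)) ^+ 2 / (t ^+ 2 *+ 2)).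
  by rewrite normal_pdfE ?gt_eqF.
under eq_fun do rewrite e.
apply: measurable_funM => //; apply: measurableT_comp => //.
apply: measurable_funM => //; apply: measurableT_comp => //.
apply: measurable_funX; apply: measurable_funB; first exact: measurable_snd.
by apply: measurable_funD => //; apply: measurable_funM => //; exact: measurable_fst.
Qed.

(** Degenerate laws are included, because a linear functional may ignore some of
    the coordinates. *)
Lemma gaussian_law_mixture al c s t (A : set R) : 0 < s -> 0 <= t -> measurable A ->
  (\int[normal_prob 0 s]_x gaussian_law (c + al * x) t A =
   gaussian_law c (Num.sqrt (al ^+ 2 * s ^+ 2 + t ^+ 2)) A)%E.
Proof.
move=> s0; rewrite le_eqVlt => /orP[/eqP <-|t0] mA.
  rewrite expr0n /= addr0 -exprMn sqrtr_sqr normrM (gtr0_norm s0).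
  have [->|al0] := eqVneq al 0.
    rewrite normr0 mul0r /gaussian_law eqxx.
    under eq_integral do rewrite mul0r addr0.
    by rewrite integral_cst //= probability_setT mule1.
  rewrite /gaussian_law eqxx mulf_eq0 normr_eq0 (negbTE al0) gt_eqF //=.
  rewrite -normal_prob_affine //.
  set B := [set x : R | A (al * x + c)%R].
  have mB : measurable B.
    by have := measurable_affine al c measurableT mA; rewrite setTI.
  transitivity (\int[normal_prob 0 s]_x (\1_B x)%:E)%E.
    apply: eq_integral => x _; rewrite diracE indicE.
    suff -> : (c + al * x \in A) = (x \in B) by [].
    by apply/idP/idP; rewrite !inE /B /= addrC.
  by rewrite integral_indic // setIT.
have r0 : 0 < Num.sqrt (al ^+ 2 * s ^+ 2 + t ^+ 2).
  by rewrite sqrtr_gt0; apply: ltr_wpDl;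
    [apply: mulr_ge0; exact: sqr_ge0|exact: exprn_gt0].
rewrite /gaussian_law !gt_eqF //; set r := Num.sqrt _ in r0 *.
pose k x y := normal_pdf 0 s x * normal_pdf (c + al * x) t y * \1_A y.
have k0 x y : (0 <= (k x y)%:E)%E.
  by rewrite lee_fin !mulr_ge0 ?normal_pdf_ge0.
have mI : measurable_fun setT (\1_A : R -> R) by exact: measurable_indic.
have mI2 : measurable_fun setT
    (fun z : measurableTypeR R * measurableTypeR R => \1_A z.2 : R).
  exact: (measurableT_comp mI (@measurable_snd _ _ (measurableTypeR R) (measurableTypeR R))).
have mk : measurable_fun setT
    (fun z : measurableTypeR R * measurableTypeR R => (k z.1 z.2)%:E).
  apply/measurable_EFinP/measurable_funM; last exact: mI2.
  apply: measurable_funM; last exact: measurable_joint_normal_pdf.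
  exact: (measurableT_comp (measurable_normal_pdf 0 s)
    (@measurable_fst _ _ (measurableTypeR R) (measurableTypeR R))).
have mpdf m u : measurable_fun setT (fun x => (normal_pdf m u x)%:E : \bar R).
  by apply/measurable_EFinP; exact: measurable_normal_pdf.
have split_A m u : (normal_prob m u A =
    \int[leb]_y ((normal_pdf m u y)%:E * (\1_A y)%:E))%E.
  rewrite /normal_prob integral_mkcond; apply: eq_integral => y _.
  by rewrite patchE indicE; case: ifP; rewrite ?mule1 ?mule0.
have inner x : (\int[leb]_y (k x y)%:E = (normal_pdf 0 s x)%:E * normal_prob (c + al * x) t A)%E.
  rewrite split_A -ge0_integralZl_EFin //.
  - by apply: eq_integral => y _; rewrite /k -!EFinM mulrA.
  - by move=> y _; rewrite -EFinM lee_fin mulr_ge0 ?normal_pdf_ge0.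
  - apply: emeasurable_funM; first exact: mpdf.
    by apply/measurable_EFinP; exact: measurable_indic.
  - exact: normal_pdf_ge0.
have mixK x : (normal_pdf 0 s x)%:E \is a fin_num by [].
have fub := @fubini_tonelli _ _ _ _ _ leb leb _ mk (fun z => k0 z.1 z.2).
rewrite /fubini_F /fubini_G /= in fub.
have mprob : measurable_fun setT (fun x : measurableTypeR R => normal_prob (c + al * x) t A).
  have -> : (fun x : measurableTypeR R => normal_prob (c + al * x) t A) = fubini_F leb
      (fun z => (normal_pdf (c + al * z.1) t z.2)%:E * (\1_A z.2)%:E)%E.
    by apply/funext => x; rewrite split_A.
  apply: measurable_fun_fubini_tonelli_F.
    apply: emeasurable_funM.
      by apply/measurable_EFinP; exact: measurable_joint_normal_pdf.
    by apply/measurable_EFinP.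
  by move=> z; rewrite -EFinM lee_fin mulr_ge0 ?normal_pdf_ge0.
rewrite normal_prob_has_density //.
transitivity (\int[leb]_x \int[leb]_y (k x y)%:E)%E.
  by apply: eq_integral => x _; rewrite inner.
rewrite fub split_A; apply: eq_integral => y _.
have e x : (k x y)%:E = ((normal_pdf c r y * \1_A y)%:E *
   (normal_pdf (al * s ^+ 2 * (y - c) / r ^+ 2) (s * t / r) x)%:E)%E.
  by rewrite /k normal_pdf_mixture // -/r -EFinM mulrAC.
under eq_integral do rewrite e.
rewrite ge0_integralZl_EFin.
- by rewrite integral_normal_pdf mule1.
- exact: measurableT.
- by move=> x _; rewrite lee_fin normal_pdf_ge0.
- exact: mpdf.
- by apply: mulr_ge0; [exact: normal_pdf_ge0|rewrite indicE ler0n].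
Qed.
End affine_normal.

(** * Linear functionals and moments of the Gaussian part *)

Section helmert_law.
Variable R : realType.
Local Notation leb := (@lebesgue_measure R).

(** Variance of [w |-> \sum_i b i * helmert w i]: the coefficient of [w.1] in this sum
    is [b 0] minus the mean of the remaining [b i]. *)
Fixpoint helmert_var (sg : nat -> R) d (b : nat -> R) : R :=
  if d is d'.+1 then
    (b 0 - (\sum_(i < d'.+1) b i.+1) / d'.+1%:R) ^+ 2 * sg d' ^+ 2
    + helmert_var sg d' (fun i => b i.+1)
  else 0.

Lemma helmert_var_ge0 sg d b : 0 <= helmert_var sg d b.
Proof.
elim: d b => [|d IH] b //=; apply: addr_ge0 => //.
by apply: mulr_ge0; exact: sqr_ge0.
Qed.

Lemma helmert_varE a d b : 0 < a ->
  helmert_var (helmert_sd a) d b =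
  (\sum_(i < d.+1) b i ^+ 2 - (\sum_(i < d.+1) b i) ^+ 2 / d.+1%:R) / a.
Proof.
move=> a0; elim: d b => [|d IH] b /=.
  by rewrite !big_ord_recl !big_ord0 !addr0 divr1 subrr mul0r.
rewrite IH [in RHS]big_ord_recl [\sum_(i < d.+2) b i]big_ord_recl /=.
rewrite sqr_sqrtr; last by rewrite divr_ge0 // mulr_ge0 // ltW.
rewrite /bump /=; set S := \sum_(_ < _) _; set Q := \sum_(_ < _) _ ^+ 2.
rewrite -[d.+2%:R]natr1; have d1 : 0 < d.+1%:R :> R by [].
by field; rewrite !gt_eqF // addr_gt0.
Qed.

Let lin d (b : nat -> R) (w : euclid R d) : R := \sum_(i < d.+1) b i * helmert w i.

Let linS d b (x : R) (w : euclid R d) :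
  @lin d.+1 b (x, w) =
  (b 0 - (\sum_(i < d.+1) b i.+1) / d.+1%:R) * x + lin (fun i => b i.+1) w.
Proof.
rewrite /lin big_ord_recl /= /bump /=.
rewrite (eq_bigr (fun i : 'I_d.+1 => b i.+1 * helmert w i - b i.+1 * (x / d.+1%:R))); last first.
  by move=> i _; rewrite mulrBr.
by rewrite sumrB -mulr_suml; ring.
Qed.

Lemma measurable_helmert_combination d (b : nat -> R) :
  measurable_fun setT (fun w : euclid R d => \sum_(i < d.+1) b i * helmert w i).
Proof.
apply: measurable_sum => i; apply: measurable_funM => //.
exact: measurable_helmert.
Qed.

(** Conditionally on [w.1] the functional is normal by induction, with a mean that
    is affine in the normal variable [w.1]. *)
Lemma helmert_combination_law sg d (b : nat -> R) c (A : set R) :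
  (forall i, 0 < sg i) -> measurable A ->
  normal_product sg d [set w | A (c + \sum_(i < d.+1) b i * helmert w i)%R] =
  gaussian_law c (Num.sqrt (helmert_var sg d b)) A.
Proof.
move=> sg0 mA; elim: d b c => [|d IH] b c.
  rewrite /= sqrtr0 /gaussian_law eqxx !diracE.
  suff -> : (tt \in [set w : unit | A (c + \sum_(i < 1) b i * 0)]) = (c \in A) by [].
  apply/idP/idP; rewrite !inE /= big_ord_recl big_ord0 mulr0 !addr0 //.
pose al := b 0 - (\sum_(i < d.+1) b i.+1) / d.+1%:R.
set S := [set w | _].
transitivity (\int[normal_prob 0 (sg d)]_x normal_product sg d (xsection S x))%E; first by [].
rewrite /= -/al.
rewrite -[in RHS](@sqr_sqrtr _ (helmert_var sg d (fun i => b i.+1))) ?helmert_var_ge0 //.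
rewrite -gaussian_law_mixture ?sqrtr_ge0 //.
apply: eq_integral => x _; rewrite -(IH (fun i => b i.+1) (c + al * x)).
congr (normal_product sg d _); apply/seteqP; split => w;
  rewrite /xsection /= inE /S /=; have := linS b x w; rewrite /lin /= => ->;
  by rewrite -/al addrA.
Qed.
End helmert_law.

Section normal_moments.
Variable R : realType.
Local Notation leb := (@lebesgue_measure R).
Implicit Types (u v x s : R).

Let e v x : R := expR (- (v ^+ 2 * x ^+ 2)).

Let me v : measurable_fun setT (e v).
Proof.
apply: measurableT_comp => //; apply: measurableT_comp => //.
by apply: measurable_funM => //; exact: measurable_funX.
Qed.

Let mse v : measurable_fun setT (fun x => x ^+ 2 * e v x).
Proof. by apply: measurable_funM; [exact: measurable_funX|exact: me]. Qed.

Let e_ge0 v x : 0 <= e v x. Proof. exact: expR_ge0. Qed.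

Let se_ge0 v x : 0 <= x ^+ 2 * e v x.
Proof. by apply: mulr_ge0; [exact: sqr_ge0|exact: e_ge0]. Qed.

Let integral_e : exists2 c : R, 0 < c &
  forall v, 0 < v -> (\int[leb]_x (e v x)%:E = (c / v)%:E)%E.
Proof.
have [c c0 cE] := integral_gauss_weight (@ltr01 R).
exists c => // v v0.
have := @integral_affine R v 0 (fun x => (expR (- (1 * x ^+ 2)))%:E).
rewrite cE gtr0_norm // gt_eqF // -EFinM mulrC => <- //.
  by apply: eq_integral => x _; rewrite /e addr0 mul1r exprMn.
apply/measurable_EFinP; apply: measurableT_comp => //; apply: measurableT_comp => //.
by apply: measurable_funM => //; exact: measurable_funX.
Qed.

(* The two inequalities below let [t] tend to [0] without any limit process. *)
Let pinch_le (y c : R) : 0 <= y ->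
  (forall t, 0 < t -> t < 1 -> y * ((1 - t) * (2 - t)) <= c) -> 2 * y <= c.
Proof.
move=> y0 h; apply: contrapT => /negP; rewrite -ltNge => lt.
pose X := 2 * y - c; have X0 : 0 < X by rewrite /X; lra.
have k0 : 0 < 6 * y + X + 1 by lra.
pose t := X / (6 * y + X + 1).
have t0 : 0 < t by rewrite divr_gt0.
have t1 : t < 1 by rewrite ltr_pdivrMr // mul1r; lra.
have tX : t * (6 * y + X + 1) = X by rewrite divfK // gt_eqF.
have := h _ t0 t1.
have ty : 0 <= t * y by rewrite mulr_ge0 // ltW.
have tty : 0 <= t * (t * y) by rewrite mulr_ge0 // ltW.
have tX0 : 0 < t * X by rewrite mulr_gt0.
have -> : y * ((1 - t) * (2 - t)) = 2 * y - 3 * (t * y) + t * (t * y) by ring.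
have e1 : 6 * (t * y) + t * X + t = X by rewrite -[RHS]tX; ring.
have XE : X = 2 * y - c by [].
by move: (t * y) (t * X) (t * (t * y)) ty tty tX0 e1 => p r w ? ? ? ? ?; lra.
Qed.

Let pinch_ge (y c : R) : 0 <= y ->
  (forall t, 0 < t -> t < 1 -> c <= y * ((1 + t) * (2 + t))) -> c <= 2 * y.
Proof.
move=> y0 h; apply: contrapT => /negP; rewrite -ltNge => lt.
pose X := c - 2 * y; have X0 : 0 < X by rewrite /X; lra.
have k0 : 0 < 8 * y + X + 1 by lra.
pose t := X / (8 * y + X + 1).
have t0 : 0 < t by rewrite divr_gt0.
have t1 : t < 1 by rewrite ltr_pdivrMr // mul1r; lra.
have tX : t * (8 * y + X + 1) = X by rewrite divfK // gt_eqF.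
have := h _ t0 t1.
have ty : 0 <= t * y by rewrite mulr_ge0 // ltW.
have tty : t * (t * y) <= t * y by rewrite ler_piMl // ltW.
have tX0 : 0 < t * X by rewrite mulr_gt0.
have -> : y * ((1 + t) * (2 + t)) = 2 * y + 3 * (t * y) + t * (t * y) by ring.
have e1 : 8 * (t * y) + t * X + t = X by rewrite -[RHS]tX; ring.
have XE : X = c - 2 * y by [].
by move: (t * y) (t * X) (t * (t * y)) ty tty tX0 e1 => p r w ? ? ? ? ?; lra.
Qed.

(** The second moment is minus the derivative of the Gaussian integral
    [c / v] in [v^2]. Since [exp] lies above its tangents, it is pinched between
    the difference quotients on both sides of [v]. *)
Let second_moment_e v : 0 < v -> exists2 c : R, 0 < c &
  (\int[leb]_x (e v x)%:E = (c / v)%:E)%E /\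
  (\int[leb]_x (x ^+ 2 * e v x)%:E = (c / (2 * v ^+ 3))%:E)%E.
Proof.
move=> v0; have [c c0 cE] := integral_e; exists c => //; split; first exact: cE.
have mE u : measurable_fun setT (fun x => (e u x)%:E : \bar R) by apply/measurable_EFinP.
have msE u : measurable_fun setT (fun x => (x ^+ 2 * e u x)%:E : \bar R).
  by apply/measurable_EFinP.
set M := (\int[leb]_x (x ^+ 2 * e v x)%:E)%E.
have M0 : (0 <= M)%E by apply: integral_ge0 => x _; rewrite lee_fin.
have hM h : 0 <= h -> (\int[leb]_x (h%:E * (x ^+ 2 * e v x)%:E) = h%:E * M)%E.
  move=> h0; rewrite ge0_integralZl_EFin //; last exact: msE.
  by move=> x _; rewrite lee_fin; exact: se_ge0.
have mhse h : measurable_fun setT (fun x => h%:E * (x ^+ 2 * e v x)%:E : \bar R)%E.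
  by apply: emeasurable_funM; [exact: measurable_cst|exact: msE].
have hse_ge0 h x : 0 <= h -> (0 <= h%:E * (x ^+ 2 * e v x)%:E)%E.
  by move=> h0; rewrite -EFinM lee_fin mulr_ge0.
have eE_ge0 u x : (0 <= (e u x)%:E)%E by rewrite lee_fin.
have upper u : 0 < u -> u < v -> ((v ^+ 2 - u ^+ 2)%:E * M + (c / v)%:E <= (c / u)%:E)%E.
  move=> u0 uv; have h0 : 0 <= v ^+ 2 - u ^+ 2 by nra.
  rewrite -!cE // -hM // -ge0_integralD //.
  - apply: ge0_le_integral => //.
    + by move=> x _; apply: adde_ge0; [exact: hse_ge0|exact: eE_ge0].
    + by apply: emeasurable_funD; [exact: mhse|exact: mE].
    + exact: mE.
    + move=> x _; rewrite -EFinM -EFinD lee_fin.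
      have := expR_ge1Dx ((v ^+ 2 - u ^+ 2) * x ^+ 2).
      have -> : e u x = e v x * expR ((v ^+ 2 - u ^+ 2) * x ^+ 2).
        by rewrite /e -expRD; congr expR; ring.
      by have := e_ge0 v x; move: (e v x) (expR _) => a b; nra.
  - by move=> x _; exact: hse_ge0.
  - exact: mhse.
  - exact: mE.
have lower u : v < u -> ((c / v)%:E <= (c / u)%:E + (u ^+ 2 - v ^+ 2)%:E * M)%E.
  move=> uv; have u0 : 0 < u by lra.
  have h0 : 0 <= u ^+ 2 - v ^+ 2 by nra.
  rewrite -!cE // -hM // -ge0_integralD //.
  - apply: ge0_le_integral => //.
    + exact: mE.
    + by apply: emeasurable_funD; [exact: mE|exact: mhse].
    + move=> x _; rewrite -EFinM -EFinD lee_fin.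
      have := expR_ge1Dx (- ((u ^+ 2 - v ^+ 2) * x ^+ 2)).
      have -> : e u x = e v x * expR (- ((u ^+ 2 - v ^+ 2) * x ^+ 2)).
        by rewrite /e -expRD; congr expR; ring.
      by have := e_ge0 v x; move: (e v x) (expR _) => a b; nra.
  - exact: mE.
  - by move=> x _; exact: hse_ge0.
  - exact: mhse.
have Mfin : M \is a fin_num.
  have h1 : 0 < v / 2 by lra. have h2 : v / 2 < v by lra.
  have := upper _ h1 h2; case: M M0 {hM upper lower} => [r|//|//] _ //.
  rewrite gt0_muley ?lte_fin; last by nra.
  by rewrite addye // leye_eq.
have m0 : 0 <= fine M by rewrite fine_ge0.
rewrite -(fineK Mfin) in upper lower *; move: (fine M) m0 upper lower => m m0 upper lower.
congr (_%:E).
have v3 : 0 < v ^+ 3 by rewrite exprn_gt0.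
have mv : 0 <= m * v ^+ 3 by rewrite mulr_ge0 // ltW.
suff -> : c = 2 * (m * v ^+ 3) by field; rewrite gt_eqF.
apply/eqP; rewrite eq_le; apply/andP; split.
- apply: pinch_ge => // t t0 t1.
  have uv : v < v * (1 + t) by nra.
  have u0 : 0 < v * (1 + t) by lra.
  have := lower _ uv; rewrite -EFinM -EFinD lee_fin => h.
  have h2 : c / v - c / (v * (1 + t)) <= ((v * (1 + t)) ^+ 2 - v ^+ 2) * m by lra.
  have k0 : 0 < t / (v * (1 + t)) by rewrite divr_gt0.
  rewrite -(ler_pM2r k0).
  move: h2; rewrite (_ : c / v - c / (v * (1 + t)) = c * (t / (v * (1 + t)))); last first.
    by field; rewrite !gt_eqF //; lra.
  move=> h2; apply: (le_trans h2); rewrite le_eqVlt; apply/orP; left; apply/eqP.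
  by field; rewrite !gt_eqF //; lra.
- apply: pinch_le => // t t0 t1.
  have uv : v * (1 - t) < v by nra.
  have u0 : 0 < v * (1 - t) by rewrite mulr_gt0 //; lra.
  have := upper _ u0 uv; rewrite -EFinM -EFinD lee_fin => h.
  have h2 : (v ^+ 2 - (v * (1 - t)) ^+ 2) * m <= c / (v * (1 - t)) - c / v by lra.
  have k0 : 0 < t / (v * (1 - t)) by rewrite divr_gt0.
  rewrite -(ler_pM2r k0).
  move: h2; rewrite (_ : c / (v * (1 - t)) - c / v = c * (t / (v * (1 - t)))); last first.
    by field; rewrite !gt_eqF //; lra.
  move=> h2; apply: le_trans h2; rewrite le_eqVlt; apply/orP; left; apply/eqP.
  by field; rewrite !gt_eqF //; lra.
Qed.

Lemma normal_second_moment s : 0 < s ->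
  (\int[normal_prob 0 s]_x (x ^+ 2)%:E = (s ^+ 2)%:E)%E.
Proof.
move=> s0; pose v := Num.sqrt (2 * s ^+ 2)^-1.
have ss : 0 < 2 * s ^+ 2 by rewrite mulr_gt0 // exprn_gt0.
have v0 : 0 < v by rewrite sqrtr_gt0 invr_gt0.
have v2 : v ^+ 2 = (2 * s ^+ 2)^-1 by rewrite sqr_sqrtr // invr_ge0 ltW.
have p0 : 0 < normal_peak s by rewrite normal_peak_gt0 // gt_eqF.
have pdfE x : normal_pdf 0 s x = normal_peak s * e v x.
  rewrite normal_pdf0E; last by rewrite gt_eqF.
  by rewrite /e v2; congr (_ * expR (- _)); rewrite mulrC.
have [c c0 [cE mE]] := second_moment_e v0.
have pc : normal_peak s * (c / v) = 1.
  have := integral_normal_pdf 0 s; under eq_integral do rewrite pdfE EFinM.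
  rewrite ge0_integralZl_EFin; first by rewrite cE -EFinM; case.
  - exact: measurableT.
  - by move=> x _; rewrite lee_fin; exact: e_ge0.
  - by apply/measurable_EFinP; exact: me.
  - exact: ltW.
have msq : measurable_fun setT (fun x : measurableTypeR R => (x ^+ 2)%:E : \bar R).
  by apply/measurable_EFinP; exact: measurable_funX.
have sq0 (x : measurableTypeR R) : (0 <= (x ^+ 2)%:E)%E by rewrite lee_fin sqr_ge0.
rewrite [LHS](normal_prob_has_density 0 s msq sq0).
have e1 x : ((normal_pdf 0 s x)%:E * (x ^+ 2)%:E)%E =
    ((normal_peak s)%:E * (x ^+ 2 * e v x)%:E)%E.
  by rewrite pdfE -!EFinM; congr (_%:E); ring.
under eq_integral do rewrite e1.
rewrite ge0_integralZl_EFin; last 4 first.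
- exact: measurableT.
- by move=> x _; rewrite lee_fin; exact: se_ge0.
- by apply/measurable_EFinP; exact: mse.
- exact: ltW.
rewrite mE -EFinM; congr (_%:E).
have -> : normal_peak s * (c / (2 * v ^+ 3)) = normal_peak s * (c / v) * (2 * v ^+ 2)^-1.
  by field; rewrite gt_eqF.
rewrite pc v2; by field; rewrite gt_eqF.
Qed.
End normal_moments.

Section image_law.
Context d d' (T : measurableType d) (T' : measurableType d') (R : realType).
Variables (P : probability T R) (f : T -> T') (mf : measurable_fun setT f).

Let mfun_f : {mfun T >-> T'} := HB.pack f (isMeasurableFun.Build _ _ _ _ _ mf).

(** [distribution] for a map given with a proof of measurability. *)
Definition image_law : probability T' R := distribution P mfun_f.

Lemma image_lawE A : image_law A = P (f @^-1` A).
Proof. by []. Qed.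

Lemma ge0_integral_image_law (G : T' -> \bar R) : measurable_fun setT G ->
  (forall y, 0 <= G y)%E -> (\int[image_law]_y G y = \int[P]_x G (f x))%E.
Proof. by move=> mG G0; rewrite (ge0_integral_distribution mfun_f). Qed.

Lemma integral_image_law (G : T' -> \bar R) : measurable_fun setT G ->
  P.-integrable setT (fun x => G (f x)) ->
  (\int[image_law]_y G y = \int[P]_x G (f x))%E.
Proof. by move=> mG iG; rewrite (@random_variable.integral_distribution _ _ _ _ _ P mfun_f). Qed.
End image_law.

Lemma helmert_varN (R : realType) (sg : nat -> R) d (b : nat -> R) :
  helmert_var sg d (fun i => - b i) = helmert_var sg d b.
Proof.
elim: d b => [|k IH] b //=; rewrite (IH (fun i => b i.+1)); congr (_ * _ + _).
by rewrite sumrN mulNr -opprD sqrrN.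
Qed.

Section helmert_moments.
Variables (R : realType) (a : R) (d : nat).
Hypothesis a0 : 0 < a.
Local Notation P := (normal_product (helmert_sd a) d).

Let l (b : nat -> R) (w : euclid R d) : R := \sum_(i < d.+1) b i * helmert w i.
Let v b := helmert_var (helmert_sd a) d b.

Let ml b : measurable_fun setT (l b : euclid R d -> measurableTypeR R).
Proof. exact: measurable_helmert_combination. Qed.

Let ml2 b : measurable_fun setT (fun w => (l b w ^+ 2)%:E : \bar R).
Proof.
apply/measurable_EFinP; apply: measurable_funX.
exact: measurable_helmert_combination.
Qed.

Let law b : probability (measurableTypeR R) R :=
  @image_law _ _ _ (measurableTypeR R) R P (l b) (ml b).

Let lawE b (A : set R) : measurable A -> law b A = gaussian_law 0 (Num.sqrt (v b)) A.
Proof.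
move=> mA; rewrite -helmert_combination_law //; last by move=> i; exact: helmert_sd_gt0.
rewrite /law image_lawE; congr (P _); apply/seteqP.
by split => w /=; rewrite add0r.
Qed.

Lemma integral_sqr_helmert_combination b :
  (\int[P]_w (l b w ^+ 2)%:E = (v b)%:E)%E.
Proof.
have msq : measurable_fun setT (fun x : measurableTypeR R => (x ^+ 2)%:E : \bar R).
  by apply/measurable_EFinP; exact: measurable_funX.
have sq0 (x : measurableTypeR R) : (0 <= (x ^+ 2)%:E)%E by rewrite lee_fin sqr_ge0.
have v0 : 0 <= v b := helmert_var_ge0 _ _ _.
rewrite -[LHS](@ge0_integral_image_law _ _ _ (measurableTypeR R) R P (l b) (ml b) _ msq sq0) -/(law b).
have [s0|s0] := eqVneq (Num.sqrt (v b)) 0.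
  pose m2 : {measure set (measurableTypeR R) -> \bar R} :=
    @dirac _ (measurableTypeR R) 0 R.
  transitivity (\int[m2]_x (x ^+ 2)%:E)%E.
    apply: eq_measure_integral => A mA _.
    by rewrite [LHS]lawE // s0 /gaussian_law eqxx.
  rewrite integral_dirac // expr0n /= diracT mul1e.
  by rewrite -[v b]sqr_sqrtr // s0 expr0n.
have s_gt0 : 0 < Num.sqrt (v b) by rewrite lt_neqAle eq_sym s0 sqrtr_ge0.
pose m2 : {measure set (measurableTypeR R) -> \bar R} :=
  normal_prob 0 (Num.sqrt (v b)).
transitivity (\int[m2]_x (x ^+ 2)%:E)%E.
  apply: eq_measure_integral => A mA _.
  by rewrite [LHS]lawE // /gaussian_law (negbTE s0).
by rewrite normal_second_moment // sqr_sqrtr.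
Qed.

Lemma integrable_sqr_helmert_combination b :
  P.-integrable setT (fun w => (l b w ^+ 2)%:E).
Proof.
apply/integrableP; split; first exact: ml2.
under eq_integral do rewrite gee0_abs ?lee_fin ?sqr_ge0 //.
by rewrite integral_sqr_helmert_combination ltry.
Qed.

Lemma integrable_helmert_combination b : P.-integrable setT (fun w => (l b w)%:E).
Proof.
have ml' : measurable_fun setT (fun w => (l b w)%:E : \bar R).
  by apply/measurable_EFinP; exact: measurable_helmert_combination.
apply: (le_integrable measurableT ml' _
  (g := fun w => (1%:E + (l b w ^+ 2)%:E)%E)).
  move=> w _; rewrite -EFinD /= lee_fin.
  have h := sqr_ge0 (l b w); rewrite [leRHS]ger0_norm; last by lra.
  by rewrite ler_norml; apply/andP; split; nra.
apply: integrableD => //; last exact: integrable_sqr_helmert_combination.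
exact: finite_measure_integrable_cst.
Qed.

(** The law of the functional is symmetric. *)
Lemma integral_helmert_combination b : (\int[P]_w (l b w)%:E = 0)%E.
Proof.
have lN w : l (fun i => - b i) w = - l b w.
  by rewrite /l -sumrN; apply: eq_bigr => i _; rewrite mulNr.
have vN : v (fun i => - b i) = v b.
  exact: helmert_varN.
have mid : measurable_fun setT (fun x : measurableTypeR R => x%:E : \bar R).
  by apply/measurable_EFinP.
have e c : (\int[P]_w (l c w)%:E = \int[law c]_x x%:E)%E.
  by rewrite [RHS](@integral_image_law _ _ _ (measurableTypeR R) R P (l c) (ml c) _ mid) //; exact: integrable_helmert_combination.
have lawN (A : set (measurableTypeR R)) : measurable A ->
    law b A = law (fun i => - b i) A.
  move=> mA; transitivity (gaussian_law 0 (Num.sqrt (v b)) A); first exact: lawE.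
  by rewrite -vN; apply/esym; exact: lawE.
have h : (\int[P]_w (l b w)%:E = (-1)%:E * \int[P]_w (l b w)%:E)%E.
  rewrite {1}e; transitivity (\int[law (fun i => (- b i)%R)]_x x%:E)%E.
    by apply: eq_measure_integral => A mA _; exact: lawN.
  rewrite -e -integralZl //; last exact: integrable_helmert_combination.
  by apply: eq_integral => w _; rewrite lN -EFinM mulN1r.
move: h; have := integrable_fin_num measurableT (integrable_helmert_combination b).
case: (\int[P]_w _)%E => // r _; rewrite -EFinM mulN1r => -[h].
by congr (_%:E); lra.
Qed.

Let unit_vec i : nat -> R := fun j => (j == i)%:R.

Let l_unit w i : (i <= d)%N -> l (unit_vec i) w = helmert w i.
Proof.
rewrite -ltnS => id; rewrite /l (bigD1 (Ordinal id)) //= /unit_vec eqxx mul1r.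
rewrite big1 ?addr0 // => j; rewrite -val_eqE /= => /negPf ->.
by rewrite mul0r.
Qed.

Lemma integrable_helmert i : (i <= d)%N -> P.-integrable setT (fun w => (helmert w i)%:E).
Proof.
move=> id; have := integrable_helmert_combination (unit_vec i).
by under eq_fun do rewrite l_unit //.
Qed.

Lemma integral_helmert i : (i <= d)%N -> (\int[P]_w (helmert w i)%:E = 0)%E.
Proof.
move=> id; rewrite -(integral_helmert_combination (unit_vec i)).
by apply: eq_integral => w _; rewrite l_unit.
Qed.

Lemma integrable_helmert_mul i j : (i <= d)%N -> (j <= d)%N ->
  P.-integrable setT (fun w => (helmert w i * helmert w j)%:E).
Proof.
move=> id jd.
have mij : measurable_fun setT (fun w : euclid R d => (helmert w i * helmert w j)%:E : \bar R).
  by apply/measurable_EFinP; apply: measurable_funM; exact: measurable_helmert.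
apply: (le_integrable measurableT mij _
  (g := fun w => ((l (unit_vec i) w ^+ 2)%:E + (l (unit_vec j) w ^+ 2)%:E)%E)).
  move=> w _; rewrite -EFinD /= lee_fin !l_unit //.
  have h1 := sqr_ge0 (helmert w i - helmert w j); have h2 := sqr_ge0 (helmert w i + helmert w j).
  rewrite [leRHS]ger0_norm; last by rewrite addr_ge0 ?sqr_ge0.
  by rewrite ler_norml; apply/andP; split; nra.
by apply: integrableD => //; exact: integrable_sqr_helmert_combination.
Qed.

(** Polarisation of the variances. *)
Lemma integral_helmert_mul i j : (i <= d)%N -> (j <= d)%N ->
  (\int[P]_w (helmert w i * helmert w j)%:E =
   (((i == j)%:R - d.+1%:R^-1) / a)%:E)%E.
Proof.
move=> id jd.
pose s := fun k => unit_vec i k + unit_vec j k.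
have ls w : l s w = helmert w i + helmert w j.
  rewrite -!l_unit // /l -big_split; apply: eq_bigr => k _.
  by rewrite mulrDl.
have e w : helmert w i * helmert w j = 2^-1 * (l s w ^+ 2 - l (unit_vec i) w ^+ 2
    - l (unit_vec j) w ^+ 2).
  by rewrite ls !l_unit //; field.
have is2 := integrable_sqr_helmert_combination s.
have ii := integrable_sqr_helmert_combination (unit_vec i).
have ij := integrable_sqr_helmert_combination (unit_vec j).
under eq_integral do rewrite e EFinM !EFinB.
rewrite integralZl //; last by apply: integrableB => //; exact: integrableB.
rewrite integralB //; last exact: integrableB.
rewrite integralB // !integral_sqr_helmert_combination -!EFinB -EFinM; congr (_%:E).
rewrite /v !helmert_varE //.
have sum_unit k : (k <= d)%N -> \sum_(m < d.+1) unit_vec k m = 1.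
  rewrite -ltnS => kd; rewrite (bigD1 (Ordinal kd)) //= /unit_vec eqxx big1 ?addr0 //.
  by move=> m; rewrite -val_eqE /= => /negPf ->.
have sum_unit2 k : (k <= d)%N -> \sum_(m < d.+1) unit_vec k m ^+ 2 = 1.
  move=> kd; rewrite -[RHS](sum_unit k kd); apply: eq_bigr => m _.
  by rewrite /unit_vec; case: eqP; rewrite ?expr1n ?expr0n.
have sum_s : \sum_(m < d.+1) s m = 2 by rewrite big_split /= !sum_unit //; ring.
have sum_s2 : \sum_(m < d.+1) s m ^+ 2 = 2 + 2 * (i == j)%:R.
  have E (m : 'I_d.+1) : s m ^+ 2 = unit_vec i m ^+ 2 + unit_vec j m ^+ 2
     + 2 * (i == j)%:R * unit_vec i m.
    rewrite /s /unit_vec; have [->|mi] := eqVneq (m : nat) i.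
      by case: eqP => _ /=; ring.
    by case: eqP => _ /=; ring.
  by rewrite (eq_bigr _ (fun m _ => E m)) !big_split /= -mulr_sumr !sum_unit2 // sum_unit //; ring.
rewrite !sum_unit2 // !sum_unit // sum_s sum_s2.
have d1 : 0 < d.+1%:R :> R by [].
by field; rewrite !gt_eqF.
Qed.
End helmert_moments.

(** * Borel measurability in finite dimension *)

Section borel_maps.
Variables (R : realType) (q : nat).

Lemma open_prod_row_box (U : set (R * 'rV[R]_q)%type) z : open U -> U z ->
  exists2 e : R, 0 < e & forall t (v : 'rV[R]_q), `|t - z.1| < e ->
    (forall i, `|v 0 i - z.2 0 i| < e) -> U (t, v).
Proof.
move=> oU Uz; have /nbhs_ballP[e /= e0 eU] := open_nbhs_nbhs (conj oU Uz).
exists e => // t v ht hv; apply: eU; split => /=.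
  by rewrite /ball /= distrC.
split => // i j; rewrite /ball /= distrC (ord1 i); exact: hv.
Qed.

Context dd (E : measurableType dd).
Variables (T : E -> R) (V : E -> 'rV[R]_q).
Hypotheses (mT : measurable_fun setT T)
  (mV : forall i, measurable_fun setT (fun y => V y 0 i)).

(** An open set is a countable union of boxes with rational centres and radii
    [1 / (n + 1)], and preimages of boxes are controlled by the coordinates. *)
Lemma measurable_prod_row :
  measurable_fun setT ((fun y => (T y, V y)) : E -> borel (R * 'rV[R]_q)%type).
Proof.
apply: (@measurability _ _ E (borel (R * 'rV[R]_q)%type) setT _
  (@open (R * 'rV[R]_q)%type)) => //.
move=> _ [U oU <-]; rewrite setTI.
pose I := (rat * {ffun 'I_q -> rat} * nat)%type.
pose near_row (k : I) (t : R) (v : 'rV[R]_q) :=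
  `|t - ratr k.1.1| < k.2.+1%:R^-1 /\ forall i, `|v 0 i - ratr (k.1.2 i)| < k.2.+1%:R^-1.
pose inU k := forall t v, near_row k t v -> U (t, v).
pose F (k : I) : set E := if pselect (inU k) then [set y | near_row k (T y) (V y)] else set0.
have mF k : measurable (F k).
  rewrite /F; case: pselect => [hk|hk]; last exact: measurable0.
  have -> : [set y | near_row k (T y) (V y)] =
      (T @^-1` [set t | `|t - ratr k.1.1| < k.2.+1%:R^-1]) `&`
      \big[setI/setT]_(i < q) ((fun y => V y 0 i) @^-1`
         [set t | `|t - ratr (k.1.2 i)| < k.2.+1%:R^-1]).
    apply/seteqP; split => y /= -[h1 h2]; split => //.
      by apply: (big_ind (fun A : set E => A y)) => [//|A B hA hB|i _]; [by split|exact: h2].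
    by move=> i; move: h2; rewrite (bigD1 i) //= => -[].
  have mball c (e : R) : measurable [set t : R | `|t - c| < e].
    rewrite (_ : [set t | _] = [set` `]c - e, c + e[]); first exact: measurable_itv.
    by apply/seteqP; split => t /=; rewrite in_itv /= ltr_norml; lra.
  apply: measurableI; first by rewrite -[X in measurable X]setTI; exact: mT.
  apply: bigsetI_measurable => i _.
  by rewrite -[X in measurable X]setTI; exact: mV.
have -> : (fun y => (T y, V y)) @^-1` U = \bigcup_(k in [set: I]) F k.
  apply/seteqP; split => y.
  - move=> /= /(open_prod_row_box oU)[e e0 eU].
    have e2 : 0 < e / 2 by lra.
    have [n hn] : exists n, n.+1%:R^-1 < e / 2.
      exists (Num.truncn (e / 2)^-1).
      by rewrite invf_plt ?posrE // truncnS_gt.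
    set e1 : R := n.+1%:R^-1 in hn *.
    have e1_gt0 : 0 < e1 by rewrite /e1 invr_gt0.
    have near_rat (x : R) : exists r : rat, `|x - ratr r| < e1.
      have /rat_in_itvoo[r] : x < x + e1 by rewrite ltrDl.
      rewrite in_itv /= => /andP[h1 h2]; exists r.
      by rewrite ltr_norml; apply/andP; split; lra.
    have [r hr] := near_rat (T y).
    have [p hp] : exists p : {ffun 'I_q -> rat}, forall i, `|V y 0 i - ratr (p i)| < e1.
      have [p hp] := choice (fun i : 'I_q => near_rat (V y 0 i)).
      by exists [ffun i => p i] => i; rewrite ffunE.
    exists (r, p, n) => //; rewrite /F; case: pselect => [hk|[]]; first by split.
    move=> t v []; rewrite -[_.2.+1%:R^-1]/e1 /= => h1 h2; apply: eU => [|i] /=.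
      rewrite (_ : t - T y = (t - ratr r) - (T y - ratr r)); last by ring.
      by apply: le_lt_trans (ler_normB _ _) _; lra.
    have := h2 i; have := hp i => h3 h4.
    rewrite (_ : v 0 i - V y 0 i = (v 0 i - ratr (p i)) - (V y 0 i - ratr (p i))); last by ring.
    by apply: le_lt_trans (ler_normB _ _) _; lra.
  - by case=> k _; rewrite /F; case: pselect => // h /= hk; exact: h.
apply: countable_bigcupT_measurable => //; exact: countableP.
Qed.
End borel_maps.

Section borel_topology.
Variable R : realType.

Lemma continuous_borel_measurable (T1 T2 : ptopologicalType) (f : T1 -> T2) :
  continuous f -> measurable_fun setT (f : borel T1 -> borel T2).
Proof.
move=> cf; apply: (@measurability _ _ (borel T1) (borel T2) setT _ (@open T2)) => //.
move=> _ [U oU <-]; rewrite setTI; apply: sub_sigma_algebra.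
by apply: open_comp => // x _; exact: cf.
Qed.

Lemma continuous_borel_real (T1 : ptopologicalType) (f : T1 -> R) :
  continuous f -> measurable_fun setT (f : borel T1 -> measurableTypeR R).
Proof.
move=> cf; apply: (@measurability _ _ (borel T1) (measurableTypeR R) setT _ _ (RGenOInfty.measurableE R)) => //.
move=> _ [_ [x ->] <-]; rewrite setTI; apply: sub_sigma_algebra.
by apply: open_comp => [y _|]; [exact: cf|exact: interval_open].
Qed.

Lemma measurable_id_borel :
  measurable_fun setT (id : measurableTypeR R -> borel R).
Proof.
apply: (@measurability _ _ (measurableTypeR R) (borel R) setT _ (@open R)) => //.
by move=> _ [U oU <-]; rewrite setTI; exact: open_measurable.
Qed.
End borel_topology.

(** * The limit law *)

Section limit_law_of_V.
Variables (R : realType) (d : nat).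

(** Twice the coefficient of [|v|^2] in the limit of [n * excess]. For [d = 0] the
    vector [v] is zero, and any positive number represents the point mass. *)
Definition gaussian_rate : R :=
  if d == 0%N then 1 else 2 * d.+1%:R * d%:R / d.+2%:R.

Lemma gaussian_rate_gt0 : 0 < gaussian_rate.
Proof.
rewrite /gaussian_rate; case: eqVneq => // d0.
by rewrite divr_gt0 // !mulr_gt0 // ltr0n lt0n.
Qed.

(** Vectors orthogonal to [u] in the hyperplane are those with first entry 0 and
    zero sum. *)
Definition vrow (w : euclid R d) : 'rV[R]_d.+2 :=
  \row_i (if i == 0%N :> nat then 0 else helmert w i.-1).

Lemma measurable_vrow_coord i : measurable_fun setT (fun w => vrow w 0 i : measurableTypeR R).
Proof.
under eq_fun do rewrite mxE.
by case: eqP => _; [exact: measurable_cst|exact: measurable_helmert].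
Qed.

Lemma measurable_vrow : measurable_fun setT (vrow : _ -> borel 'rV[R]_d.+2).
Proof.
have h := @measurable_prod_row R d.+2 _ (euclid R d) (fun=> 0) vrow
  (measurable_cst _) measurable_vrow_coord.
have s : measurable_fun setT (snd : borel (R * 'rV[R]_d.+2)%type -> borel 'rV[R]_d.+2).
  by apply: continuous_borel_measurable; by move=> [x y]; exact: cvg_snd.
exact: measurableT_comp s h.
Qed.

Definition tvrow (z : euclid R d.+1) : (R * 'rV[R]_d.+2)%type := (z.1, vrow z.2).

Lemma measurable_tvrow :
  measurable_fun setT (tvrow : _ -> borel (R * 'rV[R]_d.+2)%type).
Proof.
apply: measurable_prod_row => [|i]; first exact: measurable_fst.
exact: measurableT_comp (measurable_vrow_coord i) (@measurable_snd _ _ (measurableTypeR R) _).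
Qed.

Lemma dot_vrow (x : 'rV[R]_d.+2) w :
  dot x (vrow w) = \sum_(i < d.+1) x 0 (lift ord0 i) * helmert w i.
Proof.
rewrite /dot big_ord_recl mxE /= mulr0 add0r.
by apply: eq_bigr => i _; rewrite mxE /=.
Qed.

Definition transverse_law : probability (euclid R d) R := normal_product (helmert_sd gaussian_rate) d.

Definition V_law : probability (borel 'rV[R]_d.+2) R := image_law transverse_law measurable_vrow.

Lemma V_law_gaussian_vector : gaussian_vector V_law.
Proof.
move=> x; pose b i : R := x 0 (inord i.+1).
exists 0, (Num.sqrt (helmert_var (helmert_sd gaussian_rate) d b)).
split; first exact: sqrtr_ge0.
move=> A mA; rewrite -helmert_combination_law //; last first.
  by move=> i; apply: helmert_sd_gt0; exact: gaussian_rate_gt0.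
rewrite /V_law image_lawE; congr (transverse_law _); apply/seteqP.
have e w : dot x (vrow w) = 0 + \sum_(i < d.+1) b i * helmert w i.
  rewrite dot_vrow add0r; apply: eq_bigr => i _; congr (x 0 _ * _).
  by apply: val_inj; rewrite /= inordK // ltnS.
by split => w /=; rewrite e.
Qed.

Let V_law_integral (f : 'rV[R]_d.+2 -> R) :
  measurable_fun setT (f : borel 'rV[R]_d.+2 -> measurableTypeR R) ->
  transverse_law.-integrable setT (fun w => (f (vrow w))%:E) ->
  (\int[V_law]_v (f v)%:E = \int[transverse_law]_w (f (vrow w))%:E)%E.
Proof.
move=> mf fi.
rewrite [LHS](@integral_image_law _ _ _ (borel 'rV[R]_d.+2) R transverse_law vrow
  measurable_vrow (fun v => (f v)%:E)) //.
exact/measurable_EFinP.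
Qed.

Let mcoord i : measurable_fun setT ((fun v => v 0 i) : borel 'rV[R]_d.+2 -> measurableTypeR R).
Proof. by apply: continuous_borel_real; exact: coord_continuous. Qed.

Let helmert_pred_le (i : 'I_d.+2) : (i.-1 <= d)%N.
Proof. by case: i => -[|i] /=. Qed.

Lemma V_law_expectation i : ('E_V_law[fun v : 'rV[R]_d.+2 => v 0%R i] = 0)%E.
Proof.
rewrite unlock V_law_integral; [|exact: mcoord|].
- under eq_integral do rewrite mxE.
  case: (i == 0%N :> nat); first exact: integral0.
  apply: integral_helmert => //; exact: gaussian_rate_gt0.
- under eq_fun do rewrite mxE.
  case: (i == 0%N :> nat); first exact: integrable0.
  apply: integrable_helmert => //; exact: gaussian_rate_gt0.
Qed.

Lemma V_law_covariance i j : covariance V_law (fun x : 'rV[R]_d.+2 => x 0 i)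
   (fun x : 'rV[R]_d.+2 => x 0 j) = (V_covariance i j)%:E.
Proof.
rewrite unlock !V_law_expectation unlock.
have e : ((fun x : 'rV[R]_d.+2 => x 0 i) \- cst (fine 0)) *
    ((fun x : 'rV[R]_d.+2 => x 0 j) \- cst (fine 0)) = (fun x => x 0 i * x 0 j).
  by apply/funext => x; rewrite [LHS]/(_ * _) /= !subr0.
rewrite e.
have vE : (fun w => vrow w 0 i * vrow w 0 j) =
    (fun w => if (i == 0%N :> nat) || (j == 0%N :> nat) then 0
              else helmert w i.-1 * helmert w j.-1).
  apply/funext => w; rewrite !mxE.
  by case: (i == 0%N :> nat); rewrite ?mul0r //=; case: (j == 0%N :> nat); rewrite ?mulr0.
have vEF : (fun w => (vrow w 0 i * vrow w 0 j)%:E) =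
    (fun w => (if (i == 0%N :> nat) || (j == 0%N :> nat) then 0
              else helmert w i.-1 * helmert w j.-1)%:E).
  by apply/funext => w; congr (_%:E); exact: (congr1 (fun f => f w) vE).
have a0 := gaussian_rate_gt0.
rewrite V_law_integral; last 2 first.
- by apply: measurable_funM; exact: mcoord.
- rewrite vEF; case: ((i == 0%N :> nat) || _); first exact: integrable0.
  exact: integrable_helmert_mul.
rewrite vEF /V_covariance.
case: (boolP ((i == 0%N :> nat) || _)) => [ij|].
  rewrite integral0; congr (_%:E); case: eqP => _; first by rewrite mxE.
  by rewrite !mxE ij mulr0.
rewrite negb_or => /andP[i0 j0].
rewrite /transverse_law integral_helmert_mul //; congr (_%:E).
have -> : (i.-1 == j.-1)%N = (i == j).
  by rewrite -val_eqE /=; apply/eqP/eqP => h; lia.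
move: a0; rewrite /gaussian_rate eqSS eqSS.
case: eqVneq => [d0|d0] a0.
  have -> : i == j.
    rewrite -val_eqE /=; move: (ltn_ord i) (ltn_ord j) i0 j0 d0 => /=.
    by move: (i : nat) (j : nat) => k l h1 h2 h3 h4 h5; apply/eqP; lia.
  by rewrite mxE d0 invr1 subrr mul0r.
rewrite !mxE (negbTE i0) (negbTE j0) /=.
have [h0 h1 h2] : [/\ 0 < d%:R :> R, d.+1%:R = d%:R + 1 :> R & d.+2%:R = d%:R + 2 :> R].
  by split; [rewrite ltr0n lt0n|rewrite natr1|rewrite -natrD addn2].
rewrite h1 h2; move: (d%:R) h0 => x x0.
have [y0 z0 z0'] : [/\ x != 0, x + 1 != 0 & x + 2 - 1 != 0] by split; apply/lt0r_neq0; lra.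
have z1 : x + 2 != 0 by apply/lt0r_neq0; lra.
have z2 : x + 2 - 2 != 0 by apply/lt0r_neq0; lra.
by case: (i == j) => /=; field; rewrite ?y0 ?z0 ?z0' ?z1 ?z2.
Qed.
End limit_law_of_V.

(** Up to a factor the matrix is [D - J] on the last [D] coordinates, [J] having
    all its entries equal to 1. Its rows are the vectors of zero sum there,
    which are spanned by the rows [e_k - e_D] of [B], and it multiplies each row
    of [B] by [D]. *)
Lemma rank_V_covariance (R : realType) d : \rank (@V_covariance R d.+2) = d.
Proof.
rewrite /V_covariance eqSS eqSS; case: eqVneq => [->|d0]; first exact: mxrank0.
have d1 : 0 < d%:R :> R by rewrite ltr0n lt0n.
have [h1 h2] : d.+1%:R = d%:R + 1 :> R /\ d.+2%:R = d%:R + 2 :> R.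
  by split; [rewrite natr1|rewrite -natrD addn2].
rewrite mxrank_scale_nz; last first.
  by rewrite h2; apply: mulf_neq0; rewrite ?invr_eq0 ?mulf_neq0 ?expf_neq0 //; apply/lt0r_neq0; lra.
set M := (\matrix_(i, j) _)%R.
pose B : 'M[R]_(d, d.+2) := \matrix_(k, j) ((j == k.+1 :> nat)%:R - (j == ord_max)%:R).
pose C : 'M[R]_(d.+2, d) := \matrix_(i, k) M i (inord k.+1).
pose S : 'M[R]_(d.+2, d) := \matrix_(i, k) (i == k.+1 :> nat)%:R.
have kd (k : 'I_d) : (k.+1 < d.+2)%N by have := ltn_ord k; lia.
have ME (i j : 'I_d.+2) : M i j = (i != 0%N :> nat)%:R * (j != 0%N :> nat)%:R * (d.+1%:R * (i == j)%:R - 1).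
  rewrite mxE h1 h2; case: (i == 0%N :> nat); case: (j == 0%N :> nat) => /=; rewrite ?mul0r ?mul1r ?mul0r //.
  by case: (i == j) => /=; ring.
have BM : B *m M = d.+1%:R *: B.
  apply/matrixP => k j; rewrite mxE [in RHS]mxE [B k j]mxE.
  under eq_bigr => i _ do rewrite mxE.
  rewrite (eq_bigr (fun i : 'I_d.+2 => (i == Ordinal (kd k))%:R * M i j - (i == ord_max)%:R * M i j)); last first.
    by move=> i _; rewrite mulrBl.
  have pick (i0 : 'I_d.+2) : \sum_i (i == i0)%:R * M i j = M i0 j.
    rewrite (bigD1 i0) //= eqxx mul1r big1 ?addr0 // => i /negPf ->.
    by rewrite mul0r.
  rewrite sumrB !pick !ME /= !mul1r -!val_eqE /=.
  rewrite [(k.+1 == _)%N]eq_sym [(d.+1 == _)%N]eq_sym.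
  have [j0|j0] := eqVneq (j : nat) 0%N; first by rewrite j0 /=; ring.
  by rewrite /=; ring.
have BS : B *m S = 1%:M.
  apply/matrixP => k l; rewrite !mxE.
  rewrite (bigD1 (Ordinal (kd l))) //= big1 ?addr0 => [|i].
    rewrite !mxE /= eqxx mulr1 -!val_eqE /= eqSS [(l == k :> nat)]eq_sym.
    have /negPf -> : (l.+1 != d.+1)%N by have := ltn_ord l; lia.
    by rewrite subr0.
  by rewrite -val_eqE !mxE /= => /negPf ->; rewrite mulr0.
apply/eqP; rewrite eqn_leq; apply/andP; split; last first.
  have {1}-> : d = \rank (B *m S) by rewrite BS mxrank1.
  rewrite -(mxrank_scale_nz (a := d.+1%:R)) ?pnatr_eq0 // scalemxAl -BM.
  apply: leq_trans (mxrankM_maxl _ _) _; exact: mxrankM_maxr.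
have -> : M = C *m B.
  have sumM i : \sum_j M i j = 0.
    rewrite (eq_bigr _ (fun j _ => ME i j)) big_ord_recl /= mulr0 mul0r add0r.
    case: i => -[|i] hi /=; first by apply: big1 => j _; rewrite !mul0r.
    pose i1 : 'I_d.+1 := Ordinal (hi : (i < d.+1)%N).
    rewrite (eq_bigr (fun j : 'I_d.+1 => d.+1%:R * (j == i1)%:R - 1)); last first.
      move=> j _; rewrite !mul1r; congr (_ * _%:R - _).
      by rewrite -!val_eqE /= /bump /= add1n eqSS eq_sym.
    rewrite sumrB sumr_const card_ord -mulr_sumr (bigD1 i1) //= eqxx.
    rewrite big1 ?addr0 ?mulr1 ?subrr // => j /negPf ->. by [].
  apply/matrixP => i j; rewrite [in RHS]mxE.
  transitivity (\sum_(k < d.+2) M i k * ((j == k)%:R - (j == ord_max)%:R)).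
    under eq_bigr do rewrite mulrBr.
    rewrite sumrB -mulr_suml sumM mul0r subr0 (bigD1 j) //= eqxx mulr1.
    by rewrite big1 ?addr0 // => k; rewrite eq_sym => /negPf ->; rewrite mulr0.
  rewrite [LHS]big_ord_recr [X in _ + X = _]/= subrr mulr0 addr0 big_ord_recl.
  rewrite [M i _]ME /= mulr0 !mul0r add0r; apply: eq_bigr => k _; rewrite [C i k]mxE [B k j]mxE.
  congr (M i _ * (_%:R - _)); apply: val_inj; rewrite /= inordK //.
exact: mulmx_max_rank.
Qed.

(** * Marginals and the product form of the limit *)

Section marginals.
Variable R : realType.

Lemma bounded_integrable dd (T : measurableType dd) (P : probability T R) (f : T -> R) :
  measurable_fun setT (f : T -> measurableTypeR R) -> (exists M, forall x, `|f x| <= M) ->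
  P.-integrable setT (EFin \o f).
Proof.
move=> mf [M fM].
apply: (le_integrable measurableT _ _ (g := fun=> M%:E)).
- exact/measurable_EFinP.
- by move=> x _ /=; rewrite lee_fin; exact: le_trans (fM x) (ler_norm _).
- exact: finite_measure_integrable_cst.
Qed.

Lemma Rintegral_image_law d1 (T1 : measurableType d1) (T2 : ptopologicalType)
    (P : probability T1 R) (f : T1 -> T2)
    (mf : measurable_fun setT (f : T1 -> borel T2)) (g : T2 -> R) :
  continuous g -> (exists M, forall x, `|g x| <= M) ->
  \int[image_law P mf]_x g x = \int[P]_x g (f x).
Proof.
move=> cg gM; rewrite /Rintegral; congr fine.
have mg := continuous_borel_real cg.
rewrite [LHS](@integral_image_law _ _ _ (borel T2) R P f mf (fun v => (g v)%:E)) //.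
  exact/measurable_EFinP.
apply: (@bounded_integrable _ _ P (g \o f)); last by case: gM => M h; exists M => x /=.
exact: measurableT_comp mg mf.
Qed.

Lemma eq_law_Rintegral (T : ptopologicalType) (P Q : probability (borel T) R) (g : T -> R) :
  (forall A, measurable A -> P A = Q A) -> \int[P]_x g x = \int[Q]_x g x.
Proof.
by move=> PQ; congr fine; apply: eq_measure_integral => A mA _; exact: PQ.
Qed.

Variables (T1 T2 : ptopologicalType) (L : probability (borel (T1 * T2)%type) R)
  (L1 : probability (borel T1) R) (L2 : probability (borel T2) R).
Hypothesis LE : product_law L L1 L2.

Let mfst : measurable_fun setT (fst : borel (T1 * T2)%type -> borel T1).
Proof. by apply: continuous_borel_measurable; move=> [x y]; exact: cvg_fst. Qed.

Let msnd : measurable_fun setT (snd : borel (T1 * T2)%type -> borel T2).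
Proof. by apply: continuous_borel_measurable; move=> [x y]; exact: cvg_snd. Qed.

Lemma product_law_fst (g : T1 -> R) : continuous g -> (exists M, forall x, `|g x| <= M) ->
  \int[L]_x g x.1 = \int[L1]_x g x.
Proof.
move=> cg gM; rewrite -(Rintegral_image_law L mfst cg gM).
apply: eq_law_Rintegral => A mA; rewrite image_lawE.
rewrite (_ : fst @^-1` A = A `*` setT); last by apply/seteqP; split => x //= -[].
by rewrite LE // probability_setT mule1.
Qed.

Lemma product_law_snd (g : T2 -> R) : continuous g -> (exists M, forall x, `|g x| <= M) ->
  \int[L]_x g x.2 = \int[L2]_x g x.
Proof.
move=> cg gM; rewrite -(Rintegral_image_law L msnd cg gM).
apply: eq_law_Rintegral => A mA; rewrite image_lawE.
rewrite (_ : snd @^-1` A = setT `*` A); last by apply/seteqP; split => x //= -[].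
by rewrite LE // probability_setT mul1e.
Qed.
End marginals.

Section limit_laws.
Variables (R : realType) (d : nat).

Definition quartic_rate : R := 4 * d.+1%:R ^+ 4 / 3.

Definition limit_weight (z : euclid R d.+1) : R :=
  expR (- (quartic_rate * z.1 ^+ 4 + gaussian_rate R d / 2 * quad z.2)).

Lemma measurable_limit_weight :
  measurable_fun setT (limit_weight : _ -> measurableTypeR R).
Proof.
apply/measurableT_comp => //; apply: measurableT_comp => //.
apply: measurable_funD.
  by apply: measurable_funM => //; apply: measurable_funX; exact: measurable_fst.
apply: measurable_funM => //.
exact: measurableT_comp (@measurable_quad R d) (@measurable_snd _ _ (measurableTypeR R) _).
Qed.

(** The limit weight is a product, so normalising each factor gives independent
    laws. *)
Lemma limit_laws : exists (P : probability (euclid R d.+1) R) (k : R)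
    (mP : has_density P (vol R d.+1) (fun z => k * limit_weight z))
    (LT : probability (borel R) R),
  [/\ 0 < k, product_law (image_law P (@measurable_tvrow R d)) LT (V_law R d) &
      proportional_density LT (fun t => expR (- (quartic_rate * t ^+ 4)))].
Proof.
have q0 : 0 < quartic_rate by rewrite divr_gt0 // mulr_gt0 // exprn_gt0.
have [PT [k1 [k10 dT PTE]]] := quartic_probability q0.
have [k2 k20 dW] := normal_product_has_density d (gaussian_rate_gt0 R d).
have m1 : measurable_fun setT (fun x : measurableTypeR R => k1 * expR (- (quartic_rate * x ^+ 4))).
  apply: measurable_funM => //.
  apply/measurableT_comp => //; apply: measurableT_comp => //.
  by apply: measurable_funM => //; exact: measurable_funX.
have m2 : measurable_fun setT (fun w : euclid R d => k2 * expR (- (gaussian_rate R d / 2 * quad w))).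
  apply: measurable_funM => //.
  apply/measurableT_comp => //; apply: measurableT_comp => //.
  by apply: measurable_funM => //; exact: measurable_quad.
have p1 (x : measurableTypeR R) : 0 <= k1 * expR (- (quartic_rate * x ^+ 4)).
  by rewrite mulr_ge0 ?expR_ge0 // ltW.
have p2 (w : euclid R d) : 0 <= k2 * expR (- (gaussian_rate R d / 2 * quad w)).
  by rewrite mulr_ge0 ?expR_ge0 // ltW.
exists (product_prob PT (transverse_law R d)), (k1 * k2).
have mP : has_density (product_prob PT (transverse_law R d)) (vol R d.+1)
    (fun z => k1 * k2 * limit_weight z).
  move=> G mG G0.
  rewrite [LHS](product_has_density (n1 := PT) (m1 := @lebesgue_measure R)
    (n2 := transverse_law R d) (m2 := vol R d) m1 m2 p1 p2 dT dW mG G0).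
  apply: eq_integral => -[x w] _ /=; congr (_%:E * _)%E.
  by rewrite mulrACA -expRD -opprD.
exists mP, (image_law PT (@measurable_id_borel R)); split => //.
- exact: mulr_gt0.
- move=> A B mA mB.
  have mA' : measurable ((id : measurableTypeR R -> borel R) @^-1` A).
    by rewrite -[X in measurable X]setTI; exact: measurable_id_borel.
  have mB' : measurable (@vrow R d @^-1` B).
    by rewrite -[X in measurable X]setTI; exact: measurable_vrow.
  exact: (product_measure1E PT (transverse_law R d) mA' mB').
- exists k1 => // A mA; rewrite image_lawE PTE //.
  by rewrite -[X in measurable X]setTI; exact: measurable_id_borel.
Qed.
End limit_laws.

(** * The critical free energy *)

Section free_energy_excess.
Variables (R : realType) (d : nat).
Local Notation D := (d.+1%:R : R).

Definition min_free_energy : R := - (ln D + ln 2 + 1/2 - (D - 1) / (D + 1)).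

Lemma sum_bregman (I : finType) (y : I -> R) m : 0 < m -> (forall i, 0 <= y i) ->
  \sum_i bregman (y i) m =
  \sum_i y i * ln (y i) - (\sum_i y i) * ln m - \sum_i y i + m *+ #|I|.
Proof.
move=> m0 y0.
rewrite -sumr_const mulr_suml -!sumrB -big_split /=; apply: eq_bigr => i _.
rewrite /bregman; have [->|yi] := eqVneq (y i) 0.
  by rewrite !mul0r; ring.
have yi0 : 0 < y i by rewrite lt_neqAle eq_sym yi y0.
by rewrite ln_div ?posrE //; ring.
Qed.

(** This is where the critical values enter: the choice of [beta0] turns
    the quadratic part of the entropy of [s] into that of the energy, and the
    choice of [h0] removes the terms linear in [s]. *)
Lemma excess_free_energy x0 (y : 'I_d.+1 -> R) : 0 <= x0 -> (forall i, 0 <= y i) ->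
  x0 + \sum_i y i = 1 ->
  x0 * ln x0 + \sum_i y i * ln (y i) - (4 * (D / (D + 1))) / 2 * (x0 ^+ 2 + \sum_i y i ^+ 2)
   - (ln D - 2 * ((D - 1) / (D + 1))) * x0 = min_free_energy + excess (1/2 - x0) y.
Proof.
move=> x00 y0 sy.
have D0 : 0 < D by [].
have sy' : \sum_i y i = 1 - x0 by lra.
have sm : 1/2 + (1/2 - x0) = \sum_i y i by lra.
rewrite /excess /quartic_entropy sm.
have sq : \sum_i (y i - (\sum_i y i) / D) ^+ 2 = \sum_i y i ^+ 2 - (\sum_i y i) ^+ 2 / D.
  set S := \sum_i y i.
  have e (i : 'I_d.+1) : (y i - S / D) ^+ 2 = y i ^+ 2 - 2 * (S / D) * y i + (S / D) ^+ 2.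
    by ring.
  rewrite (eq_bigr _ (fun i _ => e i)) big_split sumrB /= -mulr_sumr -/S.
  rewrite sumr_const card_ord -[(_ ^+ 2) *+ d.+1]mulr_natr.
  by field; rewrite gt_eqF.
rewrite sq.
have br : \sum_i bregman (y i) ((\sum_i y i) / D) =
    \sum_i y i * ln (y i) - (\sum_i y i) * (ln (\sum_i y i) - ln D).
  have [S0|S0] := eqVneq (\sum_i y i) 0.
    rewrite S0 !mul0r.
    have yi i : y i = 0.
      by have /psumr_eq0P := S0; apply => // j _; exact: y0.
    rewrite !big1 ?subr0 // => i _; rewrite yi ?mul0r //.
    by rewrite /bregman !mul0r oppr0 !addr0.
  have Sgt0 : 0 < \sum_i y i by rewrite lt_neqAle eq_sym S0 sumr_ge0.
  rewrite sum_bregman //; last by rewrite divr_gt0.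
  rewrite ln_div ?posrE // card_ord -[(_ / _) *+ _]mulr_natr.
  by field; rewrite gt_eqF.
rewrite br sy' /min_free_energy.
have -> : 1/2 - (1/2 - x0) = x0 by ring.
by field; rewrite !gt_eqF //; lra.
Qed.

Lemma excess_min : excess 0 (fun _ : 'I_d.+1 => (1/2) / D : R) = 0.
Proof.
have D0 : 0 < D by [].
rewrite /excess addr0 !big1 => [|i _|i _]; last 2 first.
- by rewrite subrr expr0n.
- by rewrite /bregman divff ?ln1; [ring|rewrite gt_eqF // divr_gt0].
rewrite /quartic_entropy subr0 !addr0 mulr0 subr0.
have -> : 1/2 = 2^-1 :> R by rewrite mul1r.
by rewrite lnV ?posrE //; field.
Qed.

Let split_q : d.+2%:R - 1 = D.
Proof. by rewrite -[d.+2%:R]natr1 addrK. Qed.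

Lemma beta0E : beta0 R d.+2 = 4 * (D / (D + 1)).
Proof. by rewrite /beta0 split_q -[d.+2%:R]natr1. Qed.

Lemma h0E : h0 R d.+2 = ln D - 2 * ((D - 1) / (D + 1)).
Proof.
rewrite /h0 split_q -[d.+2%:R]natr1; congr (_ - 2 * (_ / _)).
by ring.
Qed.

Lemma free_energy_excess (x : 'rV[R]_d.+2) : simplex x ->
  free_energy (beta0 R d.+2) (h0 R d.+2) x =
  min_free_energy + excess (1/2 - x 0 ord0) (fun i => x 0 (lift ord0 i)).
Proof.
move=> [sx x0]; rewrite -excess_free_energy //; last first.
  by rewrite -[RHS]sx [RHS]big_ord_recl.
rewrite /free_energy !big_ord_recl beta0E h0E.
have -> : \sum_(i < d.+2 | i == 0%N :> nat) x 0 i = x 0 ord0.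
  by rewrite (big_pred1 ord0) // => i; rewrite /= -val_eqE.
by [].
Qed.

Lemma unique_minimizer_x_star : unique_minimizer simplex
  (free_energy (beta0 R d.+2) (h0 R d.+2)) (@x_star R d.+2).
Proof.
have D0 : 0 < D by [].
have x0E : @x_star R d.+2 0 ord0 = 1/2 by rewrite mxE /= mul1r.
have xiE i : @x_star R d.+2 0 (lift ord0 i) = (1/2) / D.
  by rewrite mxE /= split_q invfM mul1r.
have sx : simplex (@x_star R d.+2).
  split.
    rewrite big_ord_recl x0E (eq_bigr _ (fun i _ => xiE i)) sumr_const card_ord.
    by rewrite -(mulr_natr (1/2 / D)) divfK ?gt_eqF //; lra.
  by move=> i; rewrite mxE split_q; case: ifP => _; rewrite invr_ge0 ?mulr_ge0.
split => // y sy yx; rewrite !free_energy_excess // ltrD2l x0E subrr.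
have -> : (fun i => @x_star R d.+2 0 (lift ord0 i)) = (fun=> (1/2) / D).
  by apply/funext => i; rewrite xiE.
rewrite excess_min.
have [c c0 h] := @excess_quadratic_lower_bound R d.+1 isT.
case: sy => sumy y0.
have Sy : \sum_i y 0 (lift ord0 i) = 1/2 + (1/2 - y 0 ord0).
  by move: sumy; rewrite big_ord_recl => sumy; lra.
have le1 : 1/2 - y 0 ord0 <= 1/2 by have := y0 ord0; lra.
apply: lt_le_trans (h _ _ (fun i => y0 _) Sy le1).
rewrite pmulr_rgt0 // lt_neqAle eq_sym andbC addr_ge0 ?exprn_even_ge0 //=; last first.
  by apply: sumr_ge0 => i _; exact: sqr_ge0.
apply/eqP => e; apply: yx.
have s4 : 0 <= (1/2 - y 0 ord0) ^+ 4 by rewrite exprn_even_ge0.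
have q0 : 0 <= \sum_i (y 0 (lift ord0 i) - (1/2 + (1/2 - y 0 ord0)) / D) ^+ 2.
  by apply: sumr_ge0 => i _; exact: sqr_ge0.
have s40 : (1/2 - y 0 ord0) ^+ 4 = 0 by lra.
have q00 : \sum_i (y 0 (lift ord0 i) - (1/2 + (1/2 - y 0 ord0)) / D) ^+ 2 = 0 by lra.
have s0 : 1/2 - y 0 ord0 = 0 by apply/eqP; move/eqP: s40; rewrite expf_eq0.
apply/matrixP => i j; rewrite (ord1 i).
have [k ->|->] := unliftP ord0 j; last by rewrite x0E; lra.
rewrite xiE; have /psumr_eq0P := q00.
move=> /(_ (fun i _ => sqr_ge0 _) k isT)/eqP; rewrite expf_eq0 /= subr_eq0 => /eqP ->.
by rewrite s0 addr0.
Qed.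
End free_energy_excess.

(** * The law of the counts *)

Section potts_weights.
Variables (R : realType) (d : nat).
Local Notation D := (d.+1%:R : R).
Implicit Types (beta h : R) (n : nat) (c : {ffun 'I_d.+2 -> nat}).

Definition count_weight beta h n c : R :=
  expR (beta / (2 * n%:R) * (\sum_k (c k)%:R ^+ 2 - n%:R) + h * (c ord0)%:R).

Lemma potts_energy_occurrences beta h n (s : config n d.+2) :
  expR (potts_energy beta h s) = count_weight beta h n [ffun k => occurrences s k].
Proof.
have e1 : \sum_(i < n) (s i == 0%N :> nat)%:R = (occurrences s ord0)%:R :> R.
  by rewrite /occurrences natr_sum; apply: eq_bigr => i _; rewrite -val_eqE.
rewrite /potts_energy /count_weight ffunE e1; apply: congr1; congr (_ + _).
have occE k : (occurrences s k)%:R = \sum_(i < n) (s i == k)%:R :> R by rewrite /occurrences natr_sum.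
set A := \sum_(i < n) \sum_(j < n | _) _.
have AE : \sum_k ([ffun k => occurrences s k] k)%:R ^+ 2 = 2 * A + n%:R.
  transitivity (\sum_(i < n) \sum_(j < n) (s i == s j)%:R : R).
    under eq_bigr do rewrite ffunE occE expr2 mulr_suml.
    rewrite exchange_big /=; apply: eq_bigr => i _.
    under eq_bigr do rewrite mulr_sumr.
    rewrite exchange_big /=; apply: eq_bigr => j _.
    rewrite (bigD1 (s i)) //= eqxx mul1r big1 ?addr0 => [|k]; first by rewrite eq_sym.
    by rewrite eq_sym => /negPf ->; rewrite mul0r.
  have B : \sum_(i < n) \sum_(j < n | (j < i)%N) (s i == s j)%:R = A.
    rewrite /A (exchange_big_dep xpredT) //=; apply: eq_bigr => i _.
    by apply: eq_bigr => j _; rewrite eq_sym.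
  rewrite mulr_natl mulr2n -{1}B -big_split /= -[n in _ + n%:R]card_ord -sumr_const -big_split /=.
  apply: eq_bigr => i _.
  rewrite (bigID (fun j : 'I_n => (j < i)%N)) /= -addrA; congr (_ + _).
  rewrite (bigD1 i) ?ltnn //= eqxx addrC; congr (_ + _); apply: eq_bigl => j.
  by rewrite -leqNgt ltn_neqAle eq_sym andbC -val_eqE.
rewrite AE addrK; have [->|n0] := eqVneq (n%:R : R) 0; first by rewrite mulr0 !invr0 !mulr0 !mul0r.
by field.
Qed.

Definition deviation n c : R := 1/2 - (c ord0)%:R / n%:R.
Definition fraction n c (i : 'I_d.+1) : R := (c (lift ord0 i))%:R / n%:R.

(** Contribution to the exponent of the deviation of the parameters from their
    critical values, relative to the minimizer. *)
Definition tilt beta h n c : R :=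
  n%:R * (beta - beta0 R d.+2) / 2 *
    ((1/2 - deviation n c) ^+ 2 + \sum_i fraction n c i ^+ 2 - (1/4 + (1/4) / D))
  - n%:R * (h - h0 R d.+2) * deviation n c.

(** Weight of a count vector, normalised so that it has a limit: each Stirling
    ratio is of order [sqrt n]. *)
Definition local_density beta h n c : R :=
  (\prod_k (Num.sqrt n%:R / stirling_ratio (c k))) *
  expR (- (n%:R * excess (deviation n c) (fraction n c)) + tilt beta h n c).

Let ln_frac (k n : nat) : (0 < n)%N ->
  k%:R / n%:R * ln (k%:R / n%:R) = (k%:R * ln k%:R - k%:R * ln n%:R) / n%:R :> R.
Proof.
move=> n0; have [->|k0] := posnP k; first by rewrite !mul0r subrr mul0r.
by rewrite ln_div ?posrE ?ltr0n //; ring.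
Qed.

Let factE (k : nat) : k`!%:R = stirling_ratio k * expR (k%:R * ln k%:R - k%:R) :> R.
Proof.
have [->|k0] := posnP k.
  by rewrite /stirling_ratio !mul0r subrr expR0 expr0 fact0 !mulr1 invr1 mulr1.
have k0' : 0 < k%:R :> R by rewrite ltr0n.
rewrite /stirling_ratio expRB expRM_natl lnK ?posrE //.
field; rewrite expf_neq0 ?gt_eqF ?expR_gt0 //.
Qed.

(** Stirling ratios turn multinomial coefficients into the entropy part of the
    free energy. *)
Lemma multinomial_weight beta h n : (0 < n)%N -> exists2 K : R, 0 < K &
  forall c, (\sum_k c k)%N = n ->
    n`!%:R / (\prod_k (c k)`!%:R) * count_weight beta h n c = K * local_density beta h n c.
Proof.
move=> n0; have n0' : 0 < n%:R :> R by rewrite ltr0n.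
have sq0 : 0 < Num.sqrt (n%:R : R) by rewrite sqrtr_gt0.
pose kap : R := 1/4 + (1/4) / D.
pose e0 := - (beta / 2) - n%:R - n%:R * min_free_energy R d + n%:R * (beta - beta0 R d.+2) / 2 * kap
   + n%:R * (h - h0 R d.+2) / 2 + n%:R.
exists (stirling_ratio n / Num.sqrt n%:R ^+ d.+2 * expR e0).
  by rewrite mulr_gt0 ?expR_gt0 // divr_gt0 ?exprn_gt0 ?stirling_ratio_gt0.
move=> c sc.
have S0 k : stirling_ratio k != 0 :> R by rewrite gt_eqF ?stirling_ratio_gt0.
have sc' : \sum_k (c k)%:R = n%:R :> R by rewrite -natr_sum sc.
rewrite factE (eq_bigr (fun k => stirling_ratio (c k) * expR ((c k)%:R * ln (c k)%:R - (c k)%:R))); last first.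
  by move=> k _; exact: factE.
rewrite big_split /= -expR_sum sumrB sc' /local_density.
have -> : \prod_k (Num.sqrt n%:R / stirling_ratio (c k)) =
    Num.sqrt n%:R ^+ d.+2 / \prod_k stirling_ratio (c k) :> R.
  by rewrite prodf_div prodr_const card_ord.
set P := \prod_k stirling_ratio (c k); set L := \sum_k (c k)%:R * ln (c k)%:R.
have P0 : P != 0 by apply/prodf_neq0 => k _.
rewrite /count_weight.
set A := expR (n%:R * _ - n%:R); set B := expR (L - _); set C := expR (_ + _); set E := expR (_ + tilt _ _ _ _).
have ABC : A * B^-1 * C = expR e0 * E.
  rewrite /A /B /C /E -expRN -!expRD; congr expR.
  have -> : excess (deviation n c) (fraction n c) = 
     (c ord0)%:R / n%:R * ln ((c ord0)%:R / n%:R) + \sum_i fraction n c i * ln (fraction n c i)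
     - beta0 R d.+2 / 2 * (((c ord0)%:R / n%:R) ^+ 2 + \sum_i fraction n c i ^+ 2)
     - h0 R d.+2 * ((c ord0)%:R / n%:R) - min_free_energy R d.
    rewrite beta0E h0E excess_free_energy; first by rewrite addrAC subrr add0r.
    - by rewrite divr_ge0.
    - by move=> i; rewrite divr_ge0.
    - rewrite /fraction -mulr_suml -mulrDl.
      have <- : \sum_k (c k)%:R = (c ord0)%:R + \sum_(i < d.+1) (c (lift ord0 i))%:R :> R.
        by rewrite big_ord_recl.
      by rewrite sc' divff ?gt_eqF.
  have -> : (c ord0)%:R / n%:R * ln ((c ord0)%:R / n%:R) + \sum_i fraction n c i * ln (fraction n c i)
     = L / n%:R - ln n%:R.
    rewrite /fraction ln_frac // (eq_bigr _ (fun (i : 'I_d.+1) _ => ln_frac (c (lift ord0 i)) n0)).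
    rewrite -mulr_suml -mulrDl.
    transitivity ((\sum_k ((c k)%:R * ln (c k)%:R - (c k)%:R * ln n%:R)) / n%:R : R).
      by rewrite [in RHS]big_ord_recl.
    by rewrite sumrB -mulr_suml sc' /L; field; rewrite gt_eqF.
  have -> : \sum_k (c k)%:R ^+ 2 = n%:R ^+ 2 * (((c ord0)%:R / n%:R) ^+ 2 + \sum_i fraction n c i ^+ 2).
    rewrite big_ord_recl mulrDr mulr_sumr; congr (_ + _).
      by field; rewrite gt_eqF.
    by apply: eq_bigr => i _; rewrite /fraction; field; rewrite gt_eqF.
  rewrite /tilt /e0 /deviation -/kap; move: (\sum_i fraction n c i ^+ 2) => Q.
  by field; rewrite gt_eqF.
transitivity (stirling_ratio n / P * (A * B^-1 * C)).
  by field; rewrite P0 gt_eqF ?expR_gt0.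
rewrite ABC; set X := Num.sqrt n%:R ^+ d.+2; have X0 : X != 0 by rewrite expf_neq0 ?gt_eqF.
by field; rewrite P0 X0.
Qed.
End potts_weights.

(** * Coordinates at the scale of the fluctuations *)

Section scaling.
Variable R : realType.

(** All the powers of [n] in the scaling are integer powers of [n^(1/4)]. *)
Definition qroot (n : nat) : R := n%:R `^ (1 / 4).

Lemma qrootX (n k : nat) : (0 < n)%N -> qroot n ^+ k = n%:R `^ (k%:R / 4).
Proof.
move=> n0; rewrite /qroot -powR_mulrn ?powR_ge0 // -powRrM; congr (_ `^ _).
by rewrite mulrAC mul1r.
Qed.

Lemma qroot4 n : (0 < n)%N -> qroot n ^+ 4 = n%:R.
Proof. by move=> n0; rewrite qrootX // divff // powRr1. Qed.

Lemma qroot_gt0 n : (0 < n)%N -> 0 < qroot n.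
Proof. by move=> n0; apply: powR_gt0; rewrite ltr0n. Qed.

Lemma qroot_ge1 n : (0 < n)%N -> 1 <= qroot n.
Proof.
move=> n0; rewrite leNgt; apply/negP => h.
have := qroot4 n0; have q0 := qroot_gt0 n0.
have : qroot n ^+ 4 < 1 by rewrite exprn_ilt1 // ltW.
by move=> + e; rewrite e ltrn1; case: n n0 {h e q0}.
Qed.

Lemma powR_three_quarters n : (0 < n)%N -> n%:R `^ (3 / 4) = qroot n ^+ 3.
Proof. by move=> n0; rewrite qrootX. Qed.

Lemma powR_half n : (0 < n)%N -> n%:R `^ (1 / 2) = qroot n ^+ 2.
Proof. by move=> n0; rewrite qrootX //; congr (_ `^ _); field. Qed.

Lemma powRN_three_quarters n : (0 < n)%N -> n%:R `^ (- (3 / 4)) = (qroot n ^+ 3)^-1.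
Proof. by move=> n0; rewrite powRN powR_three_quarters. Qed.

Lemma qroot_cvgV : (qroot n)^-1 @[n --> \oo] --> (0 : R).
Proof.
apply/cvgrPdist_lt => e e0; near=> n.
have n0 : (0 < n)%N by near: n; exists 1%N.
have q0 := qroot_gt0 n0.
rewrite sub0r normrN gtr0_norm ?invr_gt0 // invf_plt ?posrE //.
rewrite -(@ltr_pXn2r _ 4) ?nnegrE ?ltW ?invr_gt0 // qroot4 //.
near: n; exact: nbhs_infty_gtr.
Unshelve. all: by end_near. Qed.
End scaling.

Section coordinates.
Variables (R : realType) (d : nat).
Local Notation D := (d.+1%:R : R).
Implicit Types (beta h : R) (n : nat) (c : {ffun 'I_d.+2 -> nat}).

Definition tcoord n c : R := (n%:R / 2 - (c ord0)%:R) / (qroot R n ^+ 3 * D).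
Definition vcoord n c (i : 'I_d.+1) : R :=
  ((c (lift ord0 i))%:R - (n%:R - (c ord0)%:R) / D) / qroot R n ^+ 2.

Definition vnorm2 n c : R := \sum_i vcoord n c i ^+ 2.

Lemma vnorm2_ge0 n c : 0 <= vnorm2 n c.
Proof. by apply: sumr_ge0 => i _; exact: sqr_ge0. Qed.

Lemma deviation_tcoord n c : (0 < n)%N -> deviation R n c = D * tcoord n c / qroot R n.
Proof.
move=> n0; rewrite /deviation /tcoord -(qroot4 R n0).
by field; rewrite gt_eqF ?qroot_gt0 //= gt_eqF.
Qed.

Lemma fraction_vcoord n c i : (0 < n)%N ->
  fraction R n c i - (1/2 + deviation R n c) / D = vcoord n c i / qroot R n ^+ 2.
Proof.
move=> n0; rewrite /deviation /fraction /vcoord -(qroot4 R n0).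
by field; rewrite gt_eqF ?qroot_gt0 //= gt_eqF.
Qed.

Lemma sum_fraction n c : (0 < n)%N -> (\sum_k c k)%N = n ->
  \sum_i fraction R n c i = 1/2 + deviation R n c.
Proof.
move=> n0 sc; have n0' : 0 < n%:R :> R by rewrite ltr0n.
have := congr1 (fun m => m%:R : R) sc; rewrite natr_sum big_ord_recl => sc'.
rewrite /fraction -mulr_suml /deviation.
have e : \sum_(i < d.+1) (c (lift ord0 i))%:R = n%:R - (c ord0)%:R :> R by rewrite -sc' addrC addKr.
by rewrite e; field; rewrite gt_eqF.
Qed.

Lemma deviation_le n c : (0 < n)%N -> (\sum_k c k)%N = n ->
  - (1/2) <= deviation R n c <= 1/2.
Proof.
move=> n0 sc; have n0' : 0 < n%:R :> R by rewrite ltr0n.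
have f0 : 0 <= \sum_i fraction R n c i by apply: sumr_ge0 => i _; rewrite divr_ge0.
rewrite sum_fraction // in f0.
have : 0 <= (c ord0)%:R / n%:R :> R by rewrite divr_ge0.
by move: f0; rewrite /deviation; lra.
Qed.

Lemma sum_sqr_fraction n c : (0 < n)%N -> (\sum_k c k)%N = n ->
  \sum_i fraction R n c i ^+ 2 =
  vnorm2 n c / qroot R n ^+ 4 + (1/2 + deviation R n c) ^+ 2 / D.
Proof.
move=> n0 sc; rewrite /vnorm2 mulr_suml.
have e i : vcoord n c i ^+ 2 / qroot R n ^+ 4 = fraction R n c i ^+ 2
   - 2 * ((1/2 + deviation R n c) / D) * fraction R n c i + ((1/2 + deviation R n c) / D) ^+ 2.
  transitivity ((vcoord n c i / qroot R n ^+ 2) ^+ 2).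
    by rewrite [RHS]expr_div_n (exprM (qroot R n) 2 2).
  by rewrite -fraction_vcoord //; ring.
rewrite (eq_bigr _ (fun i _ => e i)) big_split sumrB /= -mulr_sumr sum_fraction //.
rewrite sumr_const card_ord -(mulr_natr (((1 / 2 + deviation R n c) / D) ^+ 2)).
by field; rewrite gt_eqF.
Qed.

(** The increment of the sum of squares is linear in [s] near the minimizer, and
    [s * qroot n = D * tcoord]. *)
Lemma tilt_le beta h n c e : (0 < n)%N -> (\sum_k c k)%N = n ->
  n%:R * `|beta - beta0 R d.+2| <= e * qroot R n ->
  n%:R * `|h - h0 R d.+2| <= e * qroot R n ->
  `|tilt beta h n c| <= e * (4 * D * `|tcoord n c| + vnorm2 n c).
Proof.
move=> n0 sc hb hh.
have n0' : 0 < n%:R :> R by rewrite ltr0n.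
have q0 := qroot_gt0 R n0; have q1 := qroot_ge1 R n0.
have e0 : 0 <= e.
  rewrite -(pmulr_lge0 _ q0); apply: le_trans hb.
  by rewrite mulr_ge0 // ltW.
have /andP[s1 s2] := deviation_le n0 sc.
have D1 : 1 <= D by rewrite (ler_nat R 1).
have v0 := vnorm2_ge0 n c.
set s := deviation R n c in s1 s2 *.
have sE : `|s| * qroot R n = D * `|tcoord n c|.
  rewrite /s deviation_tcoord //; move: (tcoord n c) => t.
  rewrite !normrM (ger0_norm (ltW (lt_le_trans ltr01 D1))).
  by rewrite normfV (gtr0_norm q0) divfK ?gt_eqF.
have aE : `|(1/2 - s) ^+ 2 + \sum_i fraction R n c i ^+ 2 - (1/4 + 1/4 / D)|
    <= 3 * `|s| + vnorm2 n c / qroot R n ^+ 4.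
  rewrite sum_sqr_fraction // -/s.
  have -> : (1/2 - s) ^+ 2 + (vnorm2 n c / qroot R n ^+ 4 + (1/2 + s) ^+ 2 / D) - (1/4 + 1/4/D)
     = (s ^+ 2 - s + (s + s ^+ 2) / D) + vnorm2 n c / qroot R n ^+ 4.
    by field; rewrite gt_eqF //=; lra.
  apply: le_trans (ler_normD _ _) _; apply: lerD; last first.
    by rewrite ger0_norm // divr_ge0 // exprn_ge0 // ltW.
  apply: le_trans (ler_normD _ _) _.
  have a1 : `|s ^+ 2 - s| <= 3/2 * `|s|.
    rewrite (_ : s ^+ 2 - s = (s - 1) * s); last by ring.
    rewrite normrM ler_wpM2r // ler_norml; apply/andP; split; lra.
  have a2 : `|(s + s ^+ 2) / D| <= 3/2 * `|s|.
    rewrite normrM; apply: (@le_trans _ _ (`|s + s ^+ 2| * 1)).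
      apply: ler_wpM2l => //.
      by rewrite normfV ger0_norm ?invf_le1 //; lra.
    rewrite mulr1 (_ : s + s ^+ 2 = (1 + s) * s); last by ring.
    rewrite normrM ler_wpM2r // ler_norml; apply/andP; split; lra.
  by lra.
rewrite /tilt -/s; move: sE; move: (tcoord n c) => t sE.
apply: le_trans (ler_normB _ _) _.
rewrite !normrM (gtr0_norm n0').
move: aE; set A := `|_ - _|; set B := vnorm2 n c / _ => aE.
have A0 : 0 <= A by exact: normr_ge0.
have B1 : B * qroot R n <= vnorm2 n c.
  rewrite /B -mulrA ler_piMr //.
  rewrite exprSr invfM -mulrA mulVf ?gt_eqF // mulr1 invf_le1 ?exprn_gt0 //.
  exact: exprn_ege1.
have h1 : n%:R * `|beta - beta0 R d.+2| * `|2^-1| * A <= e * (1/2 * (3 * `|s| * qroot R n + B * qroot R n)).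
  rewrite (_ : `|2^-1 : R| = 1/2); last by rewrite ger0_norm ?invr_ge0 // mul1r.
  apply: (@le_trans _ _ (e * qroot R n * (1/2) * A)).
    by apply: ler_wpM2r => //; apply: ler_wpM2r.
  rewrite (_ : e * (1/2 * (3 * `|s| * qroot R n + B * qroot R n)) = e * qroot R n * (1/2) * (3 * `|s| + B)); last by ring.
  by apply: ler_wpM2l => //; rewrite !mulr_ge0 // ltW.
have h2 : n%:R * `|h - h0 R d.+2| * `|s| <= e * (`|s| * qroot R n).
  rewrite (mulrC `|s|) mulrA; exact: ler_wpM2r.
apply: le_trans (lerD h1 h2) _; rewrite -mulrDr; apply: ler_wpM2l => //.
have -> : 4 * D * `|t| = 4 * (`|s| * qroot R n) by rewrite sE; ring.
have B0 : 0 <= B by rewrite divr_ge0 // exprn_ge0 // ltW.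
have x0 : 0 <= B * qroot R n by rewrite mulr_ge0 // ltW.
have y0 : 0 <= `|s| * qroot R n by rewrite mulr_ge0 // ltW.
have -> : 3 * `|s| * qroot R n = 3 * (`|s| * qroot R n) by ring.
by move: x0 y0 B1; move: (`|s| * _) (B * _) => x y; lra.
Qed.
End coordinates.

(** * Domination of the weights *)

Section domination.
Variables (R : realType) (d : nat).
Local Notation D := (d.+1%:R : R).
Implicit Types (beta h : R) (n : nat) (c : {ffun 'I_d.+2 -> nat}).

Let Q n c : R := tcoord R n c ^+ 4 + vnorm2 R n c.

Let Q0 n c : 0 <= Q n c.
Proof. by rewrite addr_ge0 ?vnorm2_ge0 // exprn_even_ge0. Qed.

Let D1 : 1 <= D.
Proof. by rewrite (ler_nat R 1). Qed.

Let D4 : 1 <= D ^+ 4.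
Proof. exact: exprn_ege1. Qed.

Let nu_sqr n c i : (0 < n)%N ->
  n%:R * (fraction R n c i - (1/2 + deviation R n c) / D) ^+ 2 = vcoord R n c i ^+ 2.
Proof.
move=> n0; rewrite fraction_vcoord // -(qroot4 R n0).
by move: (vcoord _ _ _ _) => v; field; rewrite gt_eqF // qroot_gt0.
Qed.

Let s_pow4 n c : (0 < n)%N -> n%:R * deviation R n c ^+ 4 = D ^+ 4 * tcoord R n c ^+ 4.
Proof.
move=> n0; rewrite deviation_tcoord // -(qroot4 R n0).
by move: (tcoord _ _ _) => t; field; rewrite gt_eqF // qroot_gt0.
Qed.

(* A count of smaller order than [n] is far from its typical value, so it costs
   at least a multiple of [n] in [Q]. This happens only if [s] or the transverse
   deviation of that colour is of order one. *)
Let count_lower : exists2 A : R, 1 <= A & forall n c k, (0 < n)%N ->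
  (\sum_k c k)%N = n -> n%:R <= A * (1 + Q n c) * (c k).+1%:R.
Proof.
have [A A4 [A8 A64 A256]] : exists2 A : R, 4 <= A &
    [/\ 8 * D <= A, 64 * D ^+ 2 <= A & 256 * D ^+ 4 <= A].
  have D1' := D1; have D4' := D4.
  exists (256 * D ^+ 4); first by lra.
  have D2 : 1 <= D ^+ 2 by exact: exprn_ege1.
  have D42 : D ^+ 2 <= D ^+ 4 by rewrite ler_weXn2l.
  have D21 : D <= D ^+ 2 by rewrite -[leLHS]expr1 ler_weXn2l.
  by split => //; lra.
have D1' := D1; have D4' := D4.
have A0 : 0 <= A by lra.
exists A; first by lra.
move=> n c k n0 sc; have n0' : 0 < n%:R :> R by rewrite ltr0n.
have c1 j : 1 <= (c j).+1%:R :> R by rewrite (ler_nat R 1).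
have q0 := Q0 n c.
have step B : B <= A -> n%:R <= B * (c k).+1%:R ->
    n%:R <= A * (1 + Q n c) * (c k).+1%:R.
  move=> hA hn; apply: le_trans hn _; apply: ler_wpM2r => //.
  by apply: le_trans hA _; rewrite ler_peMr //; lra.
have big : n%:R <= A * Q n c -> n%:R <= A * (1 + Q n c) * (c k).+1%:R.
  move=> hn; apply: le_trans hn _; rewrite -[leLHS]mulr1.
  apply: ler_pM => //; first exact: mulr_ge0.
  by apply: ler_wpM2l => //; lra.
set s := deviation R n c.
have s4 : n%:R * s ^+ 4 = D ^+ 4 * tcoord R n c ^+ 4 by exact: s_pow4.
have v0 := vnorm2_ge0 R n c.
have t4 : 0 <= tcoord R n c ^+ 4 by rewrite exprn_even_ge0.
have far : 1/4 <= `|s| -> n%:R <= A * (1 + Q n c) * (c k).+1%:R.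
  move=> hs; apply: big.
  have h : 1/256 <= s ^+ 4.
    rewrite (_ : s ^+ 4 = `|s| ^+ 4); last by rewrite -normrX ger0_norm // exprn_even_ge0.
    rewrite (_ : 1/256 = (1/4) ^+ 4 :> R); last by field.
    by rewrite lerXn2r // nnegrE; lra.
  have h2 : n%:R * (1/256) <= D ^+ 4 * tcoord R n c ^+ 4 by rewrite -s4 ler_wpM2l // ltW.
  have h3 : D ^+ 4 * tcoord R n c ^+ 4 <= D ^+ 4 * Q n c.
    by apply: ler_wpM2l; [lra|rewrite /Q; lra].
  have h4 : 256 * D ^+ 4 * Q n c <= A * Q n c by apply: ler_wpM2r.
  by lra.
have [hs|hs] := leP (1/4) `|s|; first exact: far.
move: hs; rewrite ltr_norml => /andP[s1 s2].
have [j kE|kE] := unliftP ord0 k; last first.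
  apply: (step 4) => //; rewrite kE.
  have -> : n%:R = 4 * (n%:R * (1/4)) :> R by field.
  apply: ler_wpM2l => //.
  have e : (c ord0)%:R = n%:R * (1/2 - s).
    by rewrite /s /deviation; field; rewrite gt_eqF.
  rewrite -[(c ord0).+1%:R]natr1 e; apply: (@le_trans _ _ (n%:R * (1/2 - s))); last by lra.
  by apply: ler_wpM2l; lra.
have D0 : 0 < D by [].
have fE : n%:R * fraction R n c j = (c (lift ord0 j))%:R by rewrite mulrC divfK // gt_eqF.
have nu := nu_sqr c j n0; rewrite -/s in nu.
have vj : vcoord R n c j ^+ 2 <= vnorm2 R n c.
  rewrite /vnorm2 (bigD1 j) //= lerDl; apply: sumr_ge0 => i _; exact: sqr_ge0.
have m1 : 1 / (4 * D) <= (1/2 + s) / D.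
  by rewrite ler_pdivrMr ?mulr_gt0 // (_ : _ * (4 * D) = 4 * (1/2 + s)); [lra|field; rewrite gt_eqF].
have iD : 1 / (4 * D) = 2 * (1 / (8 * D)) by field; rewrite gt_eqF.
have iD0 : 0 < 1 / (8 * D) by rewrite divr_gt0 // mulr_gt0.
have [hv|hv] := leP (1 / (8 * D)) ((1/2 + s) / D - fraction R n c j).
  apply: big.
  have h : n%:R * (1 / (8 * D)) ^+ 2 <= Q n c.
    apply: (@le_trans _ _ (vcoord R n c j ^+ 2)); last by rewrite /Q; lra.
    rewrite -nu; apply: ler_wpM2l; first exact: ltW.
    rewrite -[leRHS]sqrrN opprB lerXn2r // nnegrE; first exact: ltW.
    exact: le_trans (ltW iD0) hv.
  have -> : n%:R = 64 * D ^+ 2 * (n%:R * (1 / (8 * D)) ^+ 2) by field; rewrite gt_eqF.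
  by apply: ler_pM.
apply: (step (8 * D)) => //; rewrite kE.
have -> : n%:R = 8 * D * (n%:R * (1 / (8 * D))) by field; rewrite gt_eqF.
apply: ler_wpM2l; first by rewrite mulr_ge0 // ltW.
rewrite -[(c _).+1%:R]natr1 -fE; apply: (@le_trans _ _ (n%:R * fraction R n c j)); last by lra.
apply: ler_wpM2l; first exact: ltW.
by move: hv m1 iD; move: (1 / (4 * D)) (1 / (8 * D)) ((1/2 + s) / D) => x y z; lra.
Qed.

Lemma stirling_factors_le : exists2 A : R, 0 < A & forall n c, (0 < n)%N ->
  (\sum_k c k)%N = n ->
  \prod_k (Num.sqrt n%:R / stirling_ratio (c k)) <= A * (1 + Q n c) ^+ d.+2.
Proof.
have [A A1 hA] := count_lower; have [C C0 hC] := @stirling_ratio_ge R.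
have CA0 : 0 < C * A by rewrite mulr_gt0 //; lra.
exists ((C * A) ^+ d.+2); first exact: exprn_gt0.
move=> n c n0 sc; rewrite -exprMn -[in leRHS](card_ord d.+2) -prodr_const.
apply: ler_prod => k _; apply/andP; split.
  by rewrite mulr_ge0 ?sqrtr_ge0 // invr_ge0 ltW // stirling_ratio_gt0.
have q0 := Q0 n c.
have X1 : 1 <= A * (1 + Q n c).
  by rewrite -[leLHS]mulr1; apply: ler_pM => //; lra.
have sk : 0 < Num.sqrt (c k).+1%:R :> R by rewrite sqrtr_gt0.
apply: (@le_trans _ _ (Num.sqrt n%:R * (C / Num.sqrt (c k).+1%:R))).
  by apply: ler_wpM2l; [exact: sqrtr_ge0|exact: hC].
rewrite mulrCA -[leRHS]mulrA; apply: ler_wpM2l; first exact: ltW.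
rewrite ler_pdivrMr //.
apply: (@le_trans _ _ (Num.sqrt (A * (1 + Q n c) * (c k).+1%:R))).
  by rewrite ler_sqrt; [exact: hA|rewrite mulr_ge0 //; lra].
rewrite sqrtrM; last by lra.
apply: ler_wpM2r; first exact: sqrtr_ge0.
rewrite -[leRHS]ger0_norm; last by lra.
rewrite -sqrtr_sqr ler_sqrt; last exact: sqr_ge0.
by rewrite expr2 ler_peMl //; lra.
Qed.

Let exp_power (dl : R) k (x : R) : 0 < dl -> 0 <= x ->
  (1 + x) ^+ k <= (dl^-1 + 1) ^+ k * expR (k%:R * (dl * x)).
Proof.
move=> dl0 x0; rewrite expRM_natl -exprMn lerXn2r ?nnegrE //.
- by lra.
- by rewrite mulr_ge0 ?expR_ge0 // addr_ge0 // invr_ge0 ltW.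
have i0 : 0 < dl^-1 by rewrite invr_gt0.
apply: (@le_trans _ _ ((dl^-1 + 1) * (1 + dl * x))); last first.
  by apply: ler_wpM2l; [lra|exact: expR_ge1Dx].
have e : (dl^-1 + 1) * (1 + dl * x) = dl^-1 + 1 + x + dl * x by field; rewrite gt_eqF.
by rewrite e; have := mulr_ge0 (ltW dl0) x0; lra.
Qed.

(** The exponent is at most [- c1 * Q] up to the tilt. The Stirling factors grow
    like a power of [1 + Q], and so are absorbed together with the tilt by a
    fraction of [c1 * Q]. *)
Lemma local_density_le : exists e C k : R, [/\ 0 < e, 0 < C, 0 < k &
  forall beta h n c, (0 < n)%N -> (\sum_k c k)%N = n ->
  n%:R * `|beta - beta0 R d.+2| <= e * qroot R n ->
  n%:R * `|h - h0 R d.+2| <= e * qroot R n ->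
  local_density beta h n c <= C * expR (- (k * (tcoord R n c ^+ 2 + vnorm2 R n c)))].
Proof.
have D1' := D1; have D4' := D4.
have [A A0 hA] := stirling_factors_le.
have [c1 c10 hc1] := @excess_quadratic_lower_bound R d.+1 isT.
pose e := c1 / (16 * D).
have e0 : 0 < e by rewrite divr_gt0 // mulr_gt0.
have eD : e * (4 * D) = c1 / 4 by rewrite /e; field; rewrite gt_eqF.
have ec : e <= c1 / 4 by rewrite -eD ler_peMr ?ltW //; lra.
(* Tilt and Stirling factors may each use a quarter of [c1]. *)
pose dl := c1 / (4 * d.+2%:R).
have dl0 : 0 < dl by rewrite divr_gt0 // mulr_gt0.
have dlE x : d.+2%:R * (dl * x) = c1 / 4 * x by rewrite /dl; field; rewrite gt_eqF.
exists e, (A * (dl^-1 + 1) ^+ d.+2 * expR (3/4 * c1)), (c1 / 2); split => //.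
- by rewrite mulr_gt0 ?expR_gt0 // mulr_gt0 // exprn_gt0 // addr_gt0 // invr_gt0.
- by lra.
move=> beta h n c n0 sc hb hh.
have q0 := Q0 n c; have n0' : 0 < n%:R :> R by rewrite ltr0n.
have P0 : 0 <= \prod_k (Num.sqrt n%:R / stirling_ratio (c k) : R).
  by apply: prodr_ge0 => k _; rewrite mulr_ge0 ?sqrtr_ge0 // invr_ge0 ltW // stirling_ratio_gt0.
have P1 := le_trans (hA n c n0 sc) (ler_wpM2l (ltW A0) (exp_power d.+2 dl0 q0)).
rewrite dlE in P1.
have ex : c1 * Q n c <= n%:R * excess (deviation R n c) (fraction R n c).
  have f0 i : 0 <= fraction R n c i by rewrite divr_ge0.
  have /andP[_ s2] := deviation_le R n0 sc.
  have := hc1 _ _ f0 (sum_fraction R n0 sc) s2.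
  move/(ler_wpM2l (ltW n0')); apply: le_trans.
  rewrite [leRHS]mulrCA [X in _ <= c1 * X]mulrDr s_pow4 // mulr_sumr (eq_bigr _ (fun i _ => nu_sqr c i n0)).
  apply: ler_wpM2l; first exact: ltW.
  rewrite /Q /vnorm2; apply: lerD => //.
  by rewrite ler_peMl // exprn_even_ge0.
have ti := tilt_le n0 sc hb hh.
have v0 := vnorm2_ge0 R n c.
set t := tcoord R n c in ti *; set v := vnorm2 R n c in ti v0 *.
have QE : Q n c = t ^+ 4 + v by [].
have t4 : `|t| <= 1 + t ^+ 4 /\ t ^+ 2 <= 1 + t ^+ 4.
  have -> : t ^+ 4 = `|t| ^+ 4 by rewrite -normrX ger0_norm // exprn_even_ge0.
  have -> : t ^+ 2 = `|t| ^+ 2 by rewrite real_normK ?num_real.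
  have y0 := normr_ge0 t; move: `|t| y0 => y y0.
  have y4 : y ^+ 4 = (y ^+ 2) ^+ 2 by rewrite -exprM.
  rewrite y4; have := sqr_ge0 (y ^+ 2 - 1/2); have := sqr_ge0 (y - 1/2).
  by split; nra.
have ti2 : tilt beta h n c <= c1 / 4 * (1 + Q n c).
  apply: le_trans (ler_norm _) _; apply: le_trans ti _.
  rewrite mulrDr mulrA eD QE addrA mulrDr; apply: lerD.
    by apply: ler_wpM2l; [lra|case: t4].
  exact: ler_wpM2r.
rewrite /local_density; apply: le_trans (ler_wpM2r (expR_ge0 _) P1) _.
set K := (dl^-1 + 1) ^+ d.+2; rewrite -!(mulrA A) -!(mulrA K) -!expRD.
apply: ler_wpM2l; first exact: ltW.
apply: ler_wpM2l; first by rewrite exprn_ge0 // addr_ge0 // invr_ge0 ltW.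
rewrite ler_expR; move: ex ti2; rewrite QE.
have h2 : c1 / 2 * (t ^+ 2) <= c1 / 2 * (1 + t ^+ 4) by apply: ler_wpM2l; [lra|case: t4].
move: h2; move: (tilt _ _ _ _) (_ * excess _ _) (t ^+ 2) (t ^+ 4) => x y z w.
by lra.
Qed.
End domination.

(** * Pointwise limit of the weights *)

Section pointwise_limit.
Variables (R : realType) (d : nat).
Local Notation D := (d.+1%:R : R).

Let cvg_pow (u : nat -> R) (l : R) (k : nat) : u n @[n --> \oo] --> l -> u n ^+ k @[n --> \oo] --> l ^+ k.
Proof. by move=> ul; exact: (cvg_comp _ _ ul (@exprn_continuous R k l)). Qed.

(** A colour of positive density [x] has a count tending to infinity, so
    Stirling's formula applies to it. *)
Lemma stirling_factor_cvg : exists2 k : R, 0 < k & forall (m : nat -> nat) (x : R), 0 < x ->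
  (m n)%:R / n%:R @[n --> \oo] --> x ->
  Num.sqrt n%:R / stirling_ratio (m n) @[n --> \oo] --> (Num.sqrt x * k)^-1.
Proof.
have [k k0 hk] := @stirling_ratio_cvg R; exists k => // m x x0 hm.
have m_large : \forall n \near \oo, x / 2 * n%:R <= (m n)%:R.
  have : \forall n \near \oo, x / 2 < (m n)%:R / n%:R.
    by apply: (cvgr_gt x) => //; lra.
  apply: filterS2 (nbhs_infty_gt 0) => n n0 h.
  by rewrite -ler_pdivlMr ?ltr0n // ltW.
have m_oo : m n @[n --> \oo] --> \oo.
  apply/cvgnyPge => A; near=> n.
  rewrite -(ler_nat R); apply: (@le_trans _ _ (x / 2 * n%:R)); last by near: n.
  rewrite mulrC -ler_pdivrMr; last by lra.
  near: n; exact: nbhs_infty_ger.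
have m_ratio : stirling_ratio (m n) / Num.sqrt (m n)%:R @[n --> \oo] --> k.
  exact: (cvg_comp _ _ m_oo hk).
have sx : Num.sqrt ((m n)%:R / n%:R) @[n --> \oo] --> Num.sqrt x.
  exact: (cvg_comp _ _ hm (@sqrt_continuous R x)).
have l : (Num.sqrt ((m n)%:R / n%:R) * (stirling_ratio (m n) / Num.sqrt (m n)%:R))^-1
    @[n --> \oo] --> (Num.sqrt x * k)^-1.
  apply: cvgV; first by rewrite mulf_neq0 // gt_eqF // sqrtr_gt0.
  exact: cvgM.
apply: cvg_trans l; apply: near_eq_cvg; near=> n.
have n0 : (0 < n)%N by near: n; exact: nbhs_infty_gt.
have n0' : 0 < n%:R :> R by rewrite ltr0n.
have mn0 : 0 < (m n)%:R :> R.
  apply: (@lt_le_trans _ _ (x / 2 * n%:R)); last by near: n.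
  by rewrite mulr_gt0 //; lra.
have s0 := @stirling_ratio_gt0 R (m n).
rewrite sqrtrM ?ltW // sqrtrV ?ltW //.
have h1 : Num.sqrt (m n)%:R != 0 :> R by rewrite gt_eqF // sqrtr_gt0.
have h2 : Num.sqrt n%:R != 0 :> R by rewrite gt_eqF // sqrtr_gt0.
move: (Num.sqrt n%:R) (Num.sqrt (m n)%:R) (stirling_ratio (m n)) s0 h1 h2 => a b c c0 h1 h2.
by field; rewrite h1 h2 gt_eqF.
Unshelve. all: by end_near. Qed.

Variables (beta h : nat -> R).
Hypothesis beta_rate : forall e, 0 < e ->
  \forall n \near \oo, n%:R * `|beta n - beta0 R d.+2| <= e * qroot R n.
Hypothesis h_rate : forall e, 0 < e ->
  \forall n \near \oo, n%:R * `|h n - h0 R d.+2| <= e * qroot R n.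

Variables (c : nat -> {ffun 'I_d.+2 -> nat}) (z : euclid R d.+1).
Hypothesis sum_c : \forall n \near \oo, (\sum_k c n k)%N = n.
Hypothesis t_cvg : tcoord R n (c n) @[n --> \oo] --> (z.1 : R).
Hypothesis v_cvg : forall i : 'I_d.+1, vcoord R n (c n) i @[n --> \oo] --> helmert z.2 i.

Let s n := deviation R n (c n).
Let m n := (1/2 + s n) / D.
Let y n i := fraction R n (c n) i.

Let n_gt0 : \forall n \near \oo, (0 < n)%N.
Proof. exact: nbhs_infty_gt. Qed.

Let s_cvg : s n @[n --> \oo] --> (0 : R).
Proof.
have l : D * tcoord R n (c n) * (qroot R n)^-1 @[n --> \oo] --> D * z.1 * 0.
  by apply: cvgM; [apply: cvgMr|exact: qroot_cvgV].
rewrite mulr0 in l; apply: cvg_trans l; apply: near_eq_cvg.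
by apply: filterS n_gt0 => n n0; rewrite /s deviation_tcoord.
Qed.

Let m_cvg : m n @[n --> \oo] --> 1 / (2 * D).
Proof.
have -> : 1 / (2 * D) = (1/2 + 0) / D by field; rewrite gt_eqF.
by apply: cvgMl; apply: cvgD => //; exact: cvg_cst.
Qed.

Let nu_cvg i : vcoord R n (c n) i / qroot R n ^+ 2 @[n --> \oo] --> (0 : R).
Proof.
have l : vcoord R n (c n) i * ((qroot R n)^-1 * (qroot R n)^-1) @[n --> \oo] --> helmert z.2 i * (0 * 0).
  by apply: cvgM => //; apply: cvgM; exact: qroot_cvgV.
rewrite !mulr0 in l; apply: cvg_trans l; apply: near_eq_cvg.
by apply: nearW => n; rewrite expr2 invfM.
Qed.

Let y_cvg i : y n i @[n --> \oo] --> 1 / (2 * D).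
Proof.
have l : vcoord R n (c n) i / qroot R n ^+ 2 + m n @[n --> \oo] --> 0 + 1 / (2 * D).
  exact: cvgD (nu_cvg i) m_cvg.
rewrite add0r in l.
apply: cvg_trans l; apply: near_eq_cvg.
by apply: filterS n_gt0 => n n0; rewrite -fraction_vcoord // -/(m n) subrK.
Qed.

(* The two bounds for the quartic entropy are equivalent to [4/3 * s^4], and
   [n * s^4 = (D * tcoord)^4]. *)
Let n_quartic_cvg : n%:R * quartic_entropy (s n) @[n --> \oo] --> quartic_rate R d * z.1 ^+ 4.
Proof.
have l1 : 4/3 * D ^+ 4 * tcoord R n (c n) ^+ 4 @[n --> \oo] --> quartic_rate R d * z.1 ^+ 4.
  have -> : quartic_rate R d = 4/3 * D ^+ 4 by rewrite /quartic_rate; field.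
  by apply: cvgMr; exact: cvg_pow.
have l2 : 4/3 * D ^+ 4 * tcoord R n (c n) ^+ 4 * (1 - 4 * (s n * s n))^-1 @[n --> \oo]
    --> quartic_rate R d * z.1 ^+ 4 * (1 - 4 * (0 * 0))^-1.
  apply: cvgM => //; apply: cvgV; first by rewrite !mulr0 subr0 oner_eq0.
  by apply: cvgB; [exact: cvg_cst|apply: cvgMr; exact: cvgM].
rewrite !mulr0 subr0 invr1 mulr1 in l2.
apply: squeeze_cvgr l1 l2; near=> n.
have n0 : (0 < n)%N by near: n.
have s4 : 4/3 * D ^+ 4 * tcoord R n (c n) ^+ 4 = n%:R * (4/3 * s n ^+ 4).
  rewrite /s deviation_tcoord // -(qroot4 R n0); move: (tcoord _ _ _) => t.
  by field; rewrite gt_eqF // qroot_gt0.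
have : `|s n| < 1/4.
  near: n; apply: (cvgr_norm_lt 0 s_cvg); rewrite normr0; lra.
rewrite ltr_norml => /andP[s1 s2].
rewrite s4; apply/andP; split.
  apply: ler_wpM2l => //.
  have h4 : -(1/2) <= s n <= 1/2 by lra.
  apply: le_trans (quartic_entropy_ge h4).
  by rewrite lerDl; apply: mulr_ge0; [lra|rewrite exprn_even_ge0].
rewrite -(mulrA n%:R) -expr2; apply: ler_wpM2l => //.
by apply: quartic_entropy_le; lra.
Unshelve. all: by end_near. Qed.

(* Both Bregman bounds are [(y - m)^2] times a factor that tends to
   [D], and [n * (y - m)^2 = vcoord^2]. *)
Let n_bregman_cvg i : n%:R * bregman (y n i) (m n) @[n --> \oo] --> D * helmert z.2 i ^+ 2.
Proof.
have D0 : 0 < D by [].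
set v := fun n => vcoord R n (c n) i.
have v2 : v n ^+ 2 @[n --> \oo] --> helmert z.2 i ^+ 2 by apply: cvg_pow; exact: v_cvg.
have yi := y_cvg i.
have m2 : 2 * m n @[n --> \oo] --> 2 * (1 / (2 * D)) by apply: cvgMr.
have y2 : 2 * y n i @[n --> \oo] --> 2 * (1 / (2 * D)) by apply: cvgMr.
have l1 : v n ^+ 2 * (3 * (2 * (y n i + 2 * m n))^-1) @[n --> \oo] -->
    helmert z.2 i ^+ 2 * (3 * (2 * (1 / (2 * D) + 2 * (1 / (2 * D))))^-1).
  apply: cvgM => //; apply: cvgMr; apply: cvgV.
    by rewrite gt_eqF // !mulr_gt0 // addr_gt0 // ?mulr_gt0 // divr_gt0 // mulr_gt0.
  by apply: cvgMr; exact: cvgD.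
have l2 : v n ^+ 2 * ((y n i + 2 * m n) * (2 * m n * (m n + 2 * y n i))^-1) @[n --> \oo] -->
    helmert z.2 i ^+ 2 * ((1 / (2 * D) + 2 * (1 / (2 * D))) *
      (2 * (1 / (2 * D)) * (1 / (2 * D) + 2 * (1 / (2 * D))))^-1).
  apply: cvgM => //; apply: cvgM; first exact: cvgD.
  apply: cvgV; last by apply: cvgM => //; exact: cvgD.
  have i0 : 0 < 1 / (2 * D) by rewrite divr_gt0 // mulr_gt0.
  by rewrite gt_eqF // !mulr_gt0 // addr_gt0 // ?mulr_gt0.
rewrite (_ : helmert z.2 i ^+ 2 * _ = D * helmert z.2 i ^+ 2) in l1; last first.
  by move: (helmert _ _) => x; field; rewrite gt_eqF.
rewrite (_ : helmert z.2 i ^+ 2 * _ = D * helmert z.2 i ^+ 2) in l2; last first.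
  by move: (helmert _ _) => x; field; rewrite gt_eqF.
apply: squeeze_cvgr l1 l2; near=> n.
have n0 : (0 < n)%N by near: n.
have i0 : 0 < 1 / (2 * D) by rewrite divr_gt0 // mulr_gt0.
have m0 : 0 < m n by near: n; exact: (cvgr_gt _ m_cvg).
have y0 : 0 < y n i by near: n; exact: (cvgr_gt _ yi).
have e : v n ^+ 2 = n%:R * (y n i - m n) ^+ 2.
  rewrite /y /m fraction_vcoord // -/(v n) -(qroot4 R n0); move: (v n) => x.
  by field; rewrite gt_eqF // qroot_gt0.
rewrite e -!(mulrA n%:R); apply/andP; split; apply: ler_wpM2l => //.
  by apply: le_trans (bregman_ge m0 (ltW y0)); rewrite mulrCA mulrA.
by apply: le_trans (bregman_le m0 (ltW y0)) _; rewrite mulrA.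
Unshelve. all: by end_near. Qed.

Let n_excess_cvg : n%:R * excess (s n) (y n) @[n --> \oo] -->
  quartic_rate R d * z.1 ^+ 4 + gaussian_rate R d / 2 * quad z.2.
Proof.
have l1 : \sum_i n%:R * bregman (y n i) (m n) @[n --> \oo] --> \sum_(i < d.+1) D * helmert z.2 i ^+ 2.
  by apply: cvg_big => [|i _]; [exact: add_continuous|exact: n_bregman_cvg].
have l2 : \sum_i vcoord R n (c n) i ^+ 2 @[n --> \oo] --> \sum_(i < d.+1) helmert z.2 i ^+ 2.
  by apply: cvg_big => [|i _]; [exact: add_continuous|apply: cvg_pow; exact: v_cvg].
have l : n%:R * quartic_entropy (s n) + \sum_i n%:R * bregman (y n i) (m n)
   - 2 * D / (D + 1) * \sum_i vcoord R n (c n) i ^+ 2 @[n --> \oo] -->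
   quartic_rate R d * z.1 ^+ 4 + \sum_(i < d.+1) D * helmert z.2 i ^+ 2
    - 2 * D / (D + 1) * \sum_(i < d.+1) helmert z.2 i ^+ 2.
  apply: cvgB; first by apply: cvgD; [exact: n_quartic_cvg|].
  exact: cvgMr.
rewrite -mulr_sumr sum_sqr_helmert in l.
have e : D * quad z.2 - 2 * D / (D + 1) * quad z.2 = gaussian_rate R d / 2 * quad z.2.
  rewrite /gaussian_rate; case: eqVneq => [d0|d0].
    (* For [d = 0] there is no transverse direction. *)
    have -> : quad z.2 = 0 by move: z.2; rewrite d0.
    by rewrite !mulr0 subr0.
  rewrite -[d.+2%:R]natr1 -natr1; move: (quad _) => x.
  have x0 : 0 < d%:R :> R by rewrite ltr0n lt0n.
  by field; rewrite !gt_eqF //; lra.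
rewrite -addrA e in l.
apply: cvg_trans l; apply: near_eq_cvg; apply: filterS n_gt0 => n n0.
rewrite /excess -/(m n) [RHS]mulrBr [X in _ = X - _]mulrDr.
rewrite [X in _ = _ + X - _]mulr_sumr; congr (_ - _).
rewrite mulrCA; congr (_ * _); rewrite mulr_sumr; apply: eq_bigr => i _.
rewrite /y /m fraction_vcoord // -(qroot4 R n0); move: (vcoord _ _ _ _) => x.
by field; rewrite gt_eqF // qroot_gt0.
Qed.

Let tilt_cvg : tilt (beta n) (h n) n (c n) @[n --> \oo] --> (0 : R).
Proof.
have l2 : vnorm2 R n (c n) @[n --> \oo] --> \sum_(i < d.+1) helmert z.2 i ^+ 2.
  by apply: cvg_big => [|i _]; [exact: add_continuous|apply: cvg_pow; exact: v_cvg].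
have l : 4 * D * `|tcoord R n (c n)| + vnorm2 R n (c n) @[n --> \oo] -->
    4 * D * `|z.1| + \sum_(i < d.+1) helmert z.2 i ^+ 2.
  by apply: cvgD => //; apply: cvgMr; exact: cvg_norm.
set L := 4 * D * `|z.1| + _ in l.
have L0 : 0 <= L.
  by rewrite addr_ge0 ?mulr_ge0 // sumr_ge0 // => i _; exact: sqr_ge0.
apply/cvgrPdist_le => e e0.
have e1 : 0 < e / (L + 1) by rewrite divr_gt0 //; lra.
near=> n; rewrite sub0r normrN.
have n0 : (0 < n)%N by near: n.
have sc : (\sum_k c n k)%N = n by near: n.
have hb : n%:R * `|beta n - beta0 R d.+2| <= e / (L + 1) * qroot R n.
  by near: n; exact: beta_rate.
have hh : n%:R * `|h n - h0 R d.+2| <= e / (L + 1) * qroot R n.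
  by near: n; exact: h_rate.
apply: le_trans (tilt_le n0 sc hb hh) _.
rewrite mulrAC ler_pdivrMr ?ltr_wpDl //; apply: ler_wpM2l; first exact: ltW.
by apply: ltW; near: n; apply: (cvgr_lt _ l); lra.
Unshelve. all: by end_near. Qed.

Lemma local_density_cvg_constant (k : R) : (forall (m : nat -> nat) (x : R), 0 < x ->
  (m n)%:R / n%:R @[n --> \oo] --> x ->
  Num.sqrt n%:R / stirling_ratio (m n) @[n --> \oo] --> (Num.sqrt x * k)^-1) ->
  local_density (beta n) (h n) n (c n) @[n --> \oo] -->
  (\prod_(i < d.+2) (Num.sqrt (if i == ord0 then 1/2 else 1 / (2 * D)) * k)^-1) * limit_weight z.
Proof.
move=> hk; apply: cvgM.
  apply: cvg_big => [|i _]; first exact: mul_continuous.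
  apply: hk.
    by case: eqP => _; rewrite divr_gt0 // mulr_gt0.
  have [j ->|->] := unliftP ord0 i; first exact: y_cvg.
  rewrite eqxx; have l : 1/2 - s n @[n --> \oo] --> (1/2 - 0 : R) by exact: cvgB (cvg_cst _) s_cvg.
  rewrite subr0 in l.
  apply: cvg_trans l; apply: near_eq_cvg; apply: nearW => n.
  by rewrite /s /deviation opprB addrC subrK.
have l : - (n%:R * excess (s n) (y n)) + tilt (beta n) (h n) n (c n) @[n --> \oo] -->
    - (quartic_rate R d * z.1 ^+ 4 + gaussian_rate R d / 2 * quad z.2) + 0.
  exact: cvgD (cvgN n_excess_cvg) tilt_cvg.
rewrite addr0 in l.
exact: (cvg_comp _ _ l (@continuous_expR R _)).
Qed.
End pointwise_limit.

Section local_density_cvg.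
Variables (R : realType) (d : nat).

Definition rate_condition (u : nat -> R) (l : R) : Prop := forall e : R, 0 < e ->
  \forall n \near \oo, n%:R * `|u n - l| <= e * qroot R n.

Definition density_limit (K : R) : Prop := forall (beta h : nat -> R)
    (c : nat -> {ffun 'I_d.+2 -> nat}) (z : euclid R d.+1),
  rate_condition beta (beta0 R d.+2) -> rate_condition h (h0 R d.+2) ->
  (\forall n \near \oo, (\sum_k c n k)%N = n) ->
  tcoord R n (c n) @[n --> \oo] --> (z.1 : R) ->
  (forall i : 'I_d.+1, vcoord R n (c n) i @[n --> \oo] --> helmert z.2 i) ->
  local_density (beta n) (h n) n (c n) @[n --> \oo] --> K * limit_weight z.

Lemma local_density_cvg : exists2 K : R, 0 < K & density_limit K.
Proof.
have [k k0 hk] := stirling_factor_cvg R.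
exists (\prod_(i < d.+2) (Num.sqrt (if i == ord0 then 1/2 else 1 / (2 * d.+1%:R)) * k)^-1).
  apply: prodr_gt0 => i _; rewrite invr_gt0 mulr_gt0 // sqrtr_gt0.
  by case: eqP => _; rewrite divr_gt0 // mulr_gt0.
move=> beta h c z hb hh sc ht hv.
exact: (local_density_cvg_constant hb hh sc ht hv hk).
Qed.
End local_density_cvg.

(** * Cells around the count vectors *)

Section cells.
Variables (R : realType) (d : nat).
Local Notation D := (d.+1%:R : R).
Implicit Types (n : nat) (c : {ffun 'I_d.+2 -> nat}) (y : euclid R d.+1).

Definition tail_count c (i : nat) : int := (c (inord i.+1) : int).

(** The count vector sits at the lower corner of its cell, in the coordinates
    made of [tcoord] and of the triangular coordinates of [vcoord]. *)
Definition cell n c : set (euclid R d.+1) :=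
  [set` `[tcoord R n c, tcoord R n c + (qroot R n ^+ 3 * D)^-1[] `*`
  box (qroot R n ^+ 2)^-1 (corner (qroot R n ^+ 2) d (tail_count c)).

Definition cell_volume n : R := (qroot R n ^+ 3 * D)^-1 * (qroot R n ^+ 2)^-1 ^+ d.

Lemma cell_volume_gt0 n : (0 < n)%N -> 0 < cell_volume n.
Proof.
move=> n0; have q0 := qroot_gt0 R n0.
by rewrite mulr_gt0 ?exprn_gt0 // invr_gt0 ?exprn_gt0 // mulr_gt0 // exprn_gt0.
Qed.

Lemma measurable_cell n c : measurable (cell n c).
Proof.
by apply: measurableX; [exact: measurable_itv|exact: measurable_box].
Qed.

Lemma vol_cell n c : (0 < n)%N -> vol R d.+1 (cell n c) = (cell_volume n)%:E.
Proof.
move=> n0; have q0 := qroot_gt0 R n0.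
rewrite /cell vol_setX; [|exact: measurable_itv|exact: measurable_box].
rewrite vol_box; last by rewrite invr_ge0 exprn_ge0 // ltW.
rewrite lebesgue_measure_itv /= lte_fin ltrDl invr_gt0 mulr_gt0 ?exprn_gt0 //.
by rewrite -EFinD -EFinM addrAC subrr add0r.
Qed.

Let sum_tail n c : (\sum_k c k)%N = n ->
  \sum_(i < d.+1) tail_count c i = n%:Z - (c ord0)%:Z.
Proof.
move=> <-; rewrite [(\sum_k c k)%N]big_ord_recl PoszD addrAC subrr add0r.
rewrite (big_morph Posz PoszD (erefl _)); apply: eq_bigr => i _; rewrite /tail_count.
by congr (Posz (c _)); apply: val_inj; rewrite /= inordK // ltnS.
Qed.

Lemma helmert_corner n c (i : 'I_d.+1) : (0 < n)%N -> (\sum_k c k)%N = n ->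
  helmert (corner (qroot R n ^+ 2) d (tail_count c)) i = vcoord R n c i.
Proof.
move=> n0 sc; have q0 := qroot_gt0 R n0.
rewrite /corner helmert_invK; last by rewrite -ltnS.
rewrite -mulr_suml -rmorph_sum /= (sum_tail sc) rmorphB /= /vcoord /tail_count.
have -> : inord i.+1 = lift ord0 i :> 'I_d.+2.
  by apply: val_inj; rewrite /= inordK // ltnS.
rewrite -!pmulrn; field; rewrite (gt_eqF q0) //=.
Qed.

Lemma cell_tcoord n c y : (0 < n)%N -> cell n c y ->
  `|y.1 - tcoord R n c| <= (qroot R n)^-1.
Proof.
move=> n0 [/=]; rewrite in_itv /= => /andP[h1 h2] _.
have q0 := qroot_gt0 R n0; have q1 := qroot_ge1 R n0.
have h3 : (qroot R n ^+ 3 * D)^-1 <= (qroot R n)^-1.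
  rewrite lef_pV2 ?posrE ?mulr_gt0 ?exprn_gt0 //.
  have D1 : 1 <= D by rewrite (ler_nat R 1).
  have q2 : 1 <= qroot R n ^+ 2 by exact: exprn_ege1.
  rewrite (_ : qroot R n ^+ 3 * D = qroot R n * (qroot R n ^+ 2 * D)); last by ring.
  rewrite ler_peMr //; first exact: ltW.
  by rewrite -[leLHS]mulr1; apply: ler_pM.
move: h1 h2 h3; move: (y.1 : R) (tcoord R n c) (_ ^-1) (_ ^-1) => a b e f h1 h2 h3.
by rewrite ger0_norm ?subr_ge0 //; lra.
Qed.

Let qroot_sqrV n : (0 < n)%N -> (qroot R n ^+ 2)^-1 <= (qroot R n)^-1.
Proof.
move=> n0; have q0 := qroot_gt0 R n0; have q1 := qroot_ge1 R n0.
by rewrite lef_pV2 ?posrE ?exprn_gt0 // expr2 ler_peMr //; exact: ltW.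
Qed.

Lemma cell_vcoord n c y (i : 'I_d.+1) : (0 < n)%N -> (\sum_k c k)%N = n -> cell n c y ->
  `|helmert y.2 i - vcoord R n c i| <= d%:R * (qroot R n)^-1.
Proof.
move=> n0 sc [_ yb]; have := helmert_box i yb; rewrite helmert_corner // => /le_trans; apply.
by apply: ler_wpM2l => //; exact: qroot_sqrV.
Qed.

Lemma cell_sqnorm n c y : (0 < n)%N -> (\sum_k c k)%N = n -> cell n c y ->
  sqnorm y <= 2 * (tcoord R n c ^+ 2 + vnorm2 R n c) + 2 * d.+1%:R.
Proof.
move=> n0 sc yc; have q0 := qroot_gt0 R n0; have q1 := qroot_ge1 R n0.
have i1 : (qroot R n)^-1 <= 1 by rewrite invf_le1.
have h1 := cell_tcoord n0 yc.
have h2 : sqnorm y.2 <= 2 * vnorm2 R n c + 2 * d%:R.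
  case: yc => _ /sqnorm_box h; apply: le_trans (h _) _.
    exact: le_trans (qroot_sqrV n0) i1.
  rewrite lerD2r; apply: ler_wpM2l => //.
  apply: le_trans (sqnorm_le_quad _) _; rewrite -sum_sqr_helmert /vnorm2.
  by apply: ler_sum => i _; rewrite helmert_corner.
have h3 : y.1 ^+ 2 <= 2 * tcoord R n c ^+ 2 + 2.
  have : `|y.1 - tcoord R n c| <= 1 by lra.
  rewrite ler_norml; move: (y.1 : R) (tcoord R n c) => a b /andP[a1 a2].
  have := sqr_ge0 (a - 2 * b); nra.
rewrite -[d.+1%:R]natr1 /=; lra.
Qed.

(** Number of sites whose colour is not the distinguished one, for the count
    vector whose cell contains [y]. *)
Definition total_tail n y : int := Num.floor (n%:R / 2 + qroot R n ^+ 3 * D * y.1).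

Let cell_floor n c y : (0 < n)%N -> (\sum_k c k)%N = n -> cell n c y ->
  total_tail n y = n%:Z - (c ord0)%:Z.
Proof.
move=> n0 sc [/=]; rewrite in_itv /= => /andP[h1 h2] _.
have q0 := qroot_gt0 R n0.
have q3 : 0 < qroot R n ^+ 3 * D by rewrite mulr_gt0 // exprn_gt0.
rewrite /total_tail; apply: floor_def; rewrite !intrD mulrNz.
move: h1 h2 q3; rewrite /tcoord -!pmulrn; move: (y.1 : R) (qroot R n ^+ 3 * D) => t u h1 h2 q3.
move: h1; rewrite ler_pdivrMr // => h1.
move: h2; rewrite -[ltRHS]/(_ / u + _) -{2}[u^-1]mul1r -mulrDl ltr_pdivlMr // => h2.
by apply/andP; split; lra.
Qed.

Lemma cell_counts n c y : (0 < n)%N -> (\sum_k c k)%N = n -> cell n c y ->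
  (c ord0)%:Z = n%:Z - total_tail n y /\
  forall i : 'I_d.+1, (c (lift ord0 i))%:Z = lattice_floor (qroot R n ^+ 2) (total_tail n y) y.2 i.
Proof.
move=> n0 sc yc; rewrite (cell_floor n0 sc yc); split; first by ring.
move=> i; have q0 : 0 < qroot R n ^+ 2 by rewrite exprn_gt0 // qroot_gt0.
case: yc => _ /(lattice_floor_corner q0)/(_ i); rewrite (sum_tail sc) => ->; last by rewrite -ltnS.
rewrite /tail_count; congr (Posz (c _)); apply: val_inj.
by rewrite /= inordK // ltnS.
Qed.

Lemma cell_inj n c c' y : (0 < n)%N -> (\sum_k c k)%N = n -> (\sum_k c' k)%N = n ->
  cell n c y -> cell n c' y -> c = c'.
Proof.
move=> n0 sc sc' /(cell_counts n0 sc)[a1 a2] /(cell_counts n0 sc')[b1 b2].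
apply/ffunP => k; apply: (can_inj absz_nat).
by have [i ->|->] := unliftP ord0 k; rewrite ?a1 ?b1 ?a2 ?b2.
Qed.

Let corner_ext (sg : R) k (u v : nat -> int) :
  (forall i, (i <= k)%N -> u i = v i) -> corner sg k u = corner sg k v.
Proof.
elim: k u v => [//|k IH] u v uv; rewrite /corner /=; congr pair.
  rewrite uv //; congr (_ - _ / _); apply: eq_bigr => i _; rewrite uv //.
  by rewrite -ltnS.
by apply: IH => i ik; exact: uv.
Qed.

Let qroot_large (A : R) : 0 <= A -> \forall n \near \oo, A <= qroot R n.
Proof.
move=> A0; near=> n; have n0 : (0 < n)%N by near: n; exact: nbhs_infty_gt.
rewrite -(@ler_pXn2r _ 4) ?nnegrE // ?qroot4 //; last by rewrite ltW // qroot_gt0.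
near: n; exact: nbhs_infty_ger.
Unshelve. all: by end_near. Qed.

(** The candidate counts are obtained by rounding. They are of order [n], since
    the displacements prescribed by [y] are of smaller order, and so they are
    nonnegative from some index on. *)
Lemma cell_cover y : \forall n \near \oo, exists c, (\sum_k c k)%N = n /\ cell n c y.
Proof.
pose H := \sum_(i < d.+1) `|helmert y.2 i|.
have H0 : 0 <= H by apply: sumr_ge0.
have d0 : 0 <= d%:R :> R by [].
set t : R := y.1.
pose A := 2 * D * (`|t| + H + d%:R + 1).
have A0 : 0 <= A.
  by have := normr_ge0 t; rewrite /A => t0; apply: mulr_ge0; [apply: mulr_ge0|lra].
near=> n.
have n0 : (0 < n)%N by near: n; exact: nbhs_infty_gt.
have qA : A <= qroot R n by near: n; exact: qroot_large.
have q1 := qroot_ge1 R n0; have q4 := qroot4 R n0.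
have D1 : 1 <= D by rewrite (ler_nat R 1).
set q := qroot R n in qA q1 q4.
have q0 : 0 < q by lra.
have q20 : 0 < q ^+ 2 by exact: exprn_gt0.
have q30 : 0 < q ^+ 3 by exact: exprn_gt0.
set M := total_tail n y.
have /andP[M1 M2] : (M%:~R : R) <= n%:R / 2 + q ^+ 3 * D * t < M%:~R + 1.
  by have := floor_itv (n%:R / 2 + q ^+ 3 * D * t); rewrite intrD.
have nE : n%:R / 2 = q ^+ 3 * (q / 2) :> R by rewrite -q4; field.
have t_le := ler_norm t; have t_ge := ler_norm (- t); rewrite normrN in t_ge.
have M_le : M <= n%:Z.
  rewrite -(ler_int R) -pmulrn; apply: le_trans M1 _.
  have : q ^+ 3 * (D * t) <= q ^+ 3 * (q / 2).
    apply: ler_wpM2l; first exact: ltW.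
    rewrite ler_pdivlMr //; apply: le_trans qA.
    rewrite /A (_ : D * t * 2 = 2 * D * t); last by ring.
    by apply: ler_wpM2l; [apply: mulr_ge0|lra].
  by rewrite -mulrA; lra.
pose u i := lattice_floor (q ^+ 2) M y.2 i.
have box_u : box (q ^+ 2)^-1 (corner (q ^+ 2) d u) y.2 by exact: corner_lattice_floor.
have u_ge i : (i <= d)%N -> 0 <= u i.
  move=> id; rewrite -(ler_int R); have := helmert_box i box_u.
  rewrite /corner helmert_invK // -mulr_suml -rmorph_sum /= sum_lattice_floor ler_norml => /andP[_ h].
  have hi : - H <= helmert y.2 i.
    have : `|helmert y.2 i| <= H.
      rewrite /H -ltnS in id *; rewrite (bigD1 (Ordinal id)) //= lerDl.
      by apply: sumr_ge0.
    by rewrite ler_norml => /andP[].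
  have h2 : q ^+ 2 * helmert y.2 i - (u i)%:~R + M%:~R / D <= d%:R.
    have := ler_wpM2l (ltW q20) h.
    rewrite (_ : q ^+ 2 * (d%:R / q ^+ 2) = d%:R); last by field; rewrite gt_eqF.
    by apply: le_trans; rewrite le_eqVlt; apply/orP; left; apply/eqP; field; rewrite !gt_eqF //; lra.
  have MD : q ^+ 3 * (q / (2 * D)) + q ^+ 3 * t - 1 <= M%:~R / D.
    rewrite ler_pdivlMr; last by lra.
    rewrite [leLHS](_ : _ = q ^+ 3 * (q / 2) + q ^+ 3 * D * t - D); last by field; rewrite gt_eqF //; lra.
    by lra.
  have h3 : q ^+ 3 * (`|t| + H + d%:R + 1) <= q ^+ 3 * (q / (2 * D)).
    apply: ler_wpM2l; first exact: ltW.
    by rewrite ler_pdivlMr; [rewrite mulrC|rewrite mulr_gt0 //; lra].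
  have h4 : q ^+ 2 * (- H) <= q ^+ 2 * helmert y.2 i by apply: ler_wpM2l; [exact: ltW|].
  have h5 : q ^+ 3 * - `|t| <= q ^+ 3 * t by apply: ler_wpM2l; [exact: ltW|lra].
  have h6 : q ^+ 2 * H <= q ^+ 3 * H by apply: ler_wpM2r => //; rewrite ler_weXn2l.
  have h7 : d%:R + 1 <= q ^+ 3 * (d%:R + 1).
    by rewrite ler_peMl; [|lra|exact: exprn_ege1].
  move: h2 MD h3 h4 h5 h6 h7; rewrite !mulrDr !mulrN !mulr1.
  move: (q ^+ 3 * `|t|) (q ^+ 3 * t) (q ^+ 3 * H) (q ^+ 2 * H) (q ^+ 2 * helmert _ _) (q ^+ 3 * (q / _)) (q ^+ 3 * d%:R) (M%:~R / D) ((u i)%:~R) => a1 a2 a3 a4 a5 a6 a7 a8 a9.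
  by lra.
pose c : {ffun 'I_d.+2 -> nat} :=
  [ffun k : 'I_d.+2 => if k == ord0 then `|n%:Z - M|%N else `|u k.-1|%N].
have c0E : (c ord0)%:Z = n%:Z - M by rewrite ffunE eqxx gez0_abs // subr_ge0.
have cE (i : 'I_d.+1) : (c (lift ord0 i))%:Z = u i.
  rewrite ffunE eq_sym (negPf (neq_lift _ _)) [(lift ord0 i).-1]/(i : nat).
  by rewrite gez0_abs; [|apply: u_ge; rewrite -ltnS; exact: ltn_ord i].
exists c; split.
  apply/eqP; rewrite -eqz_nat (big_morph Posz PoszD (erefl _)) big_ord_recl c0E.
  by rewrite (eq_bigr _ (fun i _ => cE i)) sum_lattice_floor subrK.
split; last first.
  rewrite (_ : corner _ _ _ = corner (q ^+ 2) d u) //; apply: corner_ext => i id.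
  rewrite -ltnS in id; rewrite /tail_count -[i]/(val (Ordinal id)) -cE.
  by congr (Posz (c _)); apply: val_inj; rewrite /= inordK.
have q3D : 0 < q ^+ 3 * D by rewrite mulr_gt0 //; lra.
have c0R : (c ord0)%:R = n%:R - M%:~R :> R.
  by have := congr1 (fun z : int => z%:~R : R) c0E; rewrite rmorphB.
rewrite /= in_itv /= /tcoord c0R -/q -/t; apply/andP; split.
  by rewrite ler_pdivrMr // mulrC; lra.
by rewrite -{2}[(_ * D)^-1]mul1r -mulrDl ltr_pdivlMr // mulrC; lra.
Unshelve. all: by end_near. Qed.
End cells.

(** * Sums over counts as integrals *)

Section riemann_sums.
Variables (R : realType) (d : nat).
Implicit Types (n : nat) (c : {ffun 'I_d.+2 -> nat}) (y : euclid R d.+1).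

Definition counts n (c : {ffun 'I_d.+2 -> 'I_n.+1}) : {ffun 'I_d.+2 -> nat} :=
  [ffun k => c k : nat].

Lemma counts_surj n (c : {ffun 'I_d.+2 -> nat}) : (\sum_k c k)%N = n ->
  exists2 c' : {ffun 'I_d.+2 -> 'I_n.+1}, (\sum_k c' k)%N = n & counts c' = c.
Proof.
move=> sc; have ck k : (c k < n.+1)%N by rewrite ltnS -sc (bigD1 k) //= leq_addr.
have e : counts [ffun k => Ordinal (ck k)] = c by apply/ffunP => k; rewrite !ffunE.
exists [ffun k => Ordinal (ck k)] => //; rewrite -[RHS]sc; apply: eq_bigr => k _.
by rewrite ffunE.
Qed.

Lemma sum_counts n (c : {ffun 'I_d.+2 -> 'I_n.+1}) : (\sum_k counts c k = \sum_k c k)%N.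
Proof. by apply: eq_bigr => k _; rewrite ffunE. Qed.

Lemma counts_inj n : injective (@counts n).
Proof.
by move=> c c' /ffunP h; apply/ffunP => k; apply: val_inj; have := h k; rewrite !ffunE.
Qed.

Definition v_row n (c : {ffun 'I_d.+2 -> nat}) : 'rV[R]_d.+2 :=
  \row_i (if unlift ord0 i is Some j then vcoord R n c j else 0).

Definition position n c : (R * 'rV[R]_d.+2)%type := (tcoord R n c, v_row n c).

Lemma position_cvg (c : nat -> {ffun 'I_d.+2 -> nat}) (y : euclid R d.+1) :
  tcoord R n (c n) @[n --> \oo] --> (y.1 : R) ->
  (forall i : 'I_d.+1, vcoord R n (c n) i @[n --> \oo] --> helmert y.2 i) ->
  position n (c n) @[n --> \oo] --> tvrow y.
Proof.
move=> ht hv; apply/cvg_ballP => e e0.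
have hv' : \forall n \near \oo, forall k : 'I_d.+1, ball (helmert y.2 k) e (vcoord R n (c n) k).
  by apply: filter_forall => k; have /cvg_ballP := hv k; apply.
near=> n; split => /=.
  by near: n; move/cvg_ballP : ht; apply.
split => // i j; rewrite !mxE.
case: unliftP => [k ->|->] /=; last exact: ballxx.
have hn : forall k : 'I_d.+1, ball (helmert y.2 k) e (vcoord R n (c n) k) by near: n.
exact: hn.
Unshelve. all: by end_near. Qed.

Variables (beta h : nat -> R) (g : (R * 'rV[R]_d.+2)%type -> R) (Mg : R).
Hypotheses (g0 : forall x, 0 <= g x) (gM : forall x, g x <= Mg) (cg : continuous g).

Definition weighted_sum n : R :=
  \sum_(c : {ffun 'I_d.+2 -> 'I_n.+1} | (\sum_k c k == n)%N)
     local_density (beta n) (h n) n (counts c) * g (position n (counts c)).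

(** The indicators have disjoint supports, so this is the step function whose
    value on a cell is the weight of its count vector. *)
Definition step n (y : euclid R d.+1) : R :=
  \sum_(c : {ffun 'I_d.+2 -> 'I_n.+1} | (\sum_k c k == n)%N)
     local_density (beta n) (h n) n (counts c) * g (position n (counts c)) *
     \1_(cell n (counts c)) y.

Let ld_ge0 n (c : {ffun 'I_d.+2 -> nat}) : 0 <= local_density (beta n) (h n) n c :> R.
Proof.
rewrite mulr_ge0 ?expR_ge0 //; apply: prodr_ge0 => k _.
by rewrite mulr_ge0 ?sqrtr_ge0 // invr_ge0 ltW // stirling_ratio_gt0.
Qed.

Lemma step_cell n c y : (0 < n)%N -> (\sum_k c k)%N = n -> cell n c y ->
  step n y = local_density (beta n) (h n) n c * g (position n c).
Proof.
move=> n0 sc yc; have [c' sc' c'E] := counts_surj sc.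
rewrite /step (bigD1 c') ?sc' ?eqxx //= c'E indicE mem_set // mulr1.
rewrite big1 ?addr0 // => b /andP[/eqP sb bc'].
rewrite indicE memNset ?mulr0 // => yb; move/eqP: bc'; apply.
apply: counts_inj; rewrite c'E; apply: (cell_inj n0 _ sc yb yc).
by rewrite sum_counts.
Qed.

Lemma step_out n y : ~ (exists c, (\sum_k c k)%N = n /\ cell n c y) -> step n y = 0.
Proof.
move=> hc; rewrite /step big1 // => c /eqP sc; rewrite indicE memNset ?mulr0 // => yc.
by apply: hc; exists (counts c); rewrite sum_counts.
Qed.

Let term_ge0 n c y : 0 <= local_density (beta n) (h n) n c * g (position n c) * \1_(cell n c) y.
Proof. by apply: mulr_ge0; [exact: mulr_ge0|rewrite indicE]. Qed.

Lemma step_ge0 n y : 0 <= step n y.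
Proof. by apply: sumr_ge0. Qed.

Lemma measurable_step n : measurable_fun setT (step n : _ -> measurableTypeR R).
Proof.
rewrite /step; under eq_fun do rewrite -big_filter.
apply: measurable_sum => c; apply: measurable_funM; first exact: measurable_cst.
by apply: measurable_indic; exact: measurable_cell.
Qed.

Lemma integral_step n : (0 < n)%N ->
  (\int[vol R d.+1]_y (step n y)%:E = (cell_volume R d n * weighted_sum n)%:E)%E.
Proof.
move=> n0; rewrite /step /weighted_sum mulr_sumr -big_filter.
under eq_integral do rewrite -big_filter -sumEFin.
rewrite ge0_integral_sum //; last 2 first.
- move=> c; apply/measurable_EFinP; apply: measurable_funM; first exact: measurable_cst.
  by apply: measurable_indic; exact: measurable_cell.
- by move=> c y _; rewrite lee_fin.
rewrite -sumEFin; apply: eq_bigr => c _.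
under eq_integral do rewrite EFinM.
rewrite ge0_integralZl_EFin //; last 2 first.
- by apply/measurable_EFinP; apply: measurable_indic; exact: measurable_cell.
- exact: mulr_ge0.
rewrite integral_indic //; last exact: measurable_cell.
rewrite setIT [in RHS]mulrC [in RHS]EFinM; congr (_ * _)%E; exact: vol_cell.
Qed.
Hypothesis beta_rate : rate_condition beta (beta0 R d.+2).
Hypothesis h_rate : rate_condition h (h0 R d.+2).

Lemma step_dominated : exists C k N, [/\ 0 < k :> R &
  forall n y, (N <= n)%N -> step n y <= C * expR (- (k * sqnorm y))].
Proof.
have [e [C [k [e0 C0 k0 hC]]]] := local_density_le R d.
have [N1 _ hN1] := beta_rate e0; have [N2 _ hN2] := h_rate e0.
exists (C * expR (k * d.+1%:R) * Mg), (k / 2), (maxn 1 (maxn N1 N2)); split; first lra.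
move=> n y; rewrite !geq_max => /and3P[n0 n1 n2].
have Mg0 : 0 <= Mg by exact: le_trans (g0 (0, 0)) (gM _).
have [[c [sc yc]]|hc] := pselect (exists c, (\sum_k c k)%N = n /\ cell n c y); last first.
  by rewrite step_out // !mulr_ge0 ?expR_ge0 // ltW.
rewrite (step_cell n0 sc yc).
have hh := hC _ _ _ _ n0 sc (hN1 n n1) (hN2 n n2).
apply: le_trans (ler_pM (ld_ge0 _ _) (g0 _) hh (gM _)) _.
rewrite [leRHS]mulrAC; apply: ler_wpM2r => //.
rewrite -[leRHS]mulrA -expRD; apply: ler_wpM2l; first exact: ltW.
rewrite ler_expR; have := cell_sqnorm n0 sc yc.
move/(ler_wpM2l (ltW k0)); move: (sqnorm y) (_ + vnorm2 _ _ _) => s v.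
by rewrite mulrDr; lra.
Qed.

Lemma step_cvg K y : density_limit d K ->
  step n y @[n --> \oo] --> K * limit_weight y * g (tvrow y).
Proof.
move=> hK.
have cov := @cell_cover R d y.
pose c n := match pselect (exists c, (\sum_k c k)%N = n /\ cell n c y) with
            | left p => projT1 (cid p) | right _ => [ffun=> 0%N] end.
have cP : \forall n \near \oo, (\sum_k c n k)%N = n /\ cell n (c n) y.
  apply: filterS cov => n hn; rewrite /c; case: pselect => // p.
  by case: cid.
have n_gt0 : \forall n \near \oo, (0 < n)%N by exact: nbhs_infty_gt.
have qV := @qroot_cvgV R.
have ht : tcoord R n (c n) @[n --> \oo] --> (y.1 : R).
  apply/cvgrPdist_le => e e0; near=> n.
  have n0 : (0 < n)%N by near: n.
  have [sc yc] : (\sum_k c n k)%N = n /\ cell n (c n) y by near: n.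
  apply: le_trans (cell_tcoord n0 yc) _.
  by apply: ltW; near: n; exact: (cvgr_lt _ qV).
have hv (i : 'I_d.+1) : vcoord R n (c n) i @[n --> \oo] --> helmert y.2 i.
  have dqV : d%:R * (qroot R n)^-1 @[n --> \oo] --> (0 : R).
    by rewrite -(mulr0 d%:R); apply: cvgMr.
  apply/cvgrPdist_le => e e0; near=> n.
  have n0 : (0 < n)%N by near: n.
  have [sc yc] : (\sum_k c n k)%N = n /\ cell n (c n) y by near: n.
  apply: le_trans (cell_vcoord i n0 sc yc) _.
  by apply: ltW; near: n; exact: (cvgr_lt _ dqV).
have sc : \forall n \near \oo, (\sum_k c n k)%N = n by apply: filterS cP => n [].
have l1 := hK beta h c y beta_rate h_rate sc ht hv.
have l2 : g (position n (c n)) @[n --> \oo] --> g (tvrow y).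
  have pc := position_cvg ht hv.
  by apply: (@cvg_comp _ _ _ (fun n => position n (c n)) g _ _ _ pc); exact: cg.
have l : local_density (beta n) (h n) n (c n) * g (position n (c n)) @[n --> \oo] -->
    K * limit_weight y * g (tvrow y) by exact: cvgM l1 l2.
apply: cvg_trans l; apply: near_eq_cvg; near=> n.
have n0 : (0 < n)%N by near: n.
have [sn yc] : (\sum_k c n k)%N = n /\ cell n (c n) y by near: n.
by rewrite (step_cell n0 sn yc).
Unshelve. all: by end_near. Qed.

(** Dominated convergence. The constants [K] and [k] will disappear when the
    average is divided by the partition function. *)
Lemma weighted_sum_cvg K k (P : probability (euclid R d.+1) R) :
  density_limit d K -> 0 < K -> 0 < k ->
  has_density P (vol R d.+1) (fun z => k * limit_weight z) ->
  cell_volume R d n * weighted_sum n @[n --> \oo] --> K / k * \int[P]_y g (tvrow y).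
Proof.
move=> hK K0 k0 hP.
have [C [kk [N [kk0 hN]]]] := step_dominated.
(* The domination holds from the index [N] on. *)
pose m0 := maxn N 1.
pose f_ n y : \bar R := (step (n + m0)%N y)%:E.
pose f y : \bar R := (K * limit_weight y * g (tvrow y))%:E.
have mgt : measurable_fun setT ((fun y => g (tvrow y)) : _ -> measurableTypeR R).
  exact: measurableT_comp (continuous_borel_real cg) (@measurable_tvrow R d).
have [] := @dominated_convergence _ _ R (vol R d.+1) setT measurableT f_ f
  (fun y => (C * expR (- (kk * sqnorm y)))%:E).
- by move=> n; apply/measurable_EFinP; exact: measurable_step.
- apply/measurable_EFinP; apply: measurable_funM => //; apply: measurable_funM => //.
  exact: measurable_limit_weight.
- apply/nearW => y _; rewrite /f_ /f; apply: cvg_EFin.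
    exact: nearW.
  rewrite (_ : fine \o _ = fun n => step (n + m0)%N y) //.
  by have := step_cvg (y := y) hK; rewrite -(cvg_shiftn m0).
- under eq_fun do rewrite EFinM.
  by apply: integrableZl => //; exact: integrable_vol_gauss_weight.
- apply/nearW => y n _; rewrite /f_ /= lee_fin ger0_norm ?step_ge0 //.
  by apply: hN; rewrite (leq_trans (leq_maxl N 1)) // leq_addl.
move=> fi _ lim.
have fE : (\int[vol R d.+1]_y f y = (K / k)%:E * \int[P]_y (g (tvrow y))%:E)%E.
  rewrite hP; last 2 first.
  - exact/measurable_EFinP.
  - by move=> y; rewrite lee_fin.
  rewrite -ge0_integralZl_EFin //; first last.
  - by rewrite divr_ge0 // ltW.
  - apply/measurable_EFinP; apply: measurable_funM => //; apply: measurable_funM => //.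
    exact: measurable_limit_weight.
  - move=> y _; rewrite lee_fin; apply: mulr_ge0 => //; apply: mulr_ge0; first exact: ltW.
    exact: expR_ge0.
  apply: eq_integral => y _; rewrite /f -!EFinM; congr (_%:E).
  by field; rewrite gt_eqF.
have gP : (\int[P]_y (g (tvrow y))%:E)%E \is a fin_num.
  apply: integrable_fin_num => //; apply: (bounded_integrable P mgt).
  by exists Mg => y; rewrite ger0_norm.
rewrite -(cvg_shiftn m0).
have lim2 : (cell_volume R d (n + m0)%N * weighted_sum (n + m0)%N)%:E @[n --> \oo] -->
    (K / k * \int[P]_y g (tvrow y))%:E.
  rewrite EFinM /Rintegral fineK // -fE.
  apply: cvg_trans lim; apply: near_eq_cvg; apply: nearW => n /=.
  rewrite integral_step //; by rewrite addn_gt0 /m0 leq_max !orbT.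
exact: fine_cvg lim2.
Qed.
End riemann_sums.

(** * Convergence of expectations *)

Section potts_expectation.
Variables (R : realType) (d : nat).

Lemma rate_condition_littleo (u : nat -> R) (l : R) :
  (fun n => u n - l) =o_\oo (fun n => n%:R `^ (- (3 / 4)) : R) -> rate_condition u l.
Proof.
move/eqoP => ho e e0; have := ho e e0; apply: filterS2 (nbhs_infty_gt 0) => n n0.
have q0 := qroot_gt0 R n0.
rewrite powRN_three_quarters // => hn.
rewrite -(qroot4 R n0); apply: le_trans (ler_wpM2l _ hn) _; first by rewrite exprn_ge0 // ltW.
have -> : `|(qroot R n ^+ 3)^-1| = (qroot R n ^+ 3)^-1.
  by rewrite ger0_norm // invr_ge0 exprn_ge0 // ltW.
suff -> : qroot R n ^+ 4 * (e * (qroot R n ^+ 3)^-1) = e * qroot R n by [].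
by field; rewrite gt_eqF.
Qed.

Definition occupation n (s : config n d.+2) : {ffun 'I_d.+2 -> nat} := [ffun k => occurrences s k].

Lemma sum_occupation n (s : config n d.+2) : (\sum_k occupation s k)%N = n.
Proof. by rewrite -[RHS](sum_occurrences s); apply: eq_bigr => k _; rewrite ffunE. Qed.

Let sum_vcoord n (c : {ffun 'I_d.+2 -> nat}) : (\sum_k c k)%N = n ->
  \sum_i vcoord R n c i = 0.
Proof.
move=> sc; rewrite -mulr_suml sumrB sumr_const card_ord.
rewrite -(mulr_natr ((n%:R - (c ord0)%:R) / _)) divfK ?pnatr_eq0 //.
have : \sum_k (c k)%:R = n%:R :> R by rewrite -natr_sum sc.
by rewrite big_ord_recl => <-; rewrite addrAC subrr add0r subrr mul0r.
Qed.

Lemma TV_decomposition_position n (s : config n d.+2) : (0 < n)%N ->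
  TV_decomposition s (tcoord R n (occupation s)) (v_row R n (occupation s)).
Proof.
move=> n0; have q0 := qroot_gt0 R n0; set c := occupation s.
have sc : (\sum_k c k)%N = n := sum_occupation s.
have v0 : v_row R n c 0 ord0 = 0 by rewrite mxE unlift_none.
have vi i : v_row R n c 0 (lift ord0 i) = vcoord R n c i by rewrite mxE liftK.
have dq : d.+2%:R - 1 = d.+1%:R :> R by rewrite -[d.+2%:R]natr1 addrK.
split; first split => /=.
- rewrite /hyperplane /= big_ord_recl v0 add0r (eq_bigr _ (fun i _ => vi i)).
  exact: sum_vcoord.
- rewrite /orthogonal_to /dot /= big_ord_recl v0 mul0r add0r.
  rewrite (eq_bigr (fun i => vcoord R n c i)) ?sum_vcoord // => i _.
  by rewrite vi mxE /= mulr1.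
- rewrite powR_three_quarters // powR_half //; apply/rowP => k.
  have -> : empirical s 0 k = (c k)%:R :> R.
    by rewrite mxE ffunE /occurrences natr_sum.
  rewrite !mxE; have [i ->|->] := unliftP ord0 k.
    rewrite /= dq /tcoord /vcoord -(qroot4 R n0).
    by field; rewrite gt_eqF //= gt_eqF.
  rewrite /= mulr0 addr0 /tcoord -(qroot4 R n0).
  rewrite (_ : 1 - d.+2%:R = - d.+1%:R); last by rewrite -dq opprB.
  by field; rewrite gt_eqF //= gt_eqF.
Qed.

Variables (T : forall n, config n d.+2 -> R) (V : forall n, config n d.+2 -> 'rV[R]_d.+2).
Hypothesis TV : forall n (s : config n d.+2), (0 < n)%N -> TV_decomposition s (T s) (V s).

Lemma TV_position n (s : config n d.+2) : (0 < n)%N ->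
  (T s, V s) = position R n (occupation s).
Proof.
move=> n0; have [tv [_ u]] := @TV_decomposition_unique R d.+2 n s isT n0.
rewrite -(u (T s, V s)); last exact: TV.
by apply: (u (_, _)); exact: TV_decomposition_position.
Qed.

Variables (beta h : nat -> R).

Definition gibbs_average (g : (R * 'rV[R]_d.+2)%type -> R) n : R :=
  \sum_(s : config n d.+2) potts_mu (beta n) (h n) s * g (T s, V s).

Let one : (R * 'rV[R]_d.+2)%type -> R := fun=> 1.

(** The factor of [multinomial_weight] is common to the numerator and to the
    partition function. *)
Lemma gibbs_average_ratio g n : (0 < n)%N ->
  gibbs_average g n = weighted_sum beta h g n / weighted_sum beta h one n.
Proof.
move=> n0; have [K K0 hK] := @multinomial_weight R d (beta n) (h n) n n0.
have S g' : \sum_(s : config n d.+2) expR (potts_energy (beta n) (h n) s) *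
    g' (position R n (occupation s)) = K * weighted_sum beta h g' n.
  pose F (c : {ffun 'I_d.+2 -> nat}) := count_weight (beta n) (h n) n c * g' (position R n c).
  transitivity (\sum_(s : config n d.+2) F [ffun k => occurrences s k]).
    by apply: eq_bigr => s _; rewrite potts_energy_occurrences.
  rewrite (sum_config_occurrences n F) /F /weighted_sum mulr_sumr; apply: eq_bigr => c /eqP sc.
  rewrite [RHS]mulrA -hK ?sum_counts // [LHS]mulrA; congr (_ / _ * _ * _).
  by apply: eq_bigr => k _; rewrite ffunE.
have Z : @potts_Z R d.+2 (beta n) (h n) n = K * weighted_sum beta h one n :> R.
  by rewrite -S /potts_Z; apply: eq_bigr => s _; rewrite mulr1.
rewrite /gibbs_average /potts_mu.
under eq_bigr do rewrite TV_position // -mulrA.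
by rewrite -mulr_sumr S Z invfM mulrACA mulVf ?gt_eqF // mul1r mulrC.
Qed.

Hypothesis beta_rate : rate_condition beta (beta0 R d.+2).
Hypothesis h_rate : rate_condition h (h0 R d.+2).
Variables (k : R) (P : probability (euclid R d.+1) R).
Hypotheses (k0 : 0 < k)
  (hP : has_density P (vol R d.+1) (fun z => k * limit_weight z)).

Let Rintegral_cst_prob (x : R) : \int[P]_y x = x.
Proof. by rewrite /Rintegral integral_cst //= probability_setT mule1. Qed.

Let gibbs_average_cvg_ge0 (g : (R * 'rV[R]_d.+2)%type -> R) (M : R) : (forall x, 0 <= g x) -> (forall x, g x <= M) ->
  continuous g -> gibbs_average g n @[n --> \oo] --> \int[P]_y g (tvrow y).
Proof.
move=> g0 gM cg; have [K K0 hK] := local_density_cvg R d.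
have l1 := weighted_sum_cvg g0 gM cg beta_rate h_rate hK K0 k0 hP.
have cst1 : continuous (fun _ : (R * 'rV[R]_d.+2)%type => 1 : R).
  by move=> x; exact: cvg_cst.
have l2 := weighted_sum_cvg (fun _ => ler01) (fun _ => lexx 1) cst1 beta_rate h_rate hK K0 k0 hP.
rewrite Rintegral_cst_prob mulr1 in l2.
have Kk : K / k != 0 by rewrite mulf_neq0 ?invr_eq0 ?gt_eqF.
have l : (cell_volume R d n * weighted_sum beta h g n) *
    (cell_volume R d n * weighted_sum beta h one n)^-1 @[n --> \oo] -->
    (K / k * \int[P]_y g (tvrow y)) * (K / k)^-1.
  by apply: cvgM => //; apply: cvgV.
rewrite mulrAC divff // mul1r in l.
apply: cvg_trans l; apply: near_eq_cvg.
apply: filterS (nbhs_infty_gt 0) => n n0.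
have c0 := cell_volume_gt0 R d n0.
by rewrite gibbs_average_ratio // invfM mulrACA divff ?gt_eqF // mul1r.
Qed.

(** Adding a constant to [g] reduces the claim to nonnegative functions. *)
Lemma gibbs_average_cvg (g : (R * 'rV[R]_d.+2)%type -> R) : continuous g -> (exists M, forall x, `|g x| <= M) ->
  gibbs_average g n @[n --> \oo] --> \int[P]_y g (tvrow y).
Proof.
move=> cg [M gM].
have M0 : 0 <= M by exact: le_trans (normr_ge0 _) (gM (0, 0)).
pose g' x := g x + M.
have cg' : continuous g' by move=> x; apply: cvgD; [exact: cg|exact: cvg_cst].
have g'0 x : 0 <= g' x by have := gM x; rewrite ler_norml /g' => /andP[]; lra.
have g'M x : g' x <= 2 * M by have := gM x; rewrite ler_norml /g' => /andP[]; lra.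
have l1 := gibbs_average_cvg_ge0 g'0 g'M cg'.
have cstM : continuous (fun _ : (R * 'rV[R]_d.+2)%type => M : R).
  by move=> x; exact: cvg_cst.
have l2 := gibbs_average_cvg_ge0 (fun=> M0) (fun=> lexx M) cstM.
rewrite Rintegral_cst_prob in l2.
have ig : P.-integrable setT (EFin \o (fun y => g (tvrow y))).
  apply: bounded_integrable; last by exists M => y.
  exact: measurableT_comp (continuous_borel_real cg) (@measurable_tvrow R d).
have iM : P.-integrable setT (EFin \o (fun _ : euclid R d.+1 => M)).
  exact: finite_measure_integrable_cst.
have e : \int[P]_y g' (tvrow y) = \int[P]_y g (tvrow y) + M.
  by rewrite /g' RintegralD // Rintegral_cst_prob.
have l : gibbs_average g' n - gibbs_average (fun=> M) n @[n --> \oo] -->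
    \int[P]_y g' (tvrow y) - M by exact: cvgB.
rewrite e addrK in l; apply: cvg_trans l; apply: near_eq_cvg; apply: nearW => n.
rewrite /gibbs_average -sumrB; apply: eq_bigr => s _.
by rewrite -mulrBr /g' addrK.
Qed.
End potts_expectation.

Theorem theorem3p7 (R : realType) (q : nat) (hq : (2 <= q)%N)
  (beta h : nat -> R)
  (beta_cvg : beta n @[n --> \oo] --> beta0 R q)
  (h_cvg : h n @[n --> \oo] --> h0 R q)
  (beta_rate : (fun n => beta n - beta0 R q) =o_\oo
               (fun n => n%:R `^ (- (3 / 4)) : R))
  (h_rate : (fun n => h n - h0 R q) =o_\oo
            (fun n => n%:R `^ (- (3 / 4)) : R))
  (T : forall n, config n q -> R)
  (V : forall n, config n q -> 'rV[R]_q)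
  (TV : forall n (s : config n q), (0 < n)%N ->
        TV_decomposition s (T n s) (V n s)) :
  let mu := fun n => @potts_mu R q (beta n) (h n) n in
  unique_minimizer simplex (free_energy (beta0 R q) (h0 R q)) (@x_star R q) /\
  exists (L : probability (borel (R * 'rV[R]_q)%type) R)
         (LT : probability (borel R) R)
         (LV : probability (borel 'rV[R]_q) R),
    [/\ cvg_in_law mu (fun n s => (T n s, V n s)) L,
        product_law L LT LV,
        cvg_in_law mu T LT /\
        proportional_density LT
          (fun t => expR (- (4 * (q%:R - 1) ^+ 4 / 3 * t ^+ 4))) &
        [/\ cvg_in_law mu V LV,
            centered_gaussian LV V_covariance &
            \rank (@V_covariance R q) = (q - 2)%N]].
Proof.
case: q hq => [//|[//|d]] _ in beta_cvg h_cvg beta_rate h_rate T V TV *.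
move=> mu; split; first exact: unique_minimizer_x_star.
have [P [k [mP [LT [k0 prodL dens]]]]] := limit_laws R d.
pose L := image_law P (@measurable_tvrow R d).
have hb := rate_condition_littleo beta_rate; have hh := rate_condition_littleo h_rate.
have joint : cvg_in_law mu (fun n s => (T n s, V n s)) L.
  move=> g cg gM; rewrite Rintegral_image_law //.
  exact: (gibbs_average_cvg TV hb hh k0 mP cg gM).
exists L, LT, (V_law R d); split => //.
- split.
    move=> g cg gM; rewrite -(product_law_fst prodL cg gM).
    apply: (joint (fun x => g x.1)); last by case: gM => M hM; exists M.
    move=> x; apply: continuous_comp; [exact: cvg_fst|exact: cg].
  by have <- : d.+1%:R = d.+2%:R - 1 :> R by rewrite -[d.+2%:R]natr1 addrK.
- split.
  + move=> g cg gM; rewrite -(product_law_snd prodL cg gM).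
    apply: (joint (fun x => g x.2)); last by case: gM => M hM; exists M.
    move=> x; apply: continuous_comp; [exact: cvg_snd|exact: cg].
  + by split; [exact: V_law_gaussian_vector|exact: V_law_expectation|exact: V_law_covariance].
  + by rewrite rank_V_covariance subn2.
Qed.
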